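(* In the situation described in the context (in particular, with the morphism $F$, the primitive vector $v'=(v,w_0)$, the weights $w_i=\langle u_i,v\rangle$ and the morphism $\varphi_{v'}$), the following hold. (1) Consider the affine faithfully flat family $\tilde{\mathcal{X}}_F\to\widetilde{\mathrm{ST}}_{\mathbb{C}[[t]]}(\tau')$ corresponding to $F$, and let $\mathcal{X}_{v'}\to\operatorname{Spec}\mathbb{C}[[s]]$ be its base change by $\varphi_{v'}$. If $w_0=1$, then $\mathcal{X}_{v'}$ is a Zariski open subscheme of the weighted blow up of $\mathcal{X}$ for the weights $(w_0=1,w_1,\dots,w_l)$; this open chart is obtained by removing the strict transform of the central fiber. For general $w_0\ge1$, $\mathcal{X}_{v'}$ is the normalization of the base change of the weighted blow up of $\mathcal{X}$ for the weights $(w_0,w_1,\dots,w_l)$ with respect to the $w_0$-th power map $\operatorname{Spec}\mathbb{C}[[s]]\to\operatorname{Spec}\mathbb{C}[[t]]$, $t\mapsto s^{w_0}$. (2) The negative weight deformation (affine test configuration) $\mathcal{W}$ obtained as the restriction of $\tilde{\mathcal{X}}_F\to\widetilde{\mathrm{ST}}_{\mathbb{C}[[t]]}(\tau')$ to the one-dimensional toric stratum $\mathbb{A}^1\simeq V(\tau')\subset\widetilde{\mathrm{ST}}_{\mathbb{C}[[t]]}(\tau')$ coincides with $$\mathcal{W}=\operatorname{Spec}(\mathrm{gr}_{(w_0,\dots,w_l)}(\mathcal{O}_{\mathcal{X},x}))\to\mathbb{A}^1.$$ Hence $\mathcal{W}$ is the affine cone of the exceptional divisor of the weighted blow up appearing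 in (1).
   Context: Everything is over $\mathbb{C}$. Setting: $\Delta$ is a smooth affine curve (germ) with closed point $0$ and uniformizer $t$; $\pi\colon\mathcal{X}\to\Delta$ is a flat affine surjective Gorenstein morphism of varieties of relative dimension $n$ such that $K_{\mathcal X}$ is Cartier and every fiber is log terminal (and Gorenstein); $X:=\pi^{-1}(0)$; $\sigma$ is a section, $x=\sigma(0)$; $\mathcal{X}_{\mathbb{C}[[t]]}=\mathcal{X}\times_\Delta\operatorname{Spec}\mathbb{C}[[t]]$. The family is strictly degenerating: $\widehat{\mathrm{vol}}_{\mathcal{X}_0}(\sigma(0))<\widehat{\mathrm{vol}}_{\mathcal{X}_t}(\sigma(t))$ for $t\neq0$, where $\widehat{\mathrm{vol}}$ is the minimal normalized volume $\min_vA(v)^n\mathrm{vol}(v)$ over valuations centered at the point. $v_X$ is the minimizing valuation at $x\in X$, $M$ the group generated by $\mathrm{Im}(v_X)$, $N=M^*$, $T=N\otimes\mathbb{G}_m$, and $W=\operatorname{Spec}(\mathrm{gr}_{v_X}\mathcal{O}_{X,x})$ with its $T$-action. $\mathcal{X}$ is embedded in $\Delta\times\mathbb{A}^l$ with $\sigma(\Delta)$ the zero section; $T$ acts linearly on $\mathbb{A}^l$, the coordinate $z_i$ having character $u_i\in M$; $W\subset\mathbb{A}^l$ is $T$-invariant and is the initial degeneration of $X\subset\mathbb{A}^l$. The construction of the semistable minimal bubble of $(\mathcal{X},\sigma)$ (a modification $\mathcal{X}'_{\min}$ of $\mathcal{X}$ along the central fiber whose central fiber $\mathcal{X}'_{\min,0}$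 is log terminal Gorenstein and a negative weight deformation of $W$, with $\widehat{\mathrm{vol}}$ at the marked point larger than $\widehat{\mathrm{vol}}_X(x)$) is carried out by applying a semistable reduction theorem, possibly after finite base change of $\Delta$ which we assume already made, and produces the following data. - A regular rational polyhedral cone $\tau\subset N_{\mathbb{R}}$ of full dimension, on whose relative interior all $u_i$ are positive, such that for every integral $v\in\mathrm{relint}(\tau)$ the initial degeneration of $X$ with respect to the weights $\langle u_i,v\rangle$ is $W$; an element $m\in M$ in the interior of $\tau^\vee$; and the cone $\tau'=\{(v,\langle m,v\rangle)\mid v\in\tau\}\subset N_{\mathbb{R}}\oplus\mathbb{R}$, with normal vector $(-m,1)$. - $\widetilde{\mathrm{ST}}_{\mathbb{C}[[t]]}(\tau'):=\operatorname{Spec}\bigl(\mathbb{C}[[t]][\tau^\vee\cap M][\mathsf{X}]/(t-\mathsf{X}\chi^m)\bigr)$, with $\mathsf{X}$ a new variable and $\chi^u$ the character for $u\in M$; $T$ acts with $t$ invariant. $V(\tau')\cong\mathbb{A}^1$ is the stratum where $\chi^u=0$ for all nonzero $u\in\tau^\vee\cap M$, with coordinate $\mathsf{X}$. - A $T$-equivariant morphism $F\colon\widetilde{\mathrm{ST}}_{\mathbb{C}[[t]]}(\tau')\to H$ to a parameter scheme $H$ of closed subschemes of $\mathbb{A}^l$ (with a flat $T$-equivariant universal family), and $\tilde{\mathcal{X}}_F\subset\mathbb{A}^l\times\widetilde{\mathrm{ST}}_{\mathbb{C}[[t]]}(\tau')$ is the corresponding pulled back affine faithfully flat family. Over the open subset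 $T\times\operatorname{Spec}\mathbb{C}[[t]]$ where all $\chi^u$ are invertible, $\tilde{\mathcal{X}}_F$ is $\{(z',g,t)\mid(\chi^{u_1}(g)z'_1,\dots,\chi^{u_l}(g)z'_l)\in\mathcal{X}_t\}$. The fiber over the point $\mathsf{X}=0$ of $V(\tau')$ is $W$ and the fiber over $\mathsf{X}=1$ is $\mathcal{X}'_{\min,0}$; it is a non-trivial negative weight deformation, i.e. $\tilde{\mathcal{X}}_F|_{V(\tau')}\to\mathbb{A}^1$ is a $T$-equivariant affine flat family in which base functions and functions on $W$ have nonnegative weights with respect to the Reeb vector of $W$. Choose a primitive integral vector $v'=(v,w_0)\in\mathrm{relint}(\tau')\cap(N\oplus\mathbb{Z})$, $w_0>0$ (so $v\in\mathrm{relint}(\tau)\cap N$ and $w_0=\langle m,v\rangle$), and put $w_i:=\langle u_i,v\rangle$. The morphism $\varphi_{v'}\colon\operatorname{Spec}\mathbb{C}[[s]]\to\widetilde{\mathrm{ST}}_{\mathbb{C}[[t]]}(\tau')$ is given by $\mathsf{X}\mapsto1$, $\chi^u\mapsto s^{\langle u,v\rangle}$, $t\mapsto s^{w_0}$. The weighted blow up of $\mathcal{X}$ (i.e. of $\mathcal{X}_{\mathbb{C}[[t]]}$) with weights $(w_0,\dots,w_l)$ is its strict transform in the weighted blow up of $\mathbb{A}^l_{\mathbb{C}[[t]]}$ at the origin for the parameters $t,z_1,\dots,z_l$. With $w(f)=\min\{w_0i_0+\sum_jw_ji_j\mid a_{i_0,\dots,i_l}\neq0\}$ for $f=\sum a_{i_0,\dots,i_l}t^{i_0}\prod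 z_j^{i_j}$ and $\overline{f}$ the restriction of $f$ to $\mathcal{X}$, $\mathrm{gr}_{(w_0,\dots,w_l)}(\mathcal{O}_{\mathcal{X},x})=\bigoplus_{\lambda\ge0}\{\overline{f}\mid w(f)\ge\lambda\}/\{\overline{f}\mid w(f)>\lambda\}$, regarded as a family over $\mathbb{A}^1$ with coordinate the class of $t$. *)

(* Defs.v *)
From HB Require Import structures.
From mathcomp Require Import all_boot all_order all_algebra.
From mathcomp Require Import boolp classical_sets reals.
From mathcomp Require Import complex.
From mathcomp Require Import mpoly.

Set Implicit Arguments.
Unset Strict Implicit.
Unset Printing Implicit Defensive.

Import Order.TTheory GRing.Theory Num.Theory.

Local Open Scope ring_scope.
Local Open Scope classical_set_scope.

Record fps (A : Type) := FPS { fcoef : nat -> A }.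

HB.instance Definition _ (A : Type) := gen_eqMixin (fps A).
HB.instance Definition _ (A : Type) := gen_choiceMixin (fps A).

Section FpsRing.
Variable A : comNzRingType.
Implicit Types f g h : fps A.

Lemma fpsP f g : (forall i, fcoef f i = fcoef g i) -> f = g.
Proof. by case: f => f; case: g => g /= fg; congr FPS; apply/funext. Qed.

Definition fps0 : fps A := FPS (fun=> 0).
Definition fps1 : fps A := FPS (fun i => (i == 0%N)%:R).
Definition fpsX : fps A := FPS (fun i => (i == 1%N)%:R).
Definition fps_opp f : fps A := FPS (fun i => - fcoef f i).
Definition fps_add f g : fps A := FPS (fun i => fcoef f i + fcoef g i).
Definition fps_mul f g : fps A :=
  FPS (fun n => \sum_(i < n.+1) fcoef f i * fcoef g (n - i)%N).
Definition fps_scale (a : A) f : fps A := FPS (fun i => a * fcoef f i).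

Fact fps_addA : associative fps_add.
Proof. by move=> f g h; apply: fpsP => i /=; rewrite addrA. Qed.
Fact fps_addC : commutative fps_add.
Proof. by move=> f g; apply: fpsP => i /=; rewrite addrC. Qed.
Fact fps_add0 : left_id fps0 fps_add.
Proof. by move=> f; apply: fpsP => i /=; rewrite add0r. Qed.
Fact fps_addN : left_inverse fps0 fps_opp fps_add.
Proof. by move=> f; apply: fpsP => i /=; rewrite addNr. Qed.

HB.instance Definition _ := GRing.isZmodule.Build (fps A)
  fps_addA fps_addC fps_add0 fps_addN.

Definition fps_trunc n f : {poly A} := \poly_(i < n) fcoef f i.

Lemma coef_fps_mul n i f g : (i < n)%N ->
  fcoef (fps_mul f g) i = (fps_trunc n f * fps_trunc n g)`_i.
Proof.
move=> lt_in; rewrite coefM /=; apply: eq_bigr => j _; rewrite !coef_poly.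
have lt_jn : (j < n)%N by apply: leq_trans (ltn_ord j) lt_in.
by rewrite lt_jn (leq_ltn_trans (leq_subr j i) lt_in).
Qed.

Lemma coef_trunc_mul n i f g (p : {poly A}) : (i < n)%N ->
  (fps_trunc n (fps_mul f g) * p)`_i =
  (fps_trunc n f * fps_trunc n g * p)`_i.
Proof.
move=> lt_in; rewrite !coefM; apply: eq_bigr => j _.
have lt_jn : (j < n)%N by apply: leq_trans (ltn_ord j) lt_in.
by rewrite {1}coef_poly lt_jn (coef_fps_mul _ _ lt_jn).
Qed.

Fact fps_mulC : commutative fps_mul.
Proof.
by move=> f g; apply: fpsP => i; rewrite !(coef_fps_mul _ _ (ltnSn i)) mulrC.
Qed.
Fact fps_mulA : associative fps_mul.
Proof.
move=> f g h; apply: fpsP => i.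
rewrite (fps_mulC f) !(coef_fps_mul _ _ (ltnSn i)).
by rewrite !(coef_trunc_mul _ _ _ (ltnSn i)) mulrC mulrA.
Qed.
Fact fps_mul1 : left_id fps1 fps_mul.
Proof.
move=> f; apply: fpsP => i; rewrite /= big_ord_recl /= subn0 mul1r.
by rewrite big1 ?addr0 // => j _; rewrite mul0r.
Qed.
Fact fps_mulDl : left_distributive fps_mul +%R.
Proof.
move=> f g h; apply: fpsP => i /=; rewrite -big_split /=.
by apply: eq_bigr => j _; rewrite mulrDl.
Qed.
Fact fps_1neq0 : fps1 != 0 :> fps A.
Proof.
by apply/eqP => /(congr1 (fun f => fcoef f 0%N)) /= /eqP; rewrite oner_eq0.
Qed.

HB.instance Definition _ := GRing.Zmodule_isComNzRing.Build (fps A)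
  fps_mulA fps_mulC fps_mul1 fps_mulDl fps_1neq0.

Fact fps_scaleA a b f : fps_scale a (fps_scale b f) = fps_scale (a * b) f.
Proof. by apply: fpsP => i /=; rewrite mulrA. Qed.
Fact fps_scale1 : left_id 1 fps_scale.
Proof. by move=> f; apply: fpsP => i /=; rewrite mul1r. Qed.
Fact fps_scaleDr : right_distributive fps_scale +%R.
Proof. by move=> a f g; apply: fpsP => i /=; rewrite mulrDr. Qed.
Fact fps_scaleDl f : {morph fps_scale^~ f : a b / a + b}.
Proof. by move=> a b; apply: fpsP => i /=; rewrite mulrDl. Qed.

HB.instance Definition _ := GRing.Zmodule_isLmodule.Build A (fps A)
  fps_scaleA fps_scale1 fps_scaleDr fps_scaleDl.

Fact fps_scaleAl (a : A) f g : a *: (f * g) = (a *: f) * g.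
Proof.
apply: fpsP => i /=; rewrite mulr_sumr.
by apply: eq_bigr => j _; rewrite mulrA.
Qed.

HB.instance Definition _ := GRing.Lmodule_isLalgebra.Build A (fps A) fps_scaleAl.
HB.instance Definition _ := GRing.Lalgebra_isComAlgebra.Build A (fps A).

End FpsRing.

Section CommutativeAlgebra.

Definition ideal (A : comNzRingType) (I : set A) :=
  [/\ I 0, forall x y, I x -> I y -> I (x + y) & forall a x, I x -> I (a * x)].

Definition prime_ideal (A : comNzRingType) (p : set A) :=
  [/\ ideal p, ~ p 1 & forall a b, p (a * b) -> p a \/ p b].

Definition ideal_gen (A : comNzRingType) (G : set A) : set A :=
  [set x | exists (k : nat) (c g : 'I_k -> A),
     (forall i, G (g i)) /\ x = \sum_i c i * g i].

Definition is_quotient (A B : comNzRingType) (I : set A) (q : {rmorphism A -> B}) :=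
  (forall b, exists a, q a = b) /\ (forall a, q a = 0 <-> I a).

Definition nonzerodiv (A : comNzRingType) (a : A) := forall b, a * b = 0 -> b = 0.

(* [E / I] is flat over [A]: every linear relation in [E / I] with
   coefficients in [A] is a consequence of relations holding in [A]. *)
Definition flat_quotient (A : comNzRingType) (E : lmodType A) (I : set E) :=
  forall (k : nat) (a : 'I_k -> A) (b : 'I_k -> E), I (\sum_i a i *: b i) ->
  exists (p : nat) (c : 'M[A]_(k, p)) (b' : 'I_p -> E),
    (forall i, I (b i - \sum_j c i j *: b' j)) /\
    (forall j, \sum_i a i * c i j = 0).

(* Surjectivity of Spec (A[z_1, ..., z_l] / I) -> Spec A. *)
Definition surjective_quotient (A : comNzRingType) (l : nat) (I : set {mpoly A[l]}) :=
  forall p : set A, prime_ideal p ->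
  exists P : set {mpoly A[l]},
    [/\ prime_ideal P, I `<=` P & forall a, P a%:MP <-> p a].

(* [A] is integrally closed in its total ring of fractions; the displayed
   relation is an integral equation for [a / b], with denominators cleared. *)
Definition integrally_closed (A : comNzRingType) :=
  forall a b : A, nonzerodiv b ->
  (exists d (c : 'I_d -> A), a ^+ d + \sum_i c i * a ^+ i * b ^+ (d - i) = 0) ->
  exists x, a = b * x.

(* [nu] exhibits [B] as the integral closure of [A] in its total ring of
   fractions. *)
Definition is_normalization (A B : comNzRingType) (nu : {rmorphism A -> B}) :=
  [/\ injective nu,
      forall y, exists d (c : 'I_d -> A), y ^+ d + \sum_i nu (c i) * y ^+ i = 0,
      forall y, exists s a, [/\ nonzerodiv s, nonzerodiv (nu s) & nu s * y = nu a]
    & integrally_closed B].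

(* Cocartesian square: Spec [B'] = Spec [B] x_(Spec [A]) Spec [A']. *)
Definition is_base_change (A A' B B' : comNzRingType) (f : A -> B) (g : A -> A')
    (j : {rmorphism B -> B'}) (j' : {rmorphism A' -> B'}) :=
  (forall a, j (f a) = j' (g a)) /\
  forall (D : comNzRingType) (h : {rmorphism B -> D}) (h' : {rmorphism A' -> D}),
    (forall a, h (f a) = h' (g a)) ->
    exists k : {rmorphism B' -> D},
      [/\ forall x, k (j x) = h x, forall x, k (j' x) = h' x
        & forall k' : {rmorphism B' -> D},
            (forall x, k' (j x) = h x) -> (forall x, k' (j' x) = h' x) -> k' =1 k].

(* [G] is the graded ring with homogeneous components S_i / K_i, where [S] is a
   multiplicative family of subgroups of [A] and [sym i] : S_i -> G is the class
   map in degree [i]. *)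
Definition graded_quotient (T : nmodType) (A G : comNzRingType)
    (S K : T -> set A) (sym : T -> A -> G) :=
  [/\ forall i a b, S i a -> S i b -> sym i (a + b) = sym i a + sym i b,
      forall i a, S i a -> (sym i a = 0 <-> K i a),
      sym 0 1 = 1 /\
      forall i j a b, S i a -> S j b -> sym (i + j) (a * b) = sym i a * sym j b,
      forall g, exists (s : seq T) (a : T -> A),
        [/\ uniq s, {in s, forall i, S i (a i)} & g = \sum_(i <- s) sym i (a i)]
    & forall (s : seq T) (a : T -> A), uniq s -> {in s, forall i, S i (a i)} ->
        \sum_(i <- s) sym i (a i) = 0 -> {in s, forall i, sym i (a i) = 0}].

End CommutativeAlgebra.

(* A variety over a field [k] of characteristic 0 is given by its coordinate
   ring [B], a subring of its function field [F]; [kap] : k -> F is the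
   structure map and [n] the dimension.  Valuations take values in [R]; their
   value at 0 is irrelevant. *)

Section FunctionField.
Variables (R : realType) (k F : fieldType) (kap : k -> F).
Implicit Types (v : F -> R) (B O q : set F) (n : nat).

Definition alg_indep d (x : 'I_d -> F) :=
  forall P : {mpoly k[d]}, mmap kap x P = 0 -> P = 0.

Definition trdeg n :=
  (exists x : 'I_n -> F, alg_indep x) /\
  (forall x : 'I_n.+1 -> F, ~ alg_indep x).

Definition prime_of B q :=
  [/\ q `<=` B, [/\ q 0, forall x y, q x -> q y -> q (x + y)
                  & forall a x, B a -> q x -> q (a * x)],
      ~ q 1 & forall a b, B a -> B b -> q (a * b) -> q a \/ q b].

Definition loc B q : set F :=
  [set x | exists a b, [/\ B a, B b, ~ q b & x = a / b]].
Definition loc_max B q : set F :=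
  [set x | exists a b, [/\ q a, B b, ~ q b & x = a / b]].

Definition normal B :=
  forall x, (exists d (c : 'I_d -> F), (forall i, B (c i)) /\
               x ^+ d + \sum_i c i * x ^+ i = 0) -> B x.

Definition valuation v :=
  [/\ forall x y, x != 0 -> y != 0 -> v (x * y) = v x + v y,
      forall x y, x != 0 -> y != 0 -> x + y != 0 ->
        Num.min (v x) (v y) <= v (x + y)
    & forall c : k, kap c != 0 -> v (kap c) = 0].

Definition val_ge v (lam : R) : set F := [set x | x = 0 \/ lam <= v x].
Definition val_gt v (lam : R) : set F := [set x | x = 0 \/ lam < v x].

Definition centered v B := B `<=` val_ge v 0.
Definition center v B : set F := B `&` val_gt v 0.

(* Normalized divisorial valuations: value group Z, residue field of
   transcendence degree n - 1 over [k]. *)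
Definition divisorial n v :=
  [/\ valuation v,
      forall x, x != 0 -> exists z : int, v x = z%:~R,
      exists2 x, x != 0 & v x = 1
    & exists y : 'I_n.-1 -> F, (forall i, val_ge v 0 (y i)) /\
        forall P : {mpoly k[n.-1]}, P != 0 -> ~ val_gt v 0 (mmap kap y P)].

Definition prime_divisor n B v :=
  [/\ divisorial n v, centered v B & val_ge v 0 `<=` loc B (center v B)].

(* The pair [(h, a)] stands for the n-form h da_1 /\ ... /\ da_n on F / k, which
   is determined by its values h det (D_i a_j) on n-tuples of derivations. *)

Definition derivation (D : F -> F) :=
  [/\ forall x y, D (x + y) = D x + D y,
      forall x y, D (x * y) = D x * y + x * D y
    & forall c : k, D (kap c) = 0].

Definition topform n := (F * ('I_n -> F))%type.

Definition form_eval n (om : topform n) (D : 'I_n -> F -> F) : F :=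
  om.1 * \det (\matrix_(i, j) D i (om.2 j)).

Definition form_eq n (om eta : topform n) :=
  forall D, (forall i, derivation (D i)) -> form_eval om D = form_eval eta D.

Definition form_neq0 n (om : topform n) :=
  exists D, (forall i, derivation (D i)) /\ form_eval om D != 0.

(* Order of vanishing of [om] along a divisorial valuation [v]: the top exterior
   power of the differentials of the valuation ring, modulo torsion, is free of
   rank 1 and some da_1 /\ ... /\ da_n with all a_i in that ring generates it;
   for such a generator the coefficient of [om] has maximal value. *)
Definition form_ord n v (om : topform n) (z : R) :=
  (exists h (a : 'I_n -> F),
     [/\ forall i, val_ge v 0 (a i), form_eq om (h, a) & v h = z]) /\
  (forall h (a : 'I_n -> F), (forall i, val_ge v 0 (a i)) ->
     form_eq om (h, a) -> v h <= z).

(* [om] generates the canonical sheaf at the prime [q]. *)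
Definition canonical_gen n B q (om : topform n) :=
  form_neq0 om /\
  forall v, prime_divisor n B v -> center v B `<=` q -> form_ord v om 0.

Definition K_cartier n B :=
  forall q, prime_of B q -> exists om : topform n, canonical_gen B q om.

Definition log_discrepancy_div n B v (a : R) :=
  [/\ divisorial n v, centered v B
    & exists (om : topform n) z,
        [/\ canonical_gen B (center v B) om, form_ord v om z & a = 1 + z]].

(* Meant for normal varieties whose canonical divisor is Cartier. *)
Definition log_terminal n B :=
  [/\ normal B, K_cartier n B
    & forall v, divisorial n v -> centered v B ->
        exists2 a, 0 < a & log_discrepancy_div n B v a].

Definition finite_type B (N : nat) (f : 'I_N -> F) :=
  B = [set x | exists P : {mpoly k[N]}, x = mmap kap f P].

(* [a] is the log discrepancy of the monomial valuation with the same values as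
   [v] on a regular system of parameters y_1, ..., y_c of the local ring [O] at
   the center of [v] on an affine birational model [B'] of [B] regular there:
   [O] has dimension [c] since its residue field has transcendence degree n - c,
   and [e i] is the order of vanishing along y_i = 0. *)
Definition model_log_discrepancy n B v (a : R) :=
  exists (N : nat) (f : 'I_N -> F) (B' : set F) (c : nat) (y : 'I_c -> F)
         (e : 'I_c -> F -> R) (A : 'I_c -> R),
  let O := loc B' (center v B') in
  let residually_indep d (x : 'I_d -> F) :=
    (forall i, O (x i)) /\
    (forall P : {mpoly k[d]}, P != 0 -> ~ val_gt v 0 (mmap kap x P)) in
  [/\ [/\ finite_type B' f, B `<=` B' & centered v B'],
      [/\ (c <= n)%N, exists x : 'I_(n - c) -> F, residually_indep _ x
        & forall x : 'I_(n - c).+1 -> F, ~ residually_indep _ x],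
      (forall i, O (y i) /\ val_gt v 0 (y i)) /\
      (forall x, O x -> val_gt v 0 x ->
         exists b : 'I_c -> F, (forall i, O (b i)) /\ x = \sum_i b i * y i),
      forall i, [/\ valuation (e i),
        forall x (j : nat), O x -> x != 0 ->
          (j%:R <= e i x <-> exists2 b, O b & x = y i ^+ j * b)
        & log_discrepancy_div n B (e i) (A i)]
    & a = \sum_i v (y i) * A i].

(* The log discrepancy of [v] is the supremum over all models of the log
   discrepancies of its monomial retractions; it is [a] if finite. *)
Definition log_discrepancy n B v (a : R) :=
  (forall b, model_log_discrepancy n B v b -> b <= a) /\
  (forall b, b < a -> exists2 b', model_log_discrepancy n B v b' & b < b').

Definition colength B (I : set F) (N : nat) :=
  exists e : 'I_N -> F, (forall i, B (e i)) /\
    forall b, B b -> exists! c : 'I_N -> k, I (b - \sum_i kap (c i) * e i).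

Definition volume n B v (V : R) :=
  forall eps, 0 < eps -> exists L : R, forall lam, L <= lam -> 0 < lam ->
    exists2 N, colength B (B `&` val_ge v lam) N
             & `|n`!%:R * N%:R / lam ^+ n - V| < eps.

Definition normalized_volume n B q v (z : R) :=
  [/\ valuation v, centered v B, center v B = q
    & exists a V, [/\ log_discrepancy n B v a, volume n B v V & z = a ^+ n * V]].

Definition minimizes_nvol n B q v (z : R) :=
  normalized_volume n B q v z /\
  forall v' z', normalized_volume n B q v' z' -> z <= z'.

(* The local ring [O], with maximal ideal [mO], is Gorenstein: it is
   Cohen-Macaulay and modulo some (equivalently any) maximal regular sequence it
   is artinian with simple socle. *)
Definition gorenstein_local O (mO : set F) :=
  exists (d : nat) (x : 'I_d -> F),
  let span (j : nat) := [set y | exists c : 'I_d -> F, (forall i, O (c i)) /\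
                            y = \sum_(i < d | (i < j)%N) c i * x i] in
  [/\ forall i, mO (x i),
      forall (i : 'I_d) a, O a -> span i (a * x i) -> span i a,
      exists N : nat, forall y : 'I_N -> F, (forall i, mO (y i)) ->
        span d (\prod_i y i)
    & exists e, [/\ O e, ~ span d e, forall a, mO a -> span d (a * e)
        & forall b, O b -> (forall a, mO a -> span d (a * b)) ->
            exists2 c, O c & span d (b - c * e)]].

Definition gorenstein B :=
  forall q, prime_of B q -> gorenstein_local (loc B q) (loc_max B q).

End FunctionField.

(* [F] is the field of fractions of A / I, via [rho] : A -> A / I -> F. *)
Definition function_field (A : comNzRingType) (I : set A) (F : fieldType)
    (rho : {rmorphism A -> F}) :=
  (forall a, rho a = 0 <-> I a) /\
  (forall x, exists a b, rho b != 0 /\ x = rho a / rho b).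

Section EmbeddedVarieties.
Variables (R : realType) (k : fieldType) (l : nat).
Implicit Types (I : set {mpoly k[l]}) (n : nat).

Definition scalars (F : fieldType) (rho : {mpoly k[l]} -> F) (c : k) : F :=
  rho c%:MP.

(* Maximal ideal of the origin. *)
Definition origin (F : fieldType) (rho : {mpoly k[l]} -> F) : set F :=
  rho @` [set f | f@_0%MM = 0].

Definition lt_gorenstein n I :=
  exists (F : fieldType) (rho : {rmorphism {mpoly k[l]} -> F}),
  [/\ function_field I rho, trdeg (scalars rho) n,
      log_terminal R (scalars rho) n (range rho)
    & gorenstein (range rho)].

Definition min_nvol n I (z : R) :=
  exists (F : fieldType) (rho : {rmorphism {mpoly k[l]} -> F}) (v : F -> R),
  function_field I rho /\
  minimizes_nvol (scalars rho) n (range rho) (origin rho) v z.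

(* Sum of the terms of weight [mu], the variable z_i having weight [wt i]. *)
Definition weight (wt : 'I_l -> R) (a : 'X_{1..l}) : R := \sum_i wt i *+ a i.
Definition weight_part (wt : 'I_l -> R) (mu : R) (f : {mpoly k[l]}) :=
  \sum_(a <- msupp f | weight wt a == mu) f@_a *: 'X_[a].

(* Initial forms are the parts of lowest weight. *)
Definition initial_ideal (wt : 'I_l -> R) I : set {mpoly k[l]} :=
  ideal_gen [set g | exists f mu, [/\ I f,
    {in msupp f, forall a, mu <= weight wt a} & g = weight_part wt mu f]].

End EmbeddedVarieties.

(* Ideal of the base change of V(J) along the ring map [y]. *)
Definition base_change_ideal (A B : comNzRingType) (l : nat) (y : A -> B)
    (J : set {mpoly A[l]}) : set {mpoly B[l]} :=
  ideal_gen [set map_mpoly y f | f in J].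

(* Substitution z_i := g_i z_i. *)
Definition rescale (A : comNzRingType) (l : nat) (g : 'I_l -> A)
    (f : {mpoly A[l]}) : {mpoly A[l]} :=
  f \mPo [tuple g i *: 'X_i | i < l].

Section Family.
Variables (R : realType).
Local Notation C := (R[i]).

Definition smooth_affine_curve (OD : comAlgType C) :=
  [/\ (forall a b : OD, a * b = 0 -> a = 0 \/ b = 0),
      exists (N : nat) (f : 'I_N -> OD),
        forall a, exists P : {mpoly C[N]}, a = mmap (in_alg OD) f P,
      integrally_closed OD,
      (exists a : OD, a != 0 /\ forall b, a * b <> 1)
    & forall p q : set OD, prime_ideal p -> prime_ideal q -> p `<=` q ->
        p = [set 0] \/ p = q].

(* [pt0] is the closed point 0, [t] a uniformizer there, and [taylor] the
   expansion map from functions to C[[t]]. *)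
Definition uniformized (OD : comAlgType C) (pt0 : {lrmorphism OD -> C^o}) (t : OD)
    (taylor : {lrmorphism OD -> fps C}) :=
  [/\ pt0 t = 0, forall a, pt0 a = 0 -> exists u b, pt0 u <> 0 /\ u * a = t * b,
      taylor t = fpsX C & forall a, fcoef (taylor a) 0%N = pt0 a].

(* The family V(J) in Delta x A^l, of relative dimension [n], with section the
   zero section; [rho] maps its coordinate ring to its function field.  A fiber
   is the fiber over an arbitrary field-valued point of Delta. *)
Definition gorenstein_lt_family (OD : comAlgType C) (l n : nat)
    (J : set {mpoly OD[l]}) (F : fieldType) (rho : {rmorphism {mpoly OD[l]} -> F}) :=
  let kap (c : C) := rho (c%:A)%:MP in
  [/\ ideal J /\ function_field J rho,
      trdeg kap n.+1 /\ K_cartier R kap n.+1 (range rho),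
      flat_quotient J /\ surjective_quotient J,
      forall (K : fieldType) (y : {rmorphism OD -> K}),
        lt_gorenstein R n (base_change_ideal y J)
    & forall f, J f -> f@_0%MM = 0].

Definition strictly_degenerating (OD : comAlgType C) (pt0 : {lrmorphism OD -> C^o})
    (l n : nat) (J : set {mpoly OD[l]}) :=
  forall c : {lrmorphism OD -> C^o}, ~ (c =1 pt0) ->
  exists z0 zc : R, [/\ min_nvol n (base_change_ideal pt0 J) z0,
    min_nvol n (base_change_ideal c J) zc & z0 < zc].

End Family.

(* A basis identifies M and its dual N with Z^r, written as row vectors. *)

Section Lattice.
Variables (R : realType) (r : nat).

Definition dotp (A : comNzRingType) (x y : 'rV[A]_r) : A :=
  \sum_i x 0 i * y 0 i.

Definition realv (u : 'rV[int]_r) : 'rV[R]_r := map_mx intr u.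

Definition regular_cone (tau : set 'rV[R]_r) :=
  exists2 E : 'M[int]_r, E \in unitmx &
    tau = [set x | exists c : 'I_r -> R, (forall i, 0 <= c i) /\
                     x = \sum_i c i *: realv (row i E)].

Definition dual_cone (tau : set 'rV[R]_r) : set 'rV[R]_r :=
  [set y | forall x, tau x -> 0 <= dotp y x].

(* Interior of a convex set; it is the relative interior of a cone of full
   dimension. *)
Definition cone_interior (tau : set 'rV[R]_r) : set 'rV[R]_r :=
  [set x | forall y, exists2 e, 0 < e & tau (x + e *: y)].

Definition dual_monoid (tau : set 'rV[R]_r) : set 'rV[int]_r :=
  [set u | dual_cone tau (realv u)].

(* [A]-points of the torus N (x) G_m. *)
Definition torus_point (A : comNzRingType) (g : 'rV[int]_r -> A) :=
  g 0 = 1 /\ forall a b, g (a + b) = g a * g b.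

End Lattice.

(* [X] = V(IX) has function field [F].  The group M generated by the image of
   [v] is Z^r, embedded in the reals by u |-> <u, xi> ([xi] is the Reeb vector);
   W = Spec [GW] is embedded in A^l with z_i mapped to its class in degree u_i. *)
Definition minimizer_data (R : realType) (l n r : nat) (IX : set {mpoly R[i][l]})
    (F : fieldType) (rho : {rmorphism {mpoly R[i][l]} -> F}) (v : F -> R)
    (xi : 'rV[R]_r) (u : 'I_l -> 'rV[int]_r)
    (GW : comNzRingType) (sym : R -> F -> GW) :=
  let deg i := dotp (realv R (u i)) xi in
  let Ox := loc (range rho) (origin rho) in
  [/\ function_field IX rho /\
      exists z, minimizes_nvol (scalars rho) n (range rho) (origin rho) v z,
      (forall a : 'rV[int]_r, dotp (realv R a) xi = 0 -> a = 0) /\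
      (forall x : R, (exists2 f, f != 0 & v f = x) <->
                     (exists a : 'rV[int]_r, x = dotp (realv R a) xi)),
      graded_quotient (fun lam => Ox `&` val_ge v lam)
                      (fun lam => Ox `&` val_gt v lam) sym,
      forall i, val_ge v (deg i) (rho 'X_i)
    & exists th : {rmorphism {mpoly R[i][l]} -> GW},
        [/\ forall c, th c%:MP = sym 0 (rho c%:MP),
            forall i, th 'X_i = sym (deg i) (rho 'X_i),
            forall b, exists f, th f = b
          & forall f, th f = 0 <-> initial_ideal deg IX f]].

Section Toric.
Variables (R : realType) (l r : nat).
Local Notation C := (R[i]).
Implicit Type tau : set 'rV[R]_r.

(* [ST] = C[[t]][tau^v cap M][X] / (t - X chi^m), by its universal property. *)
Definition toric_relations tau (m : 'rV[int]_r) (A : comAlgType C)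
    (tt : {lrmorphism fps C -> A}) (chi : 'rV[int]_r -> A) (XX : A) :=
  [/\ chi 0 = 1,
      forall a b, dual_monoid tau a -> dual_monoid tau b ->
        chi (a + b) = chi a * chi b
    & tt (fpsX C) = XX * chi m].

Definition toric_ring tau (m : 'rV[int]_r) (ST : comAlgType C)
    (tt : {lrmorphism fps C -> ST}) (chi : 'rV[int]_r -> ST) (XX : ST) :=
  toric_relations tau m tt chi XX /\
  forall (A : comAlgType C) (tt' : {lrmorphism fps C -> A})
         (chi' : 'rV[int]_r -> A) (XX' : A),
    toric_relations tau m tt' chi' XX' ->
    let compatible (h : {lrmorphism ST -> A}) :=
      [/\ forall f, h (tt f) = tt' f,
          forall a, dual_monoid tau a -> h (chi a) = chi' a & h XX = XX'] in
    exists2 h, compatible h & forall h', compatible h' -> h' =1 h.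

(* A parameter scheme of closed subschemes of A^l, through its functor of points
   on C-algebras: an [A]-point is a closed subscheme of A^l_A flat over [A],
   with ideal [par_ideal].  By Yoneda a morphism Spec A -> H is an element of
   [par_pts A].  The torus point [g] acts on A^l by z_i |-> g(u_i)^-1 z_i, so
   that the coordinate function z_i has character u_i. *)
Record param_scheme (u : 'I_l -> 'rV[int]_r) := ParamScheme {
  par_pts :> comAlgType C -> Type;
  par_ideal : forall A, par_pts A -> set {mpoly A[l]};
  par_inj : forall A, injective (@par_ideal A);
  par_idealP : forall A (h : par_pts A), ideal (par_ideal h);
  par_flat : forall A (h : par_pts A), flat_quotient (par_ideal h);
  par_pull : forall (A B : comAlgType C), {lrmorphism A -> B} ->
    par_pts A -> par_pts B;
  par_pullE : forall (A B : comAlgType C) (f : {lrmorphism A -> B}) h,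
    par_ideal (par_pull f h) = base_change_ideal f (par_ideal h);
  par_act : forall (A : comAlgType C) (g : 'rV[int]_r -> A), torus_point g ->
    par_pts A -> par_pts A;
  par_actE : forall (A : comAlgType C) (g : 'rV[int]_r -> A) (hg : torus_point g) h,
    par_ideal (par_act hg h) =
    [set f | par_ideal h (rescale (fun i => g (- u i)) f)]
}.

Variables (tau : set 'rV[R]_r) (m : 'rV[int]_r) (u : 'I_l -> 'rV[int]_r).
Variables (ST : comAlgType C) (tt : {lrmorphism fps C -> ST}).
Variables (chi : 'rV[int]_r -> ST) (XX : ST).

(* [y'] = g . y, where T acts on Spec ST with chi^a of weight a, t invariant and
   hence X of weight -m. *)
Definition torus_translate (A : comAlgType C) (g : 'rV[int]_r -> A)
    (y y' : {lrmorphism ST -> A}) :=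
  [/\ forall f, y' (tt f) = y (tt f),
      forall a, dual_monoid tau a -> y' (chi a) = g a * y (chi a)
    & y' XX = g (- m) * y XX].

Definition equivariant (H : param_scheme u) (F : H ST) :=
  forall (A : comAlgType C) (g : 'rV[int]_r -> A) (hg : torus_point g)
         (y y' : {lrmorphism ST -> A}),
    torus_translate g y y' -> par_pull y' F = par_act hg (par_pull y F).

(* The map y : Spec A -> Spec ST factors through the stratum V(tau'), its
   coordinate X being pulled back to [x]. *)
Definition stratum_map (A : comAlgType C) (y : {lrmorphism ST -> A}) (x : A) :=
  (forall a, dual_monoid tau a -> a != 0 -> y (chi a) = 0) /\ y XX = x.

(* The subscheme of A^l x A^1 with ideal [IV] is equivariantly isomorphic to
   V(IW) x A^1 over A^1, the weights of z_i and X being u_i and m. *)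
Definition trivial_deformation (IW : set {mpoly C[l]}) (IV : set {mpoly {poly C}[l]}) :=
  exists y : l.-tuple {mpoly {poly C}[l]},
    [/\ forall (i : 'I_l) (a : 'X_{1..l}) (j : nat), ((tnth y i)@_a)`_j != 0 ->
          \sum_(h < l) u h *+ a h + m *+ j = u i,
        forall f, base_change_ideal (@polyC C) IW f <-> IV (f \mPo y)
      & forall g, exists f, IV (g - f \mPo y)].

(* The data produced by the construction of the semistable minimal bubble;
   [IX] and [JT] are the ideals of the central fiber and of the base change of
   the family to C[[t]]. *)
Definition bubble_data (n : nat) (xi : 'rV[R]_r) (IX : set {mpoly C[l]})
    (JT : set {mpoly (fps C)[l]}) (H : param_scheme u) (F : H ST) :=
  let IW := initial_ideal (fun i => dotp (realv R (u i)) xi) IX in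
  [/\ [/\ regular_cone tau,
          forall x i, cone_interior tau x -> 0 < dotp (realv R (u i)) x,
          forall v : 'rV[int]_r, cone_interior tau (realv R v) ->
            initial_ideal (fun i => (dotp (u i) v)%:~R : R) IX = IW,
          cone_interior (dual_cone tau) (realv R m)
        & toric_ring tau m tt chi XX],
      equivariant F /\ surjective_quotient (par_ideal F),
      forall (A : comAlgType C) (y : {lrmorphism ST -> A}),
        (forall a, dual_monoid tau a -> exists b, y (chi a) * b = 1) ->
        par_ideal (par_pull y F) =
        ideal_gen [set rescale (fun i => y (chi (u i))) (map_mpoly (y \o tt) f) | f in JT],
      (forall y : {lrmorphism ST -> C^o}, stratum_map y 0 ->
         par_ideal (par_pull y F) = IW) /\
      (forall y : {lrmorphism ST -> C^o}, stratum_map y 1 ->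
         let I1 : set {mpoly C[l]} := par_ideal (par_pull y F) in
         lt_gorenstein R n I1 /\
         exists z0 z1 : R, [/\ min_nvol n IX z0, min_nvol n I1 z1 & z0 < z1])
    & [/\ 0 <= dotp (realv R m) xi,
          forall i, 0 <= dotp (realv R (u i)) xi
        & forall y : {lrmorphism ST -> {poly C}}, stratum_map y 'X ->
            ~ trivial_deformation IW (par_ideal (par_pull y F))]].

(* The map phi_(v') : Spec C[[s]] -> Spec ST for v' = (v, w0); the exponents
   <a, v> are nonnegative since [v] lies in tau. *)
Definition arc_map (v : 'rV[int]_r) (w0 : nat) (phi : {lrmorphism ST -> fps C}) :=
  [/\ phi XX = 1,
      forall a, dual_monoid tau a -> phi (chi a) = fpsX C ^+ `|dotp a v|%N
    & phi (tt (fpsX C)) = fpsX C ^+ w0].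

End Toric.

(* A graded ring is a multiplicative family [S] of subgroups of a ring [P], the
   component of degree [lam] being [S lam]; homogeneous ideals are families
   [K lam] contained in [S lam]. *)

Section Proj.
Variables (P : comNzRingType) (S : nat -> set P).

Definition proj_point (p : nat -> set P) :=
  [/\ forall i, p i `<=` S i,
      forall i, p i 0 /\ (forall x y, p i x -> p i y -> p i (x + y)),
      forall i j a x, S i a -> p j x -> p (i + j)%N (a * x),
      forall i j a b, S i a -> S j b -> p (i + j)%N (a * b) -> p i a \/ p j b
    & exists i a, [/\ (0 < i)%N, S i a & ~ p i a]].

Definition in_Vplus (K p : nat -> set P) := forall i, K i `<=` p i.

(* [B] is the coordinate ring of the affine open subscheme of V_+(K) where [g],
   homogeneous of degree [d], does not vanish, i.e. the degree 0 part of
   (S / K)[1 / g]; [frac j f] is the fraction f / g^j. *)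
Definition chart_ring (K : nat -> set P) (g : P) (d : nat) (B : comNzRingType)
    (frac : nat -> P -> B) :=
  [/\ forall j x y, S (j * d)%N x -> S (j * d)%N y ->
        frac j (x + y) = frac j x + frac j y,
      forall i j x y, S (i * d)%N x -> S (j * d)%N y ->
        frac (i + j)%N (x * y) = frac i x * frac j y,
      frac 0%N 1 = 1 /\ frac 1%N g = 1,
      forall b, exists j x, S (j * d)%N x /\ b = frac j x
    & forall j x, S (j * d)%N x ->
        (frac j x = 0 <-> exists i, K ((i + j) * d)%N (g ^+ i * x))].

(* Homogeneous ideal of the affine cone over V_+(K). *)
Definition cone_ideal (K : nat -> set P) (i : nat) : set P :=
  [set x | S i x /\ forall j a, (0 < j)%N -> S j a ->
             exists e : nat, K (i + e * j)%N (a ^+ e * x)].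

End Proj.

Section WeightedBlowUp.
Variables (R : realType) (l : nat) (w0 : nat) (w : 'I_l -> nat).
Local Notation C := (R[i]).
Local Notation P := {mpoly (fps C)[l]}.

(* Functions on A^l_(C[[t]]) of weight at least [lam]; Proj of the graded ring
   with these components is the weighted blow up at the origin. *)
Definition weight_ge (lam : nat) : set P :=
  [set f | forall (a : 'X_{1..l}) (i : nat), fcoef (f@_a) i != 0 ->
             (lam <= w0 * i + \sum_(j < l) w j * a j)%N].

(* Homogeneous ideal of the strict transform of V(J): the closure of the
   complement of the center, on which all functions of positive weight vanish. *)
Definition strict_transform (J : set P) (lam : nat) : set P :=
  [set f | weight_ge lam f /\
           forall a, weight_ge 1 a -> exists e : nat, J (a ^+ e * f)].

(* Homogeneous ideal of the exceptional divisor of the strict transform of V(J):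
   its intersection with the exceptional divisor of the ambient weighted blow up,
   the weighted projective space cut out by the elements of excess weight. *)
Definition exceptional_divisor (J : set P) (lam : nat) : set P :=
  [set f | exists a b, [/\ weight_ge lam.+1 a, strict_transform J lam b & f = a + b]].

Definition central_fiber (J : set P) : set P := ideal_gen (J `|` [set (fpsX C)%:MP]).

(* Pull back of functions along z_i = s^(w_i) z'_i and the given map C[[t]] -> C[[s]]. *)
Definition blow_down (pw : fps C -> fps C) (f : P) : P :=
  rescale (fun i => fpsX C ^+ w i) (map_mpoly pw f).

(* Filtration on the local ring at x = sigma(0) of the family V(J) in
   Delta x A^l, inside the function field: classes of germs f / g with
   w(f) >= lam, where g does not vanish at x (so w(g) = 0). *)
Definition local_filtration (OD : comAlgType C) (pt0 : OD -> C) (taylor : OD -> fps C)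
    (F : fieldType) (rho : {mpoly OD[l]} -> F) (lam : nat) : set F :=
  [set x | exists f g, [/\ weight_ge lam (map_mpoly taylor f),
                           pt0 g@_0%MM != 0 & x = rho f / rho g]].

End WeightedBlowUp.

(* Main.v *)
(* The arc phi has a universal version Spec C[X][[s]] -> Spec ST, given by
   t |-> X s^w0 and chi^a |-> s^<a, v>, whose locus s = 0 is the stratum V(tau').
   The pulled back family is flat and, after inverting s, is obtained from the
   family V(J) by t = X s^w0, z_i = s^(w_i) z'_i; so it is the extended Rees
   algebra of the weight filtration modulo J, whose special fiber is the
   associated graded ring.  Hence a symbol vanishes on W exactly if it is the
   symbol of an element of J, which gives (2), since symbols of formal and of
   algebraic germs agree by truncation.  For (1a), flatness over C[X][[s]] turns
   a congruence f = t h modulo J with f of weight n into one with h of weight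
   n - w0, so the strict transform of the central fiber is cut out by t.
   For (1b), the fraction f / t^n goes to the function s^(-n w0) f(s^w0, s^w z')
   on the family over the arc X = 1.  Splitting power series in s according to
   exponents modulo w0 shows that this map is injective on the base changed chart
   and birational; it is integral since z'_i^w0 comes from z_i^w0 / t^(w_i).
   The target is normal: its generic fiber is the fiber of the family over a
   C((s))-valued point, which is log terminal, hence normal, and its special
   fiber is log terminal, hence reduced. *)

Require Import Defs.
From HB Require Import structures.
From mathcomp Require Import all_boot all_order all_algebra.
From mathcomp Require Import boolp classical_sets reals.
From mathcomp Require Import complex.
From mathcomp Require Import mpoly.

Set Implicit Arguments.
Unset Strict Implicit.
Unset Printing Implicit Defensive.

Import Order.TTheory GRing.Theory Num.Theory.

Local Open Scope ring_scope.
Local Open Scope classical_set_scope.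

(** * Ideals and base change *)

Section Ideals.
Variable A : comNzRingType.
Implicit Types (I G : set A).

(** The hypotheses describe the pulled back family by equations only over the torus; across [s = 0]
    the link is flatness. So ideals are compared after inverting [s], which gives statements up to a
    power of [s], and torsion-freeness then removes that power. The base of the universal arc is a
    power series ring because C[[t]] has to map to it by t |-> X s^w0. Its role is taken by the
    projections [component]: with X in degree w0, z'_i in degree w_i and s in degree -1, both X s^w0
    and s^(w_i) z'_i have degree 0, hence the projections are linear over the coordinates of the
    original family and carry the pulled back ideal into the original one. On the arc X = 1 this
    grading is lost, and the splitting of exponents modulo w0 replaces it. Both comparisons in (2)
    are instances of one statement about filtered rings. *)

Lemma mem_ideal_gen G x : G x -> ideal_gen G x.
Proof.
move=> Gx; exists 1%N, (fun=> 1), (fun=> x); split=> //.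
by rewrite big_ord1 mul1r.
Qed.

Lemma ideal_genP G : ideal (ideal_gen G).
Proof.
split.
- by exists 0%N, (fun=> 0), (fun=> 0); split; [case | rewrite big_ord0].
- move=> x y [k [c [g [Gg ->]]]] [k' [c' [g' [Gg' ->]]]].
  exists (k + k')%N, (fun i => match split i with inl a => c a | inr a => c' a end),
    (fun i => match split i with inl a => g a | inr a => g' a end).
  split; first by move=> i; case: (split i).
  rewrite big_split_ord /=; congr (_ + _); apply: eq_bigr => i _.
    by rewrite -[lshift k' i]/(unsplit (inl i)) unsplitK.
  by rewrite -[rshift k i]/(unsplit (inr i)) unsplitK.
- move=> a x [k [c [g [Gg ->]]]]; exists k, (fun i => a * c i), g; split=> //.
  by rewrite mulr_sumr; apply: eq_bigr => i _; rewrite mulrA.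
Qed.

Lemma ideal_sum I (T : Type) (s : seq T) (P : pred T) (F : T -> A) :
  ideal I -> (forall i, P i -> I (F i)) -> I (\sum_(i <- s | P i) F i).
Proof. by case=> I0 ID _ IF; elim/big_ind: _. Qed.

Lemma ideal_gen_sub G I : ideal I -> G `<=` I -> ideal_gen G `<=` I.
Proof.
move=> idI GI _ [k [c [g [Gg ->]]]]; apply: ideal_sum => // i _.
by case: idI => _ _; apply; apply: GI.
Qed.

End Ideals.

Lemma ideal_preim (A B : comNzRingType) (h : {rmorphism A -> B}) (I : set B) :
  ideal I -> ideal [set x | I (h x)].
Proof.
case=> I0 ID IM; split=> [|x y|a x] /=; rewrite ?rmorph0 ?rmorphD ?rmorphM //.
- exact: ID.
- exact: IM.
Qed.

Lemma ideal_gen_image (A B : comNzRingType) (h : {rmorphism A -> B}) (G : set A) x :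
  ideal_gen G x -> ideal_gen [set h g | g in G] (h x).
Proof.
apply: (ideal_gen_sub (ideal_preim h (ideal_genP _))) => g Gg.
by apply: mem_ideal_gen; exists g.
Qed.

Lemma mcoeff_map (l : nat) (A B : comNzRingType) (y : {rmorphism A -> B})
    (f : {mpoly A[l]}) a : (map_mpoly y f)@_a = y f@_a.
Proof. exact: mcoeff_map_mpoly. Qed.

Section BaseChangeIdeal.
Variables (l : nat) (A B : comNzRingType) (y : {rmorphism A -> B}).
Implicit Types J : set {mpoly A[l]}.

Lemma base_changeP J : ideal (base_change_ideal y J).
Proof. exact: ideal_genP. Qed.

Lemma mem_base_change J f : J f -> base_change_ideal y J (map_mpoly y f).
Proof. by move=> Jf; apply: mem_ideal_gen; exists f. Qed.

(** Coefficients of a multiplier lift along the surjection, so the image of [J] is already an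
    ideal. *)
Lemma base_change_surj J : ideal J -> (forall b, exists a, y a = b) ->
  base_change_ideal y J = [set map_mpoly y f | f in J].
Proof.
move=> [J0 JD JM] surj; apply/seteqP; split; last first.
  by move=> _ [f Jf <-]; exact: mem_base_change.
apply: ideal_gen_sub => //; split.
- by exists 0 => //; rewrite rmorph0.
- by move=> _ _ [f Jf <-] [g Jg <-]; exists (f + g); rewrite ?rmorphD //; exact: JD.
- move=> g _ [f Jf <-].
  have [c cE] := choice surj.
  exists ((\sum_(a <- msupp g) c g@_a *: 'X_[a]) * f : {mpoly A[l]}); first exact: JM.
  rewrite rmorphM rmorph_sum; congr (_ * _); rewrite [RHS]mpolyE.
  apply: eq_bigr => a _; apply/mpolyP => b.
  by rewrite mcoeff_map !mcoeffZ !mcoeffX rmorphM rmorph_nat cE.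
Qed.

End BaseChangeIdeal.

Lemma base_change_comp (l : nat) (A B D : comNzRingType) (y : {rmorphism A -> B})
    (z : {rmorphism B -> D}) (J : set {mpoly A[l]}) :
  base_change_ideal z (base_change_ideal y J) = base_change_ideal (z \o y) J.
Proof.
have zyE f : map_mpoly (z \o y) f = map_mpoly z (map_mpoly y f).
  by apply/mpolyP => a; rewrite !mcoeff_map.
apply/seteqP; split.
  apply: ideal_gen_sub; first exact: base_changeP.
  move=> _ [f Jf <-]; move: f Jf.
  apply: (ideal_gen_sub (ideal_preim (map_mpoly z) (base_changeP _ _))).
  by move=> _ [f Jf <-] /=; rewrite -zyE; exact: (mem_base_change (z \o y)).
apply: ideal_gen_sub; first exact: base_changeP.
by move=> _ [f Jf <-]; rewrite zyE; do 2 apply: mem_base_change.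
Qed.

(** The one-term relation [a *: f = 0] in the quotient must come from coefficients [c] with
    [a * c = 0], and these vanish. *)
Lemma flat_torsion_free (l : nat) (A : comNzRingType) (I : set {mpoly A[l]}) a f :
  flat_quotient I -> nonzerodiv a -> I (a *: f) -> I f.
Proof.
move=> flI nza If.
have [|p [c [b' [Ib cE]]]] := flI 1%N (fun=> a) (fun=> f); first by rewrite big_ord1.
have := Ib ord0; rewrite big1 ?subr0 // => j _.
by have := cE j; rewrite big_ord1 => /nza ->; rewrite scale0r.
Qed.

(** * Power series *)

Section FpsCoef.
Variable A : comNzRingType.
Implicit Types f g : fps A.

Lemma fcoefD f g i : fcoef (f + g) i = fcoef f i + fcoef g i. Proof. by []. Qed.
Lemma fcoefN f i : fcoef (- f) i = - fcoef f i. Proof. by []. Qed.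
Lemma fcoef0 i : fcoef (0 : fps A) i = 0. Proof. by []. Qed.
Lemma fcoef1 i : fcoef (1 : fps A) i = (i == 0%N)%:R. Proof. by []. Qed.
Lemma fcoefZ a f i : fcoef (a *: f) i = a * fcoef f i. Proof. by []. Qed.
Lemma fcoefM f g n :
  fcoef (f * g) n = \sum_(i < n.+1) fcoef f i * fcoef g (n - i)%N.
Proof. by []. Qed.

Lemma fcoef_sum (T : Type) (s : seq T) (P : pred T) (F : T -> fps A) i :
  fcoef (\sum_(j <- s | P j) F j) i = \sum_(j <- s | P j) fcoef (F j) i.
Proof. exact: (big_morph (fun f => fcoef f i) (fun f g => fcoefD f g i)). Qed.

Lemma fcoefXM f i : fcoef (fpsX A * f) i = if i is j.+1 then fcoef f j else 0.
Proof.
case: i => [|i]; rewrite fcoefM big_ord_recl /= ?big_ord0 ?mul0r ?addr0 // add0r.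
rewrite big_ord_recl /= mul1r big1 ?addr0 ?subSS ?subn0 // => j _.
by rewrite mul0r.
Qed.

Lemma fcoefXnM n f i :
  fcoef (fpsX A ^+ n * f) i = if (i < n)%N then 0 else fcoef f (i - n)%N.
Proof.
elim: n i => [|n IHn] i; first by rewrite expr0 mul1r subn0.
by rewrite exprS -mulrA fcoefXM; case: i => [|i] //; rewrite IHn ltnS subSS.
Qed.

Lemma fcoefXn n i : fcoef (fpsX A ^+ n) i = (i == n)%:R.
Proof.
rewrite -[_ ^+ n]mulr1 fcoefXnM fcoef1 subn_eq0.
by case: ltngtP.
Qed.

Definition fps_shift n f := FPS (fun i => fcoef f (i + n)%N).

Fact fps_shift_additive n : {morph fps_shift n : f g / f - g}.
Proof. by move=> f g; apply: fpsP. Qed.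
HB.instance Definition _ n := GRing.isZmodMorphism.Build (fps A) (fps A)
  (fps_shift n) (fps_shift_additive n).

Lemma fps_shiftK n f : fps_shift n (fpsX A ^+ n * f) = f.
Proof.
by apply: fpsP => i; rewrite [LHS]fcoefXnM ltnNge leq_addl addnK.
Qed.

Lemma fps_shiftE n f : (forall i, (i < n)%N -> fcoef f i = 0) ->
  fpsX A ^+ n * fps_shift n f = f.
Proof.
move=> f0; apply: fpsP => i; rewrite fcoefXnM.
by case: ltnP => [/f0 -> // | ni] /=; rewrite subnK.
Qed.

Lemma fpsXn_nonzerodiv n : nonzerodiv (fpsX A ^+ n).
Proof. by move=> f /(congr1 (fps_shift n)); rewrite fps_shiftK raddf0. Qed.

Definition fps_coef0 f := fcoef f 0.

Fact fps_coef0_additive : {morph fps_coef0 : f g / f - g}.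
Proof. by []. Qed.
Fact fps_coef0_monoid : monoid_morphism fps_coef0.
Proof. by split=> // f g; rewrite /fps_coef0 fcoefM big_ord1. Qed.
HB.instance Definition _ := GRing.isZmodMorphism.Build (fps A) A fps_coef0
  fps_coef0_additive.
HB.instance Definition _ := GRing.isMonoidMorphism.Build (fps A) A fps_coef0
  fps_coef0_monoid.

Lemma fps_coef0_eq0 f : fps_coef0 f = 0 -> f = fpsX A * fps_shift 1 f.
Proof.
by move=> f0; rewrite -[X in X * _]expr1 fps_shiftE // => -[].
Qed.

Lemma fcoef_alg a i : fcoef (a%:A : fps A) i = if i == 0%N then a else 0.
Proof. by rewrite fcoefZ fcoef1; case: eqP; rewrite ?mulr1 ?mulr0. Qed.

Lemma fpsX_neq0 : fpsX A != 0.
Proof.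
by apply/eqP => /(congr1 (fun f => fcoef f 1%N)) /= /eqP; rewrite oner_eq0.
Qed.

Lemma fps_truncE n f :
  f = \sum_(i < n) fcoef f i *: fpsX A ^+ i + fpsX A ^+ n * fps_shift n f.
Proof.
apply: fpsP => i; rewrite fcoefD fcoef_sum fcoefXnM.
under eq_bigr do rewrite fcoefZ fcoefXn.
case: ltnP => [lt_in|le_ni].
  rewrite (bigD1 (Ordinal lt_in)) //= eqxx mulr1 big1 ?addr0 // => j.
  by rewrite -val_eqE /= eq_sym => /negPf ->; rewrite mulr0.
rewrite [fcoef (fps_shift _ _) _]/= subnK // big1 ?add0r // => j _.
by rewrite gtn_eqF ?mulr0 // (leq_trans (ltn_ord j)).
Qed.

End FpsCoef.

Section FpsDomain.
Variable A : idomainType.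
Implicit Types f g : fps A.

(** Units and inverses are chosen classically; they serve to make [fps A] an integral domain, so
    that its field of fractions can be formed. *)
Let unitf : pred (fps A) := fun f => `[< exists g, g * f = 1 >].
Let invf f : fps A :=
  match pselect (exists g, g * f = 1) with left fP => projT1 (cid fP) | right _ => f end.

Fact fps_mulVf : {in unitf, left_inverse 1 invf *%R}.
Proof. by move=> f /asboolP fP; rewrite /invf; case: pselect => // ?; case: cid. Qed.
Fact fps_unitP f g : g * f = 1 -> unitf f.
Proof. by move=> gf; apply/asboolP; exists g. Qed.
Fact fps_inv_out : {in [predC unitf], invf =1 id}.
Proof. by move=> f /asboolPn fP; rewrite /invf; case: pselect. Qed.
HB.instance Definition _ := GRing.ComNzRing_hasMulInverse.Build (fps A)
  fps_mulVf fps_unitP fps_inv_out.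

Lemma fps_neq0 f : f != 0 ->
  exists n, fcoef f n != 0 /\ forall i, (i < n)%N -> fcoef f i = 0.
Proof.
move=> f0; have exn : exists n, fcoef f n != 0.
  apply: contra_notP (negP f0) => /forallNP fz.
  by apply/eqP/fpsP => i; apply/eqP; apply: contra_notT (fz i).
case: (ex_minnP exn) => n fn nmin; exists n; split=> // i lt_in.
by apply/eqP; apply: contraTT lt_in => /nmin; rewrite -leqNgt.
Qed.

(** The lowest nonzero coefficients of the two factors multiply to a single coefficient of the
    product, in degree [n + m]. *)
Fact fps_integral : GRing.integral_domain_axiom (fps A).
Proof.
move=> f g fg; apply/norP => -[/fps_neq0 [n [fn fnlt]] /fps_neq0 [m [gm gmlt]]].
have /negP := mulf_neq0 fn gm; apply; apply/eqP.
have := congr1 (fun h => fcoef h (n + m)%N) fg; rewrite fcoefM fcoef0 => <-.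
have nP : (n < (n + m).+1)%N by rewrite ltnS leq_addr.
rewrite (bigD1 (Ordinal nP)) //= addKn big1 ?addr0 // => i.
rewrite -val_eqE /= neq_ltn => /orP[/fnlt -> | lt_ni]; first by rewrite mul0r.
by rewrite gmlt ?mulr0 // ltn_subLR ?ltn_add2r // -ltnS.
Qed.
HB.instance Definition _ := GRing.ComUnitRing_isIntegral.Build (fps A) fps_integral.

End FpsDomain.

(* A series with constant term 1 - u is inverted by the geometric series. *)
Lemma fps_inv_ex (K : fieldType) (f : fps K) :
  fcoef f 0%N != 0 -> exists g, g * f = 1.
Proof.
move=> f0; pose u : fps K := 1 - (fcoef f 0%N)^-1 *: f.
have u0 : fps_coef0 u = 0.
  by rewrite /fps_coef0 fcoefD fcoefN fcoefZ fcoef1 mulVf // subrr.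
have uX k i : (i < k)%N -> fcoef (u ^+ k) i = 0.
  by move=> ik; rewrite (fps_coef0_eq0 u0) exprMn fcoefXnM ik.
pose g : fps K := FPS (fun n => fcoef (\sum_(k < n.+1) u ^+ k) n).
have gE N n : (n <= N)%N -> fcoef g n = fcoef (\sum_(k < N.+1) u ^+ k) n.
  move=> nN; rewrite /= !fcoef_sum.
  rewrite (big_ord_widen _ (fun k => fcoef (u ^+ k) n) (_ : n.+1 <= N.+1)%N) //.
  rewrite [RHS](bigID (fun k : 'I_N.+1 => (k < n.+1)%N)) /= [X in _ + X]big1 ?addr0 //.
  by move=> k; rewrite -leqNgt => /uX.
have g1 : (1 - u) * g = 1.
  apply: fpsP => n; rewrite fcoefM.
  under eq_bigr do rewrite (gE n) ?leq_subr //.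
  rewrite -fcoefM; have := subrX1 u n.+1.
  move=> /(congr1 -%R); rewrite opprB -mulNr opprB => <-.
  by rewrite fcoefD fcoefN uX // subr0.
exists ((fcoef f 0%N)^-1 *: g); rewrite -scalerAl mulrC scalerAl.
by rewrite -[X in X * g](subKr 1) g1.
Qed.

(** * Localizations and the torus chart *)

Section SubringType.
Variables (A : comNzRingType) (T : subringClosed A).

(** A closed subset turned into a ring of its own, so that it can be the target of a universal
    property or of a localization map. *)
Record subring := Subring { subring_val : A; _ : subring_val \in T }.
HB.instance Definition _ := [isSub for subring_val].
HB.instance Definition _ := [Choice of subring by <:].
HB.instance Definition _ := [SubChoice_isSubComNzRing of subring by <:].

Variables (B : comNzRingType) (h : {rmorphism B -> A}) (hT : forall b, h b \in T).

Definition to_subring (b : B) : subring := Subring (hT b).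

Fact to_subring_additive : {morph to_subring : f g / f - g}.
Proof. by move=> f g; apply: val_inj; rewrite /= rmorphB. Qed.
Fact to_subring_monoid : monoid_morphism to_subring.
Proof.
by split=> [|f g]; apply: val_inj; rewrite /= ?rmorph1 ?rmorphM.
Qed.
HB.instance Definition _ := GRing.isZmodMorphism.Build B subring to_subring
  to_subring_additive.
HB.instance Definition _ := GRing.isMonoidMorphism.Build B subring to_subring
  to_subring_monoid.

End SubringType.

(* [A] as a [k]-algebra through [kap]. *)
Definition alg_via (k A : comNzRingType) (kap : {rmorphism k -> A}) : Type := A.

Section AlgebraVia.
Variables (k A : comNzRingType) (kap : {rmorphism k -> A}).
Local Notation via := (alg_via kap).

HB.instance Definition _ := GRing.ComNzRing.on via.

Definition via_scale (c : k) (x : via) : via := kap c * (x : A).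

Fact via_scaleA a b x : via_scale a (via_scale b x) = via_scale (a * b) x.
Proof. by rewrite /via_scale rmorphM mulrA. Qed.
Fact via_scale1 : left_id 1 via_scale.
Proof. by move=> x; rewrite /via_scale rmorph1 mul1r. Qed.
Fact via_scaleDr : right_distributive via_scale +%R.
Proof. by move=> a x y; rewrite /via_scale -mulrDr. Qed.
Fact via_scaleDl x : {morph via_scale^~ x : a b / a + b}.
Proof. by move=> a b; rewrite /via_scale rmorphD mulrDl. Qed.
HB.instance Definition _ := GRing.Zmodule_isLmodule.Build k via
  via_scaleA via_scale1 via_scaleDr via_scaleDl.

Fact via_scaleAl (a : k) (x y : via) : a *: (x * y) = (a *: x) * y.
Proof. exact: mulrA. Qed.
HB.instance Definition _ := GRing.Lmodule_isLalgebra.Build k via via_scaleAl.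
HB.instance Definition _ := GRing.Lalgebra_isComAlgebra.Build k via.

Variables (S : comAlgType k) (h : {rmorphism S -> A}).
Hypothesis hkap : forall c, h c%:A = kap c.

Definition via_morph (x : S) : via := h x.

Fact via_morph_additive : {morph via_morph : f g / f - g}.
Proof. exact: (rmorphB h). Qed.
Fact via_morph_monoid : monoid_morphism via_morph.
Proof. by split=> [|f g]; rewrite /via_morph ?rmorph1 ?rmorphM. Qed.

(** The universal properties in use quantify over C-algebras; retyping the target lets ring
    morphisms that respect the scalars enter them. *)
Lemma via_lrmorphism : exists g : {lrmorphism S -> via}, forall x, g x = h x.
Proof.
have sc : scalable via_morph.
  by move=> c x; rewrite /via_morph -mulr_algl rmorphM hkap.
pose m1 := GRing.isZmodMorphism.Build S via via_morph via_morph_additive.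
pose m2 := GRing.isMonoidMorphism.Build S via via_morph via_morph_monoid.
pose m3 := GRing.isScalable.Build k S via _ via_morph sc.
pose g : {lrmorphism S -> via} := HB.pack via_morph m1 m2 m3.
by exists g.
Qed.

End AlgebraVia.

Section Localization.
Variables (B : idomainType) (s : B).

(** The ring [B[1/s]] inside the fraction field, with denominators multiplied out. *)
Definition away_pred : {pred {fraction B}} :=
  fun x => `[< exists e b, x * tofrac (s ^+ e) = tofrac b >].

Fact away_subring : subring_closed away_pred.
Proof.
split.
- by apply/asboolP; exists 0%N, 1; rewrite expr0 mulr1.
- move=> x y /asboolP[e [b xE]] /asboolP[e' [b' yE]]; apply/asboolP.
  exists (e + e')%N, (s ^+ e' * b - s ^+ e * b').
  rewrite tofracB !tofracM -xE -yE exprD tofracM mulrBl.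
  by rewrite (mulrCA y) [X in X - _]mulrA [X in X - _]mulrC.
- move=> x y /asboolP[e [b xE]] /asboolP[e' [b' yE]]; apply/asboolP.
  by exists (e + e')%N, (b * b'); rewrite exprD !tofracM -xE -yE mulrACA.
Qed.
HB.instance Definition _ := GRing.isSubringClosed.Build {fraction B} away_pred
  away_subring.

Fact away_tofrac b : tofrac b \in away_pred.
Proof. by apply/asboolP; exists 0%N, b; rewrite expr0 mulr1. Qed.

Lemma localization_away : s != 0 ->
  exists (L : comNzRingType) (inc : {rmorphism B -> L}),
    [/\ injective inc, exists y, inc s * y = 1
      & forall x, exists e b, inc (s ^+ e) * x = inc b].
Proof.
move=> s0; exists (subring away_pred), (to_subring (h := @tofrac B) away_tofrac).
split.
- by move=> a b /(congr1 val) /= /eqP; rewrite tofrac_eq => /eqP.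
- have invP : (tofrac s)^-1 \in away_pred.
    by apply/asboolP; exists 1%N, 1; rewrite expr1 mulVf // tofrac_eq0.
  by exists (Subring invP); apply: val_inj; rewrite /= mulfV // tofrac_eq0.
- case=> x xP; have [e [b xE]] := asboolW xP.
  by exists e, b; apply: val_inj; rewrite /= mulrC.
Qed.

End Localization.

Lemma clear_denominators (l : nat) (B : idomainType) (L : comNzRingType) (s : B)
    (inc : {rmorphism B -> L}) (p : {mpoly L[l]}) :
    (forall x, exists e b, inc (s ^+ e) * x = inc b) ->
  exists e q, inc (s ^+ e) *: p = map_mpoly inc q.
Proof.
move=> den; elim/mpolyind: p => [|c a p _ _ [e [q pE]]].
  by exists 0%N, 0; rewrite scaler0 rmorph0.
have [e' [b cE]] := den c; exists (e + e')%N, (s ^+ e *: (b *: 'X_[a]) + s ^+ e' *: q).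
rewrite rmorphD /= scalerDr !map_mpolyZ map_mpolyX -pE -cE !scalerA.
by rewrite exprD rmorphM mulrA [inc (s ^+ e') * _]mulrC.
Qed.

(** A membership over [L] involves finitely many coefficients; one power of [s] clears all their
    denominators, and injectivity of [inc] brings the identity back to [B]. *)
Lemma contract_away (l : nat) (B : idomainType) (L : comNzRingType) (s : B)
    (inc : {rmorphism B -> L}) (G : set {mpoly B[l]}) f :
    injective inc -> (forall x, exists e b, inc (s ^+ e) * x = inc b) ->
  ideal_gen [set map_mpoly inc g | g in G] (map_mpoly inc f) ->
  exists e, ideal_gen G (s ^+ e *: f).
Proof.
move=> inj den Gf.
have clear (p : {mpoly L[l]}) := clear_denominators p den.
pose I := [set p : {mpoly L[l]} | exists e q, ideal_gen G q /\
             inc (s ^+ e) *: p = map_mpoly inc q].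
have [gen0 genD genM] := ideal_genP G.
have idI : ideal I.
  split.
  - by exists 0%N, 0; rewrite scaler0 rmorph0.
  - move=> p p' [e [q [Gq pE]]] [e' [q' [Gq' pE']]].
    exists (e + e')%N, ((s ^+ e')%:MP * q + (s ^+ e)%:MP * q'); split.
      by apply: genD; apply: genM.
    rewrite rmorphD /= !mul_mpolyC !map_mpolyZ -pE -pE' scalerDr !scalerA.
    by rewrite exprD rmorphM [inc (s ^+ e') * _]mulrC.
  - move=> c p [e [q [Gq pE]]]; have [e' [c' cE]] := clear c.
    exists (e + e')%N, (c' * q); split; first exact: genM.
    rewrite rmorphM /= -pE -cE -scalerAl -scalerAr !scalerA.
    by rewrite exprD rmorphM mulrC.
have GI : [set map_mpoly inc g | g in G] `<=` I.
  move=> _ [g Gg <-]; exists 0%N, g; split; first exact: mem_ideal_gen.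
  by rewrite expr0 rmorph1 scale1r.
have [e [q [Gq qE]]] := ideal_gen_sub idI GI Gf.
exists e; suff -> : s ^+ e *: f = q by [].
apply/mpolyP => a; apply: inj; move/mpolyP/(_ a): qE.
by rewrite -map_mpolyZ !mcoeff_map.
Qed.

Lemma rescaleE (A : comNzRingType) (l : nat) (g : 'I_l -> A) f :
  rescale g f = \sum_(a <- msupp f) (f@_a * mmap1 g a) *: 'X_[a].
Proof.
rewrite /rescale comp_mpolyE; apply: eq_bigr => a _.
rewrite -scalerA; congr (_ *: _); rewrite mpolyXE_id -mul_mpolyC /mmap1.
rewrite rmorph_prod -big_split; apply: eq_bigr => i _.
by rewrite tnth_mktuple exprZn -mul_mpolyC.
Qed.

Lemma mcoeff_sumX (A : nzRingType) (l : nat) (s : seq 'X_{1..l}) (E : 'X_{1..l} -> A) a :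
  uniq s -> (\sum_(b <- s) E b *: 'X_[b])@_a = if a \in s then E a else 0.
Proof.
move=> us; rewrite raddf_sum /=; case: ifP => [sa | sNa].
  rewrite (bigD1_seq a) //= mcoeffZ mcoeffX eqxx mulr1 big1 ?addr0 // => b.
  by rewrite mcoeffZ mcoeffX => /negPf ->; rewrite mulr0.
rewrite big_seq big1 // => b sb; rewrite mcoeffZ mcoeffX.
by case: eqP sNa => [<- | _ _]; rewrite ?sb ?mulr0.
Qed.

Lemma mcoeff_rescale (A : comNzRingType) (l : nat) (g : 'I_l -> A) f a :
  (rescale g f)@_a = f@_a * mmap1 g a.
Proof.
rewrite rescaleE mcoeff_sumX ?msupp_uniq //; case: ifP => // /negbT.
by rewrite -mcoeff_eq0 => /eqP ->; rewrite mul0r.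
Qed.

Lemma map_rescale (A B : comNzRingType) (h : {rmorphism A -> B}) (l : nat)
    (g : 'I_l -> A) f :
  map_mpoly h (rescale g f) = rescale (h \o g) (map_mpoly h f).
Proof.
apply/mpolyP => a; rewrite mcoeff_map !mcoeff_rescale mcoeff_map rmorphM.
congr (_ * _); rewrite /mmap1 rmorph_prod.
by apply: eq_bigr => i _; rewrite rmorphXn.
Qed.

Lemma eq_map_mpoly (A B : comNzRingType) (h h' : {rmorphism A -> B}) (l : nat)
    (f : {mpoly A[l]}) : h =1 h' -> map_mpoly h f = map_mpoly h' f.
Proof. by move=> hh'; apply/mpolyP => a; rewrite !mcoeff_map hh'. Qed.

Lemma map_mpoly_comp2 (A B D : comNzRingType) (y : {rmorphism A -> B})
    (z : {rmorphism B -> D}) (l : nat) (f : {mpoly A[l]}) :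
  map_mpoly (z \o y) f = map_mpoly z (map_mpoly y f).
Proof. by apply/mpolyP => a; rewrite !mcoeff_map. Qed.

Section TorusChart.
Variables (R : realType) (l r : nat).
Local Notation C := (R[i]).
Variables (tau : set 'rV[R]_r) (u : 'I_l -> 'rV[int]_r).
Variables (ST : comAlgType C) (tt : {lrmorphism fps C -> ST}).
Variables (chi : 'rV[int]_r -> ST).
Variables (H : param_scheme R u) (F : H ST) (JT : set {mpoly (fps C)[l]}).

Hypothesis torus_ideal : forall (A : comAlgType C) (y : {lrmorphism ST -> A}),
  (forall a, dual_monoid tau a -> exists b, y (chi a) * b = 1) ->
  par_ideal (par_pull y F) =
  ideal_gen [set rescale (fun i => y (chi (u i))) (map_mpoly (y \o tt) f) | f in JT].

Variables (B : idomainType) (s : B) (f : {rmorphism ST -> B}).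
Hypotheses (s_neq0 : s != 0)
  (chiE : forall a, dual_monoid tau a -> exists e, f (chi a) = s ^+ e).

Let gens := [set rescale (fun i => f (chi (u i))) (map_mpoly (f \o tt) j) | j in JT].

(** Each [f (chi a)] is a power of [s], hence invertible in [L = B[1/s]], so the equations known
    over the torus apply there. The two lemmas that follow contract this equality to [B], in both
    directions and up to a power of [s]. *)
Lemma torus_chart : exists (L : comNzRingType) (inc : {rmorphism B -> L}),
  [/\ injective inc, forall x, exists e b, inc (s ^+ e) * x = inc b
    & base_change_ideal inc (base_change_ideal f (par_ideal F)) =
      ideal_gen [set map_mpoly inc g | g in gens]].
Proof.
have [L [inc [inj [sV sVE] den]]] := localization_away s_neq0.
exists L, inc; split=> //.
(* [torus_ideal] speaks of C-algebras only; [L] receives its scalars through [ST]. *)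
pose kap : {rmorphism C -> L} := (inc \o (f \o in_alg ST))%FUN.
have [y yE] := via_lrmorphism (h := inc \o f) (kap := kap) (fun c => erefl _).
have yE' : y = (inc \o f)%FUN :> (ST -> L) by apply/funext.
rewrite base_change_comp.
have := torus_ideal (y := y); rewrite par_pullE yE' => yF.
apply: etrans (yF _) _.
  move=> a /chiE [e aE]; exists (sV ^+ e).
  by rewrite /= aE rmorphXn -exprMn sVE expr1n.
congr ideal_gen; apply/seteqP; split.
  move=> _ [j Jj <-]; exists (rescale (fun i => f (chi (u i))) (map_mpoly (f \o tt) j)).
    by exists j.
  by rewrite map_rescale -map_mpoly_comp2.
move=> _ [_ [j Jj <-] <-]; exists j => //.
by rewrite map_rescale -map_mpoly_comp2.
Qed.

Lemma pull_sub_torus g : base_change_ideal f (par_ideal F) g ->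
  exists e, ideal_gen gens (s ^+ e *: g).
Proof.
have [L [inc [inj den incE]]] := torus_chart.
by move=> /(mem_base_change inc); rewrite incE; apply: contract_away.
Qed.

Lemma torus_sub_pull g : ideal_gen gens g ->
  exists e, base_change_ideal f (par_ideal F) (s ^+ e *: g).
Proof.
have [L [inc [inj den incE]]] := torus_chart.
move=> /(ideal_gen_image (map_mpoly inc)); rewrite -incE => /(contract_away inj den).
move=> [e ge]; exists e; move: ge; apply: ideal_gen_sub => //.
exact: base_changeP.
Qed.

End TorusChart.

Section Dilation.
Variables (A B : comNzRingType) (h : {rmorphism A -> B}) (x : B) (d : nat).
Hypothesis d_gt0 : (0 < d)%N.

(* Substitution of [x s ^ d] for the variable. *)
Definition fps_dil (f : fps A) : fps B :=
  FPS (fun j => if (d %| j)%N then h (fcoef f (j %/ d)) * x ^+ (j %/ d) else 0).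

(** Terms of [f] of order at least [n] land in degrees at least [d * n > K]. This indexes the
    product by exponents of [f] instead of exponents of the dilated series. *)
Lemma fcoef_dilM (f : fps A) (b : fps B) n K : (K < d * n)%N ->
  fcoef (fps_dil f * b) K =
  \sum_(k < n) h (fcoef f k) * x ^+ k *
     (if (K < d * k)%N then 0 else fcoef b (K - d * k)).
Proof.
move=> ltK.
have dilE : fps_dil f = \sum_(k < n) (h (fcoef f k) * x ^+ k) *: fpsX B ^+ (d * k) +
                        fpsX B ^+ (d * n) * fps_shift (d * n) (fps_dil f).
  apply: fpsP => j; rewrite fcoefD fcoef_sum fcoefXnM.
  under eq_bigr do rewrite fcoefZ fcoefXn.
  case: ltnP => [lt_j|le_j]; last first.
    rewrite [X in _ + X]/= subnK // big1 ?add0r // => k _.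
    by rewrite gtn_eqF ?mulr0 // (leq_trans _ le_j) // ltn_pmul2l.
  rewrite addr0 /=; case: ifP => [/dvdnP[k jE] | dNj]; last first.
    rewrite big1 // => k _; case: eqP => [jE | _]; rewrite ?mulr0 //.
    by rewrite jE dvdn_mulr in dNj.
  have lt_kn : (k < n)%N by rewrite jE mulnC ltn_pmul2l in lt_j.
  rewrite jE mulnK // (bigD1 (Ordinal lt_kn)) //= mulnC eqxx mulr1 big1 ?addr0 // => i.
  by rewrite -val_eqE eqn_pmul2l // eq_sym => /negPf /= ->; rewrite mulr0.
rewrite dilE mulrDl fcoefD -mulrA fcoefXnM ltK addr0 mulr_suml fcoef_sum.
by apply: eq_bigr => k _; rewrite -scalerAl fcoefZ fcoefXnM.
Qed.

Fact fps_dil_additive : {morph fps_dil : f g / f - g}.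
Proof.
move=> f g; apply: fpsP => j /=; case: ifP => _; rewrite ?subr0 //.
by rewrite rmorphB mulrBl.
Qed.

Fact fps_dil_monoid : monoid_morphism fps_dil.
Proof.
split=> [|f g]; apply: fpsP => j.
  rewrite fcoef1 /=; case: ifP => [/dvdnP[k ->] | dNj].
    rewrite mulnK // rmorph_nat muln_eq0 (gtn_eqF d_gt0) orbF.
    by case: eqP => [->|_]; rewrite ?mulr1 ?mul0r.
  by case: eqP dNj => [->|//]; rewrite dvdn0.
have lt_j : (j < d * j.+1)%N by rewrite (leq_trans (ltnSn j)) // leq_pmull.
rewrite (fcoef_dilM _ _ lt_j) [LHS]/=; case: ifP => [/dvdnP[m] | dNj]; last first.
  rewrite big1 // => k _; case: ltnP => [_|le_kj]; rewrite ?mulr0 //=.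
  by rewrite dvdn_subl ?dvdn_mulr // dNj mulr0.
rewrite mulnC => ->; rewrite mulKn // rmorph_sum mulr_suml.
have le_m : (m.+1 <= (d * m).+1)%N by rewrite ltnS leq_pmull.
pose E k := h (fcoef f k) * x ^+ k * (if (d * m < d * k)%N then 0
              else fcoef (fps_dil g) (d * m - d * k)).
rewrite -[RHS]/(\sum_(k < (d * m).+1) E k) [RHS](bigID (fun k : 'I__ => (k < m.+1)%N)) /=.
rewrite [X in _ = _ + X]big1 ?addr0; last first.
  by move=> k; rewrite -leqNgt => lt_mk; rewrite /E ltn_pmul2l // lt_mk mulr0.
rewrite -(big_ord_widen _ E le_m); apply: eq_bigr => k _.
have le_km : (k <= m)%N by rewrite -ltnS.
rewrite /E ltn_pmul2l // ltnNge le_km /= -mulnBr dvdn_mulr // mulKn //.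
rewrite rmorphM [RHS]mulrACA -exprD subnKC //.
Qed.

HB.instance Definition _ := GRing.isZmodMorphism.Build (fps A) (fps B) fps_dil
  fps_dil_additive.
HB.instance Definition _ := GRing.isMonoidMorphism.Build (fps A) (fps B) fps_dil
  fps_dil_monoid.

Lemma fps_dilZ a f : fps_dil (a *: f) = h a *: fps_dil f.
Proof.
by apply: fpsP => j /=; case: ifP; rewrite ?mulr0 // rmorphM mulrA.
Qed.

Lemma fps_dilX : fps_dil (fpsX A) = x *: fpsX B ^+ d.
Proof.
apply: fpsP => j; rewrite fcoefZ fcoefXn /=; case: ifP => [/dvdnP[k ->]|dNj].
  rewrite mulnK // rmorph_nat.
  have -> : (k * d == d)%N = (k == 1)%N by rewrite -[X in (_ == X)%N]mul1n eqn_pmul2r.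
  by case: eqP => [->|_]; rewrite ?mul1r ?mul0r ?mulr1 ?mulr0.
by case: eqP dNj => [->|_ _]; rewrite ?dvdnn ?mulr0.
Qed.

(** Continuity is automatic: the remainder of [f] after its first [j + 1] terms is a multiple of the
    variable to the power [j + 1], and its image starts in degree [d * (j + 1) > j]. *)
Lemma fps_dil_uniq (g : {rmorphism fps A -> fps B}) :
  (forall a, g a%:A = (h a)%:A) -> g (fpsX A) = x *: fpsX B ^+ d -> g =1 fps_dil.
Proof.
move=> ga gX f; apply: fpsP => j.
have lt_j : (j < d * j.+1)%N by rewrite (leq_trans (ltnSn j)) // leq_pmull.
have vanish (y : {rmorphism fps A -> fps B}) f' :
    y (fpsX A) = x *: fpsX B ^+ d -> fcoef (y (fpsX A ^+ j.+1 * f')) j = 0.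
  move=> yX; rewrite rmorphM rmorphXn yX exprZn -exprM -scalerAl fcoefZ fcoefXnM lt_j.
  by rewrite mulr0.
rewrite (fps_truncE j.+1 f) !rmorphD !fcoefD !vanish //; last exact: fps_dilX.
rewrite !addr0 !rmorph_sum !fcoef_sum; apply: eq_bigr => i _.
congr (fcoef _ j); apply: etrans (esym (fps_dilZ _ _)).
rewrite -mulr_algl rmorphM ga !rmorphXn gX mulr_algl; congr (_ *: _ ^+ i).
by rewrite -fps_dilX.
Qed.

End Dilation.

(** * Weights and symbols *)

(** Coefficientwise application of a map that may depend on the exponent, as needed for operations
    that see the weight of a monomial. *)
HB.lock Definition mfam (l : nat) (A B : nzRingType) (E : 'X_{1..l} -> A -> B)
    (f : {mpoly A[l]}) : {mpoly B[l]} :=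
  \sum_(a <- msupp f) E a f@_a *: 'X_[a].

Lemma mcoeff_mfam (l : nat) (A B : nzRingType) (E : 'X_{1..l} -> A -> B) f a :
  (forall a, E a 0 = 0) -> (mfam E f)@_a = E a f@_a.
Proof.
move=> E0; rewrite mfam.unlock mcoeff_sumX ?msupp_uniq //; case: ifP => // /negbT.
by rewrite -mcoeff_eq0 => /eqP ->; rewrite E0.
Qed.

Lemma mpolyZM (A : comNzRingType) (l : nat) (x y : A) (f g : {mpoly A[l]}) :
  (x *: f) * (y *: g) = (x * y) *: (f * g).
Proof. by rewrite -scalerAl -scalerAr scalerA. Qed.

Lemma poly_mpolyE (A : nzRingType) (l : nat) (f : {mpoly {poly A}[l]}) :
  f = \sum_(a <- msupp f) \sum_(i < size f@_a) (f@_a`_i *: 'X^i) *: 'X_[a].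
Proof.
rewrite [LHS]mpolyE; apply: eq_bigr => a _.
by rewrite -scaler_suml -[in LHS](coefK f@_a) poly_def.
Qed.

(* Locked, since unfolding it makes unification diverge. *)
HB.lock Definition blow (R : realType) (l : nat) (w : 'I_l -> nat) (D : comNzRingType)
    (psi : fps R[i] -> fps D) (f : {mpoly (fps R[i])[l]}) : {mpoly (fps D)[l]} :=
  rescale (fun i => fpsX D ^+ w i) (map_mpoly psi f).

Section Weights.
Variables (R : realType) (l w0 : nat) (w : 'I_l -> nat).
Hypothesis w0_gt0 : (0 < w0)%N.
Local Notation C := (R[i]).
Local Notation P := {mpoly (fps C)[l]}.
Local Notation V := {mpoly {poly C}[l]}.
Local Notation s := (fpsX {poly C}).
Local Notation S := (@weight_ge R l w0 w).

Definition wdeg (a : 'X_{1..l}) : nat := \sum_(j < l) w j * a j.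

Lemma wdegD a b : wdeg (a + b)%MM = (wdeg a + wdeg b)%N.
Proof.
by rewrite /wdeg -big_split; apply: eq_bigr => j _; rewrite mnmDE mulnDr.
Qed.

Lemma wdeg0 : wdeg 0%MM = 0%N.
Proof. by rewrite /wdeg big1 // => j _; rewrite mnm0E muln0. Qed.

Lemma wdegU i : wdeg U_(i)%MM = w i.
Proof.
rewrite /wdeg (bigD1 i) //= mnm1E eqxx muln1 big1 ?addn0 // => j.
by rewrite mnm1E eq_sym => /negPf ->; rewrite muln0.
Qed.

Lemma mmap1_Xw (D : comNzRingType) a :
  mmap1 (fun i => fpsX D ^+ w i) a = fpsX D ^+ wdeg a.
Proof.
rewrite /mmap1 /wdeg expr_sum; apply: eq_bigr => i _.
by rewrite exprM.
Qed.

Lemma weight_geP n (f : P) : S n f <->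
  forall a i, (w0 * i + wdeg a < n)%N -> fcoef f@_a i = 0.
Proof.
split=> [Sf a i lt_n | Sf a i fai].
  by apply/eqP; apply: contraTT lt_n => /Sf; rewrite -leqNgt.
by rewrite leqNgt; apply: contraNN fai => /Sf ->.
Qed.

Section Blow.
Variables (D : comNzRingType) (psi : {rmorphism fps C -> fps D}).

Lemma mcoeff_blow f a : (blow w psi f)@_a = fpsX D ^+ wdeg a * psi f@_a.
Proof. by rewrite blow.unlock mcoeff_rescale mcoeff_map mmap1_Xw mulrC. Qed.

Fact blow_additive : {morph blow w psi : f g / f - g}.
Proof. by move=> f g; rewrite blow.unlock /rescale !rmorphB. Qed.
Fact blow_monoid : monoid_morphism (blow w psi).
Proof. by split=> [|f g]; rewrite blow.unlock /rescale ?rmorph1 ?rmorphM. Qed.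
HB.instance Definition _ := GRing.isZmodMorphism.Build P {mpoly (fps D)[l]}
  (blow w psi) blow_additive.
HB.instance Definition _ := GRing.isMonoidMorphism.Build P {mpoly (fps D)[l]}
  (blow w psi) blow_monoid.

Lemma blowC c : blow w psi c%:MP = (psi c)%:MP.
Proof. by rewrite blow.unlock map_mpolyC /rescale comp_mpolyC. Qed.

Lemma blowM f g : blow w psi (f * g) = blow w psi f * blow w psi g.
Proof. exact: rmorphM. Qed.

End Blow.

Local Notation psi := (fps_dil (polyC : {rmorphism C -> {poly C}}) 'X w0).
Local Notation beta := (blow w psi).

(** A term t^i z^a goes to X^i s^(w0 i + wdeg a) z^a under [beta], which turns the weight into the
    order in [s]. *)
Lemma weight_ge_blow n f : S n f <-> exists g, beta f = s ^+ n *: g.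
Proof.
split=> [/weight_geP Sf | [g fE]].
  exists (map_mpoly (fps_shift n) (beta f)); apply/mpolyP => a.
  rewrite mcoeffZ.
  rewrite mcoeff_map_mpoly.
  apply: esym; apply: fps_shiftE => j lt_j.
  rewrite mcoeff_blow fcoefXnM; case: ltnP => // le_aj /=.
  case: ifP => // /dvdnP[k kE]; rewrite kE mulnK // Sf ?rmorph0 ?mul0r //.
  by rewrite mulnC -kE subnK.
apply/weight_geP => a i lt_n; move/mpolyP/(_ a): fE; rewrite mcoeff_blow mcoeffZ.
move/(congr1 (fun b => fcoef b (w0 * i + wdeg a))).
rewrite !fcoefXnM lt_n ltnNge leq_addl addnK /= dvdn_mulr // mulKn //.
by move/eqP; rewrite mul_polyC scaler_eq0 (negPf (monic_neq0 (monicXn _ _))) orbF => /eqP.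
Qed.

Lemma weight_geD n f g : S n f -> S n g -> S n (f + g).
Proof.
move=> /weight_geP Sf /weight_geP Sg; apply/weight_geP => a i lt_n.
by rewrite mcoeffD fcoefD Sf // Sg // addr0.
Qed.

Lemma weight_ge_zero n : S n 0.
Proof. by apply/weight_geP => a i _; rewrite mcoeff0. Qed.

Lemma weight_ge_all f : S 0 f.
Proof. by apply/weight_geP. Qed.

Lemma weight_geW n k f : (k <= n)%N -> S n f -> S k f.
Proof.
move=> le_kn /weight_geP Sf; apply/weight_geP => a i lt_k.
by apply: Sf; apply: leq_trans le_kn.
Qed.

Lemma weight_geM n k f g : S n f -> S k g -> S (n + k) (f * g).
Proof.
move=> /weight_ge_blow[f' fE] /weight_ge_blow[g' gE]; apply/weight_ge_blow.
by exists (f' * g'); rewrite blowM fE gE mpolyZM exprD.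
Qed.

Lemma weight_geMl n f g : S n g -> S n (f * g).
Proof. by move=> Sg; rewrite -[n]add0n; apply: (weight_geM _ Sg); apply: weight_ge_all. Qed.

Lemma weight_geMr n f g : S n f -> S n (f * g).
Proof. by rewrite mulrC; apply: weight_geMl. Qed.

Lemma weight_geN n f : S n f -> S n (- f).
Proof. by rewrite -mulN1r; apply: weight_geMl. Qed.

Lemma weight_geXn n k f : S n f -> S (k * n) (f ^+ k).
Proof.
move=> Sf; elim: k => [|k IHk]; first exact: weight_ge_all.
by rewrite exprS mulSn; apply: weight_geM.
Qed.

Lemma weight_ge_t : S w0 (fpsX C)%:MP.
Proof.
apply/weight_geP => a [|i]; rewrite mcoeffC.
  by case: eqP => _; rewrite ?mulr1 ?mulr0.
by rewrite mulnS -addnA ltnNge leq_addr.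
Qed.

Lemma weight_ge_z i : S (w i) 'X_i.
Proof.
apply/weight_geP => a j; rewrite mcoeffX; case: eqP => // <-.
by rewrite wdegU ltnNge leq_addl.
Qed.

(* The homogeneous part of degree [n] of a class modulo higher weights. *)
Definition symbol n (f : P) : V :=
  mfam (fun a (c : fps C) => \poly_(i < n.+1)
          (if (w0 * i + wdeg a == n)%N then fcoef c i else 0)) f.

(** The grading of [V] puts X in degree [w0] and z_i in degree [w i]. The bound [n.+1] loses
    nothing: as [w0 > 0], degree [n] forces [i <= n]. *)
Definition hpart n (h : V) : V :=
  mfam (fun a (c : {poly C}) => \poly_(i < n.+1)
          (if (w0 * i + wdeg a == n)%N then c`_i else 0)) h.

Let lt_of_deg n i a : (w0 * i + wdeg a == n)%N -> (i < n.+1)%N.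
Proof.
move/eqP <-; rewrite ltnS (leq_trans (leq_pmull i w0_gt0)) //.
exact: leq_addr.
Qed.

Lemma coef_symbol n f a i :
  (symbol n f)@_a`_i = if (w0 * i + wdeg a == n)%N then fcoef f@_a i else 0.
Proof.
rewrite mcoeff_mfam; last first.
  by move=> b; apply/polyP => j; rewrite coef_poly ?coef0 !if_same.
rewrite coef_poly; case: ifP => // ni; case: ifP => // /lt_of_deg.
by rewrite ni.
Qed.

Lemma coef_hpart n h a i :
  (hpart n h)@_a`_i = if (w0 * i + wdeg a == n)%N then h@_a`_i else 0.
Proof.
rewrite mcoeff_mfam; last first.
  by move=> b; apply/polyP => j; rewrite coef_poly ?coef0 !if_same.
rewrite coef_poly; case: ifP => // ni; case: ifP => // /lt_of_deg.
by rewrite ni.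
Qed.

Lemma vpolyP (h h' : V) : (forall a i, h@_a`_i = h'@_a`_i) -> h = h'.
Proof. by move=> hh'; apply/mpolyP => a; apply/polyP => i. Qed.

Lemma symbolD n f g : symbol n (f + g) = symbol n f + symbol n g.
Proof.
apply: vpolyP => a i; rewrite !(mcoeffD, coefD) !coef_symbol mcoeffD.
by case: ifP; rewrite ?addr0.
Qed.

Lemma symbolN n f : symbol n (- f) = - symbol n f.
Proof.
apply: vpolyP => a i; rewrite mcoeffN coefN !coef_symbol mcoeffN.
by case: ifP; rewrite ?oppr0.
Qed.

(** The coefficient of s^n in [beta f] collects exactly the terms of weight [n]. Seen this way,
    multiplicativity of symbols follows from [beta] being a ring morphism. *)
Lemma symbol_blow n f g : beta f = s ^+ n *: g ->
  map_mpoly (@fps_coef0 _) g = symbol n f.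
Proof.
move=> fE; apply: vpolyP => a i; rewrite coef_symbol mcoeff_map /fps_coef0.
move/mpolyP/(_ a)/(congr1 (fun b : fps {poly C} => (fcoef b n)`_i)): fE.
rewrite mcoeff_blow mcoeffZ !fcoefXnM ltnn subnn => <-.
case: ltnP => [lt_na|le_an].
  by rewrite coef0 gtn_eqF // (leq_trans lt_na) // leq_addl.
rewrite /=; case: ifP => [/dvdnP[k kE]|dN]; last first.
  rewrite coef0; case: eqP => // nE.
  by rewrite -nE addnK dvdn_mulr in dN.
rewrite kE mulnK // coefCM coefXn -(subnK le_an) kE eqn_add2r mulnC eqn_pmul2r //.
by rewrite eq_sym; case: eqP => [->|_]; rewrite ?mulr1 ?mulr0.
Qed.

Lemma symbolM n k f g : S n f -> S k g ->
  symbol (n + k) (f * g) = symbol n f * symbol k g.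
Proof.
move=> /weight_ge_blow[f' fE] /weight_ge_blow[g' gE].
rewrite -(symbol_blow fE) -(symbol_blow gE) -rmorphM; apply/esym/symbol_blow.
by rewrite blowM fE gE mpolyZM exprD.
Qed.

Lemma symbol_eq0 n f : S n f -> (symbol n f = 0 <-> S n.+1 f).
Proof.
move=> /weight_geP Sf; split=> [f0 | /weight_geP Sf1]; last first.
  apply: vpolyP => a i; rewrite coef_symbol mcoeff0 coef0.
  by case: eqP => // nE; apply: Sf1; rewrite nE.
apply/weight_geP => a i; rewrite ltnS leq_eqVlt => /orP[nE|/Sf //].
by have := coef_symbol n f a i; rewrite nE f0 mcoeff0 coef0.
Qed.

Lemma symbol1 : symbol 0 1 = 1.
Proof.
apply: vpolyP => a i; rewrite coef_symbol !mcoeff1.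
case: (a =P 0%MM) => [-> | _]; last by rewrite coef0 if_same.
rewrite !mulr1n wdeg0 addn0 muln_eq0 gtn_eqF // fcoef1 coef1.
by case: eqP.
Qed.

Lemma symbol_t : symbol w0 (fpsX C)%:MP = 'X%:MP.
Proof.
apply: vpolyP => a i; rewrite coef_symbol !mcoeffC.
case: (a =P 0%MM) => [-> | _]; last by rewrite !mulr0 coef0 if_same.
rewrite !mulr1 wdeg0 addn0 -[X in (_ == X)%N]muln1 eqn_pmul2l //= coefX.
by case: eqP.
Qed.

Lemma symbolC c : symbol 0 (c%:A)%:MP = c%:P%:MP.
Proof.
apply: vpolyP => a i; rewrite coef_symbol !mcoeffC.
case: (a =P 0%MM) => [-> | _]; last by rewrite !mulr0 coef0 if_same.
rewrite !mulr1 wdeg0 addn0 muln_eq0 gtn_eqF // orFb fcoef_alg coefC.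
by case: eqP.
Qed.

Lemma symbol_z i : symbol (w i) 'X_i = 'X_i.
Proof.
apply: vpolyP => a j; rewrite coef_symbol !mcoeffX.
case: (U_(i)%MM =P a) => [<- | _]; last by rewrite coef0 if_same.
rewrite wdegU -[X in (_ == X)%N]add0n eqn_add2r muln_eq0 gtn_eqF // orFb coef1.
by case: (j =P 0%N) => [->|].
Qed.

Lemma hpart_symbol n f : hpart n (symbol n f) = symbol n f.
Proof. by apply: vpolyP => a i; rewrite coef_hpart coef_symbol; case: eqP. Qed.

Lemma hpart_id n h : hpart n (hpart n h) = hpart n h.
Proof. by apply: vpolyP => a i; rewrite !coef_hpart; case: eqP. Qed.

Lemma sum_hpart h : exists N, h = \sum_(n < N) hpart n h.
Proof.
have [N NP] : exists N, forall a i, h@_a`_i != 0 -> (w0 * i + wdeg a < N)%N.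
  exists (\max_(a <- msupp h) (w0 * size h@_a + wdeg a)).+1 => a i hai.
  have ha : a \in msupp h by rewrite mcoeff_msupp; apply: contraNneq hai => ->; rewrite coef0.
  rewrite ltnS (bigD1_seq a) ?msupp_uniq //= leq_max leq_add2r leq_pmul2l //.
  by rewrite ltnW // ltnNge; apply: contraNN hai => /leq_sizeP ->.
exists N; apply: vpolyP => a i; rewrite raddf_sum coef_sum.
under eq_bigr do rewrite coef_hpart.
have [->|hai] := eqVneq h@_a`_i 0; first by rewrite big1 // => n _; rewrite if_same.
rewrite (bigD1 (Ordinal (NP _ _ hai))) //= eqxx big1 ?addr0 // => n.
by rewrite -val_eqE eq_sym /= => /negPf ->.
Qed.

End Weights.

Section Components.
Variables (R : realType) (l w0 : nat) (w : 'I_l -> nat).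
Hypothesis w0_gt0 : (0 < w0)%N.
Local Notation C := (R[i]).
Local Notation P := {mpoly (fps C)[l]}.
Local Notation B := (fps {poly C}).
Local Notation s := (fpsX {poly C}).
Local Notation S := (@weight_ge R l w0 w).
Local Notation psi := (fps_dil (polyC : {rmorphism C -> {poly C}}) 'X w0).
Local Notation beta := (blow w psi).

(* Terms X^i s^j with j = w0 i + e, read as t^i. *)
Definition slice e (b : B) : fps C := FPS (fun i => (fcoef b (w0 * i + e)%N)`_i).

Lemma fcoef_slice e b i : fcoef (slice e b) i = (fcoef b (w0 * i + e)%N)`_i.
Proof. by []. Qed.

Lemma slice0 e : slice e 0 = 0.
Proof. by apply: fpsP => i; rewrite /= coef0. Qed.

Lemma sliceD e b b' : slice e (b + b') = slice e b + slice e b'.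
Proof. by apply: fpsP => i; rewrite /= coefD. Qed.

(** The image X^k s^(w0 k) of t^k moves terms along the line [j = w0 * i + e], so each slice is
    linear over C[[t]]. *)
Lemma slice_psi e c b : slice e (psi c * b) = c * slice e b.
Proof.
apply: fpsP => i; rewrite fcoefM fcoef_slice.
have lt_K : (w0 * i + e < w0 * (w0 * i + e).+1)%N.
  by rewrite (leq_trans (ltnSn _)) // leq_pmull.
rewrite (fcoef_dilM _ _ _ _ _ lt_K) // coef_sum.
have le_i : (i.+1 <= (w0 * i + e).+1)%N.
  by rewrite ltnS (leq_trans (leq_pmull i w0_gt0)) ?leq_addr.
pose E k := fcoef c k * fcoef (slice e b) (i - k).
rewrite -[RHS]/(\sum_(k < i.+1) E k) (big_ord_widen _ E le_i) [RHS]big_mkcond.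
apply: eq_bigr => k _; rewrite -mulrA coefCM coefXnM ltnS.
case: ltnP => [lt_ik | le_ki]; first by rewrite mulr0.
rewrite ltnNge (leq_trans _ (leq_addr e _)) ?leq_pmul2l //= /E fcoef_slice.
by rewrite mulnBr addnBAC ?leq_pmul2l.
Qed.

Lemma slice_shift e k b : slice (e + k) (s ^+ k * b) = slice e b.
Proof.
by apply: fpsP => i; rewrite !fcoef_slice fcoefXnM addnA ltnNge leq_addl addnK.
Qed.

(* The component of [g] of degree n - e, for X of degree w0, s of degree -1 and
   z_i of degree w_i, read as a function of t and z. *)
Definition component n e (g : {mpoly B[l]}) : P :=
  mfam (fun a b => slice (wdeg w a + e) (s ^+ n * b)) g.

Lemma mcoeff_component n e g a :
  (component n e g)@_a = slice (wdeg w a + e) (s ^+ n * g@_a).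
Proof. by rewrite mcoeff_mfam // => b; rewrite mulr0 slice0. Qed.

Lemma componentD n e g g' :
  component n e (g + g') = component n e g + component n e g'.
Proof.
by apply/mpolyP => a; rewrite mcoeffD !mcoeff_component mcoeffD mulrDr sliceD.
Qed.

Lemma component0 n e : component n e 0 = 0.
Proof. by apply/mpolyP => a; rewrite mcoeff_component !mcoeff0 mulr0 slice0. Qed.

Lemma component_sum n e (T : Type) (r : seq T) (Q : pred T) (f : T -> {mpoly B[l]}) :
  component n e (\sum_(i <- r | Q i) f i) = \sum_(i <- r | Q i) component n e (f i).
Proof. exact: (big_morph _ (componentD n e) (component0 n e)). Qed.

Lemma component_term n e c m :
  component n e (c *: 'X_[m]) = slice (wdeg w m + e) (s ^+ n * c) *: 'X_[m].
Proof.
apply/mpolyP => a; rewrite mcoeff_component !mcoeffZ !mcoeffX.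
by case: eqP => [->|_]; rewrite ?mulr1 ?mulr0 ?slice0.
Qed.

Lemma blow_term c m : beta (c *: 'X_[m]) = (s ^+ wdeg w m * psi c) *: 'X_[m].
Proof.
apply/mpolyP => a; rewrite mcoeff_blow !mcoeffZ !mcoeffX.
by case: eqP => [->|_]; rewrite ?mulr1 ?mulr0 ?rmorph0 ?mulr0.
Qed.

(** Values of [beta] have degree 0 for the grading with s in degree -1, hence multiplication by them
    commutes with taking a homogeneous component. *)
Lemma component_blowM n e f g : component n e (beta f * g) = f * component n e g.
Proof.
rewrite [f in LHS]mpolyE [g in LHS]mpolyE raddf_sum mulr_suml component_sum /=.
rewrite [f in RHS]mpolyE mulr_suml; apply: eq_bigr => a _.
rewrite mulr_sumr component_sum [g in RHS]mpolyE component_sum mulr_sumr.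
apply: eq_bigr => b _.
rewrite [beta _]blow_term mpolyZM -mpolyXD [LHS]component_term [component _ _ _]component_term.
rewrite [RHS]mpolyZM -mpolyXD wdegD; congr (_ *: _).
rewrite -addnA [(wdeg w a + _)%N]addnC -mulrA mulrCA slice_shift.
by rewrite (mulrCA _ (psi _)) slice_psi.
Qed.

Lemma component_shift n e k g : component n (e + k) (s ^+ k *: g) = component n e g.
Proof.
apply/mpolyP => a; rewrite !mcoeff_component mcoeffZ mulrCA addnA.
exact: slice_shift.
Qed.

Lemma component_weight_ge n e g : S (n - e) (component n e g).
Proof.
apply/weight_geP => a i lt_n; rewrite mcoeff_component fcoef_slice fcoefXnM.
by rewrite addnA addnC -ltn_subRL lt_n coef0.
Qed.

Lemma component_blow n f g : beta f = s ^+ n *: g -> component n 0 g = f.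
Proof.
move=> fE; apply/mpolyP => a; apply: fpsP => i.
rewrite mcoeff_component -mcoeffZ -fE mcoeff_blow addn0 fcoef_slice.
rewrite fcoefXnM ltnNge leq_addl addnK /= dvdn_mulr // mulKn //.
by rewrite coefCM coefXn eqxx mulr1.
Qed.

(** X has degree [w0] whereas t has degree 0, which explains the offset [w0] on the right. *)
Lemma component_X n g :
  component n 0 ('X%:A *: g) = (fpsX C)%:MP * component n w0 g.
Proof.
apply/mpolyP => a; apply: fpsP => i.
rewrite mcoeffCM !mcoeff_component mcoeffZ fcoefXM addn0 fcoef_slice.
rewrite mulr_algl -scalerAr fcoefZ coefXM.
case: i => [|i] //; rewrite fcoef_slice [in LHS]/=.
by rewrite mulnS [(w0 + _)%N]addnC -addnA [(w0 + _)%N]addnC.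
Qed.

Lemma symbol_component n g :
  symbol w0 w n (component n 0 g) = hpart w0 w n (map_mpoly (@fps_coef0 _) g).
Proof.
apply: vpolyP => a i; rewrite coef_symbol // coef_hpart // mcoeff_map.
case: eqP => // nE; rewrite mcoeff_component addn0 fcoef_slice nE.
by rewrite fcoefXnM ltnn subnn.
Qed.

End Components.

Lemma quotient_lift (A B G : comNzRingType) (I : set A) (q : {rmorphism A -> B})
    (f : {rmorphism A -> G}) :
    is_quotient I q -> (forall a, f a = 0 <-> I a) ->
  exists psi : {rmorphism B -> G}, injective psi /\ forall a, psi (q a) = f a.
Proof.
move=> [surj ker] fker; have [c cE] := choice surj.
have fq a a' : (f a == f a') = (q a == q a').
  rewrite -subr_eq0 -[RHS]subr_eq0 -!rmorphB.
  by apply/eqP/eqP => [/fker/ker | /ker/fker].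
have fcE a : f (c (q a)) = f a by apply/eqP; rewrite fq cE.
pose psi b := f (c b).
have psiD : {morph psi : b b' / b - b'}.
  move=> b b'; rewrite /psi -rmorphB; apply/eqP.
  by rewrite fq rmorphB !cE.
have psiM : monoid_morphism psi.
  split=> [|b b']; rewrite /psi -?rmorphM -?(rmorph1 f); apply/eqP;
    by rewrite fq ?rmorphM ?rmorph1 !cE.
pose m1 := GRing.isZmodMorphism.Build B G psi psiD.
pose m2 := GRing.isMonoidMorphism.Build B G psi psiM.
pose g : {rmorphism B -> G} := HB.pack psi m1 m2.
exists g; split=> // b b' /eqP; rewrite -[g b]/(f (c b)) -[g b']/(f (c b')).
by rewrite fq !cE => /eqP.
Qed.

Section Evaluation.
Variables (R : realType) (l : nat).
Local Notation C := (R[i]).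
Local Notation V := {mpoly {poly C}[l]}.
Variables (A : comNzRingType) (kap : {rmorphism C -> A}) (t : A) (z : 'I_l -> A).

Definition vev : V -> A := mmap (horner_eval t \o map_poly kap) z.

Fact vev_additive : {morph vev : f g / f - g}.
Proof. exact: rmorphB. Qed.
Fact vev_monoid : monoid_morphism vev.
Proof. by split=> [|f g]; rewrite /vev ?rmorph1 ?rmorphM. Qed.
HB.instance Definition _ := GRing.isZmodMorphism.Build V A vev vev_additive.
HB.instance Definition _ := GRing.isMonoidMorphism.Build V A vev vev_monoid.

Lemma vev_coef p : vev p%:MP = (map_poly kap p).[t].
Proof. exact: mmapC. Qed.

Lemma vevC c : vev c%:P%:MP = kap c.
Proof. by rewrite vev_coef map_polyC hornerC. Qed.

Lemma vevX : vev 'X%:MP = t.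
Proof. by rewrite vev_coef map_polyX hornerX. Qed.

Lemma vev_mon a : vev 'X_[a] = mmap1 z a.
Proof. exact: mmapX. Qed.

Lemma vev_z i : vev 'X_i = z i.
Proof. by rewrite vev_mon mmap1U. Qed.

Lemma vev_term c i a : vev ((c *: 'X^i) *: 'X_[a]) = kap c * t ^+ i * mmap1 z a.
Proof.
rewrite -mul_mpolyC rmorphM /= vev_mon vev_coef map_polyZ map_polyXn.
by rewrite hornerZ hornerXn.
Qed.

End Evaluation.

(** * Comparison of a quotient of [V] with the graded ring of a filtration *)

Section GradedMap.
Variables (R : realType) (l w0 : nat) (w : 'I_l -> nat).
Hypothesis w0_gt0 : (0 < w0)%N.
Local Notation C := (R[i]).
Local Notation V := {mpoly {poly C}[l]}.

Variables (A G : comNzRingType) (S : nat -> set A) (sym : nat -> A -> G).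
Hypotheses (S0 : forall n, S n 0) (SD : forall n a b, S n a -> S n b -> S n (a + b))
  (SM : forall i j a b, S i a -> S j b -> S (i + j)%N (a * b)).
Hypotheses (symD : forall n a b, S n a -> S n b -> sym n (a + b) = sym n a + sym n b)
  (symM : forall i j a b, S i a -> S j b -> sym (i + j)%N (a * b) = sym i a * sym j b)
  (sym1 : sym 0 1 = 1).
Variables (kap : {rmorphism C -> A}) (t : A) (z : 'I_l -> A).
Hypotheses (Sk : forall c, S 0%N (kap c)) (St : S w0 t) (Sz : forall i, S (w i) (z i)).

Let sym_0 n : sym n 0 = 0.
Proof. by apply: (addrI (sym n 0)); rewrite -symD // !addr0. Qed.

Let S1 : S 0 1.
Proof. by rewrite -(rmorph1 kap). Qed.

Lemma sym_scalars : exists kG : {rmorphism C -> G}, forall c, kG c = sym 0%N (kap c).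
Proof.
pose f c := sym 0%N (kap c).
have fD : {morph f : b b' / b - b'}.
  move=> b b'; apply: (addIr (f b')); rewrite subrK /f -symD // -rmorphD.
  by rewrite subrK.
have fM : monoid_morphism f.
  split=> [|b b']; rewrite /f ?rmorph1 // rmorphM.
  by rewrite -symM.
pose m1 := GRing.isZmodMorphism.Build C G f fD.
pose m2 := GRing.isMonoidMorphism.Build C G f fM.
by exists (HB.pack_for {rmorphism C -> G} f m1 m2).
Qed.

Lemma sym_exp n x k : S n x -> S (n * k)%N (x ^+ k) /\ sym (n * k)%N (x ^+ k) = sym n x ^+ k.
Proof.
move=> Sx; elim: k => [|k [IHS IHs]]; first by rewrite muln0 !expr0.
by rewrite mulnS !exprS; split; [apply: SM | rewrite symM // IHs].
Qed.

Lemma sym_monomial a : S (wdeg w a) (mmap1 z a) /\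
  sym (wdeg w a) (mmap1 z a) = mmap1 (fun i => sym (w i) (z i)) a.
Proof.
rewrite /wdeg /mmap1; elim: (index_enum _) => [|i r [IHS IHs]]; first by rewrite !big_nil.
have [Si si] := sym_exp (a i) (Sz i).
by rewrite !big_cons; split; [apply: SM | rewrite symM // IHs si].
Qed.

(** Homogeneity of [h] leaves only terms of degree [n], and the symbol of each is the product of the
    symbols of its factors. *)
Lemma sym_vev (kG : {rmorphism C -> G}) n h : (forall c, kG c = sym 0%N (kap c)) ->
    hpart w0 w n h = h ->
  S n (vev kap t z h) /\
  sym n (vev kap t z h) = vev kG (sym w0 t) (fun i => sym (w i) (z i)) h.
Proof.
move=> kGE hh; set evG := vev kG _ _.
rewrite (congr1 (vev kap t z) (poly_mpolyE h)) (congr1 evG (poly_mpolyE h)).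
rewrite /evG !rmorph_sum /=.
pose rel x y := S n x /\ sym n x = y.
have rel0 : rel 0 0 by split.
have relD x x' y y' : rel x x' -> rel y y' -> rel (x + y) (x' + y').
  by move=> [Sx <-] [Sy <-]; split; [apply: SD | rewrite symD].
apply: (big_ind2 rel) => // a _; rewrite !rmorph_sum /=.
apply: (big_ind2 rel) => // i _; rewrite !vev_term.
have [nE | nN] := eqVneq (w0 * i + wdeg w a)%N n; last first.
  suff -> : h@_a`_i = 0 by rewrite !rmorph0 !mul0r.
  by have := coef_hpart w w0_gt0 n h a i; rewrite hh (negPf nN).
have [Si si] := sym_exp i St; have [Sa sa] := sym_monomial a.
rewrite /rel -nE -sa kGE -si -mulrA -[(w0 * i + _)%N]add0n.
by split; [do 2 apply: SM => // | rewrite !symM //; [rewrite mulrA | apply: SM]].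
Qed.

End GradedMap.

Section GradedRing.
Variables (R : realType) (l w0 : nat) (w : 'I_l -> nat).
Hypothesis w0_gt0 : (0 < w0)%N.
Local Notation C := (R[i]).
Local Notation V := {mpoly {poly C}[l]}.

Variables (A G : comNzRingType) (S K : nat -> set A) (sym : nat -> A -> G).
Hypothesis gr : graded_quotient S K sym.
Hypotheses (S0 : forall n, S n 0) (SD : forall n a b, S n a -> S n b -> S n (a + b))
  (SM : forall i j a b, S i a -> S j b -> S (i + j)%N (a * b)).
Variables (kap : {rmorphism C -> A}) (t : A) (z : 'I_l -> A).
Hypotheses (Sk : forall c, S 0%N (kap c)) (St : S w0 t) (Sz : forall i, S (w i) (z i)).

Let symD n a b : S n a -> S n b -> sym n (a + b) = sym n a + sym n b.
Proof. by case: gr => + _ _ _ _; apply. Qed.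

Let symM i j a b : S i a -> S j b -> sym (i + j)%N (a * b) = sym i a * sym j b.
Proof. by case: gr => _ _ [_ +] _ _; apply. Qed.

Let sym1 : sym 0 1 = 1.
Proof. by case: gr => _ _ [+ _] _ _. Qed.

Variables (OW : comNzRingType) (q : {rmorphism V -> OW}) (IV : set V).
Hypotheses (idIV : ideal IV) (qIV : is_quotient IV q).
Hypothesis IV_hom : forall n h, IV h -> IV (hpart w0 w n h).
Hypothesis S_lift : forall n a, S n a ->
  exists h, hpart w0 w n h = h /\ K n (a - vev kap t z h).
Hypothesis K_IV : forall n h, hpart w0 w n h = h -> (K n (vev kap t z h) <-> IV h).

(** Evaluation at the symbols of [t] and the [z i] maps [V] to [G]. Its kernel is [IV], since both
    are determined degree by degree and agree there by [K_IV]; it is onto because [S_lift]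
    represents every class by a homogeneous polynomial. The abstract form serves both the local ring
    at x and the cone over the exceptional divisor. *)
Lemma graded_iso : exists psi : {rmorphism OW -> G},
  [/\ bijective psi, psi (q 'X%:MP) = sym w0 t,
      forall c, psi (q c%:P%:MP) = sym 0%N (kap c)
    & forall i, psi (q 'X_i) = sym (w i) (z i)].
Proof.
have [kG kGE] := sym_scalars symD symM sym1 Sk.
have symK n a : S n a -> (sym n a = 0 <-> K n a) by case: gr => _ + _ _ _; apply.
pose evG : {rmorphism V -> G} := vev kG (sym w0 t) (fun i => sym (w i) (z i)).
have evE n h : hpart w0 w n h = h -> S n (vev kap t z h) /\ sym n (vev kap t z h) = evG h.
  by apply: sym_vev.
have evG0 h : evG h = 0 <-> IV h.
  have [N hE] := sum_hpart w w0_gt0 h.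
  have hom n : hpart w0 w n (hpart w0 w n h) = hpart w0 w n h by apply: hpart_id.
  have part n : sym n (vev kap t z (hpart w0 w n h)) = 0 <-> IV (hpart w0 w n h).
    by apply: iff_trans (K_IV (hom n)); apply: symK; case: (evE _ _ (hom n)).
  have sumE : evG h = \sum_(n <- index_iota 0 N) sym n (vev kap t z (hpart w0 w n h)).
    rewrite {1}hE rmorph_sum big_mkord.
    by apply: eq_bigr => n _; have [_ ->] := evE _ _ (hom n).
  split=> [h0 | IVh].
    rewrite hE; apply: ideal_sum => // n _; apply/part.
    case: gr => _ _ _ _ /(_ (index_iota 0 N) (fun n => vev kap t z (hpart w0 w n h))).
    apply; rewrite ?iota_uniq -?sumE //; last by rewrite mem_index_iota /=.
    by move=> k _; case: (evE _ _ (hom k)).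
  by rewrite sumE big1 // => n _; apply/part/IV_hom.
have [psi [psi_inj psiE]] := quotient_lift (f := evG) qIV evG0.
exists psi; split; [| by rewrite psiE /= vevX | |].
- have surj g : exists b, psi b = g.
    have [_ _ _ /(_ g) [r [a [_ Sa ->]]] _] := gr.
    elim: r Sa => [|n r IHr] Sa; first by exists 0; rewrite rmorph0 big_nil.
    have [|b bE] := IHr; first by move=> k kr; apply: Sa; rewrite inE kr orbT.
    have San : S n (a n) by apply: Sa; rewrite mem_head.
    have [h [hom Kh]] := S_lift San; have [Sh sh] := evE _ _ hom.
    exists (q h + b); rewrite rmorphD bE big_cons psiE -sh; congr (_ + _).
    have SN : S n (- vev kap t z h).
      by rewrite -mulN1r -(rmorph1 kap) -rmorphN -[n]add0n; apply: SM.
    rewrite -[in RHS](subrK (vev kap t z h) (a n)) symD //; last exact: SD.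
    by have /symK -> := Kh; rewrite ?add0r //; apply: SD.
  have [c cE] := choice surj; exists c => // b.
  by apply: psi_inj; rewrite cE.
- by move=> c; rewrite psiE /= vevC.
- by move=> i; rewrite psiE /= vev_z.
Qed.

End GradedRing.

Lemma vev_id (R : realType) (l : nat) (kG : {rmorphism R[i] -> {mpoly {poly R[i]}[l]}}) h :
  (forall c, kG c = c%:P%:MP) -> vev kG 'X%:MP (fun i => 'X_i) h = h.
Proof.
move=> kGE; rewrite (congr1 (vev _ _ _) (poly_mpolyE h)) rmorph_sum [RHS]poly_mpolyE.
apply: eq_bigr => a _; rewrite rmorph_sum; apply: eq_bigr => i _ /=.
rewrite vev_term kGE mmap1_id -rmorphXn -rmorphM /=.
by rewrite mul_mpolyC mul_polyC.
Qed.

Section SymbolLift.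
Variables (R : realType) (l w0 : nat) (w : 'I_l -> nat).
Hypothesis w0_gt0 : (0 < w0)%N.
Local Notation C := (R[i]).
Local Notation P := {mpoly (fps C)[l]}.
Local Notation V := {mpoly {poly C}[l]}.
Variable kap : {rmorphism C -> P}.
Hypothesis kapE : forall c, kap c = (c%:A)%:MP.

Lemma symbol_vev n h : hpart w0 w n h = h ->
  weight_ge w0 w n (vev kap (fpsX C)%:MP (fun i => 'X_i) h) /\
  symbol w0 w n (vev kap (fpsX C)%:MP (fun i => 'X_i) h) = h.
Proof.
move=> hh; pose kG : {rmorphism C -> V} := @mpolyC l {poly C} \o polyC.
have [] := sym_vev (S := @weight_ge R l w0 w) (sym := symbol w0 w) (w := w) (kap := kap)
  (kG := kG) (t := (fpsX C)%:MP) (z := fun i => 'X_i) w0_gt0 _ _ _ _ _ _ _ _ _ _ hh.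
- exact: weight_ge_zero.
- exact: weight_geD.
- by move=> *; apply: weight_geM.
- by move=> *; apply: symbolD.
- by move=> *; apply: symbolM.
- exact: symbol1.
- by move=> c; apply: weight_ge_all.
- exact: weight_ge_t.
- exact: weight_ge_z.
- by move=> c; rewrite kapE symbolC.
move=> Sh ->; split; first exact: Sh.
rewrite (@symbol_t R l w0 w w0_gt0).
rewrite -[RHS](vev_id (kG := kG)); last by [].
apply: (congr1 (fun z => vev kG 'X%:MP z h)).
by apply/funext => i; apply: symbol_z.
Qed.

End SymbolLift.

Fact exprD_mul_eq (A : comNzRingType) (a f j t h : A) k e :
  a ^+ e * f = j + t * h -> a ^+ (k + e) * f = a ^+ k * j + t * (a ^+ k * h).
Proof. by move=> E; rewrite exprD -mulrA E mulrDr mulrCA. Qed.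

(** * The extended Rees algebra *)

Section ExtendedRees.
Variables (R : realType) (l w0 : nat) (w : 'I_l -> nat).
Hypothesis w0_gt0 : (0 < w0)%N.
Local Notation C := (R[i]).
Local Notation P := {mpoly (fps C)[l]}.
Local Notation B := (fps {poly C}).
Local Notation V := {mpoly {poly C}[l]}.
Local Notation s := (fpsX {poly C}).
Local Notation S := (@weight_ge R l w0 w).
Local Notation psi := (fps_dil (polyC : {rmorphism C -> {poly C}}) 'X w0).
Local Notation beta := (blow w psi).
Local Notation tP := ((fpsX C)%:MP : P).

Variables (I : set {mpoly B[l]}) (J : set P).
Hypotheses (idI : ideal I) (idJ : ideal J) (flI : flat_quotient I) (flJ : flat_quotient J).
Hypothesis I_gen : forall g, I g -> exists e, ideal_gen [set beta f | f in J] (s ^+ e *: g).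
Hypothesis blow_I : forall f, J f -> I (beta f).

Let sn_nzd n : nonzerodiv (s ^+ n). Proof. exact: fpsXn_nonzerodiv. Qed.

Lemma component_mem n e g : I g -> J (component w0 w n e g).
Proof.
move=> /I_gen[k gk]; rewrite -(component_shift w0 w n e k).
pose K := [set g' | forall c, J (component w0 w n (e + k) (c * g'))].
have [J0 JD JM] := idJ.
have idK : ideal K.
  split=> [c|g1 g2 K1 K2 c|a g1 K1 c].
  - by rewrite mulr0 component0.
  - by rewrite mulrDr componentD; apply: JD.
  - by rewrite mulrA; apply: K1.
have: K (s ^+ k *: g).
  apply: ideal_gen_sub gk => // _ [f Jf <-] c.
  by rewrite mulrC component_blowM // mulrC; apply: JM.
by move/(_ 1); rewrite mul1r.
Qed.

Lemma blow_mem n f g : beta f = s ^+ n *: g -> (I g <-> J f).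
Proof.
move=> fE; split=> [Ig | /blow_I].
  by rewrite -(component_blow w0_gt0 fE); apply: component_mem.
by rewrite fE; apply: flat_torsion_free.
Qed.

Lemma torsion_free_tP e f : J (tP ^+ e * f) -> J f.
Proof.
rewrite -rmorphXn /= mul_mpolyC; apply: flat_torsion_free => //.
exact: fpsXn_nonzerodiv.
Qed.

(** The function t has positive weight and, by flatness, is a nonzerodivisor modulo [J]; testing
    saturation on it shows that nothing is added to [J]. *)
Lemma strict_transformE n f : strict_transform w0 w J n f <-> S n f /\ J f.
Proof.
split=> -[Sf]; last by move=> Jf; split=> // a _; exists 0%N; rewrite expr0 mul1r.
move=> Jf; split=> //; have [|e] := Jf tP.
  by apply: weight_geW (weight_ge_t w0 w).
exact: torsion_free_tP.
Qed.

Lemma blow_t : beta tP = ('X%:A * s ^+ w0)%:MP.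
Proof. by rewrite blowC; congr (_%:MP); rewrite mulr_algl; apply: fps_dilX. Qed.

(** Writing [beta f = s^n g], the congruence becomes a linear relation modulo [I] with coefficients
    s^n and X. Flatness reduces it to relations in C[X][[s]], where s^n and X form a regular
    sequence; so [g] is X times some [k] modulo [I], and suitable components of both parts give [j']
    and [h']. *)
Lemma weight_ge_split n f j h : (w0 <= n)%N -> S n f -> J j -> f = j + tP * h ->
  exists j' h', [/\ J j', S (n - w0) h' & f = j' + tP * h'].
Proof.
move=> le_n /(weight_ge_blow w w0_gt0)[g fE] Jj fjh.
pose b (i : 'I_2) := if i == ord0 then g else - (s ^+ w0 *: beta h).
pose a (i : 'I_2) : B := if i == ord0 then s ^+ n else 'X%:A.
have Irel : I (\sum_i a i *: b i).
  rewrite big_ord_recl big_ord1 /a /b /= -fE fjh raddfD /= [beta (tP * h)]blowM.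
  rewrite blow_t mul_mpolyC scalerN scalerA addrK.
  exact: blow_I.
have [p [c [b' [Ib cE]]]] := flI Irel.
(* From s^n c_0 + X c_1 = 0 the entry c_0 is X times the quotient of -c_1 by s^n, and [d] is that
   quotient. *)
pose d j0 := fps_shift n (- c (lift ord0 ord0) j0).
have c0E j0 : c ord0 j0 = 'X%:A * d j0.
  have := cE j0; rewrite big_ord_recl big_ord1 /a /= => /eqP.
  rewrite addr_eq0 => /eqP /(congr1 (fps_shift n)); rewrite fps_shiftK => ->.
  by rewrite /d -mulrN !mulr_algl; apply: fpsP.
pose k := \sum_j0 d j0 *: b' j0.
have Igk : I (g - 'X%:A *: k).
  have := Ib ord0; rewrite /b /= scaler_sumr; congr (I (_ - _)).
  by apply: eq_bigr => j0 _; rewrite c0E scalerA.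
exists (component w0 w n 0 (g - 'X%:A *: k)), (component w0 w n w0 k); split.
- exact: component_mem.
- exact: component_weight_ge.
- rewrite -component_X -componentD subrK; apply/esym.
  exact: component_blow.
Qed.

Lemma strict_transform_central p : proj_point S p ->
    in_Vplus (strict_transform w0 w J) p ->
  (~ in_Vplus (strict_transform w0 w (central_fiber J)) p <-> ~ p w0 tP).
Proof.
move=> [pS pD pM pprime [i0 [a0 [i0_gt0 Sa0 pa0]]]] pJ.
suff tE : in_Vplus (strict_transform w0 w (central_fiber J)) p <-> p w0 tP.
  by split=> np /tE.
split=> [pc | pt].
  apply: pc; split; first exact: weight_ge_t.
  move=> a _; exists 0%N; rewrite expr0 mul1r; apply: mem_ideal_gen; by right.
have pt_mul n h : (w0 <= n)%N -> S (n - w0) h -> p n (tP * h).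
  by move=> le_n Sh; rewrite mulrC -(subnK le_n); apply: pM.
(* The element [a0] of positive degree [i0] lies outside [p], so primality cancels its powers. *)
have p_prime n e f : S n f -> p (e * i0 + n)%N (a0 ^+ e * f) -> p n f.
  move=> Sf; elim: e => [|e IHe]; first by rewrite expr0 mul1r.
  rewrite exprS mulSn -mulrA -addnA => /pprime[|||/IHe] //.
  by apply: weight_geM => //; apply: weight_geXn.
have cfE f : central_fiber J f -> exists j h, J j /\ f = j + tP * h.
  have [J0 JD JM] := idJ.
  apply: (ideal_gen_sub (I := [set f | exists j h, J j /\ f = j + tP * h])).
    split.
    - by exists 0, 0; rewrite mulr0 addr0.
    - move=> f1 f2 [j1 [h1 [Jj1 ->]]] [j2 [h2 [Jj2 ->]]].
      by exists (j1 + j2), (h1 + h2); split; [apply: JD | rewrite mulrDr addrACA].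
    - move=> c f1 [j1 [h1 [Jj1 ->]]]; exists (c * j1), (c * h1).
      by split; [apply: JM | rewrite mulrDr mulrCA].
  move=> f1 [Jf1 | ->]; first by exists f1, 0; rewrite mulr0 addr0.
  by exists 0, 1; rewrite add0r mulr1.
move=> n f [Sf cf]; have [|e /cfE[j [h [Jj fE]]]] := cf a0.
  exact: weight_geW Sa0.
(* The exponent [e] brings [f] into the ideal of the central fiber; the [w0] further factors raise
   the degree to at least [w0], as division by t requires. *)
apply: (p_prime _ (w0 + e)%N) => //.
have le_w0 : (w0 <= (w0 + e) * i0 + n)%N.
  by rewrite (leq_trans _ (leq_addr _ _)) // mulnDl (leq_trans (leq_pmulr _ i0_gt0)) ?leq_addr.
have Saf : S ((w0 + e) * i0 + n) (a0 ^+ (w0 + e) * f).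
  by apply: weight_geM => //; apply: weight_geXn.
have afE : a0 ^+ (w0 + e) * f = a0 ^+ w0 * j + tP * (a0 ^+ w0 * h).
  exact: exprD_mul_eq.
have [|j' [h' [Jj' Sh' E]]] := weight_ge_split le_w0 Saf _ afE.
  by case: idJ => _ _; apply.
rewrite E; apply: (pD _).2; last exact: pt_mul.
apply: pJ; apply/strict_transformE; split=> //.
rewrite -[j'](addrK (tP * h')) -E; apply: weight_geD => //; apply: (weight_geN w0_gt0).
by rewrite -(subnK le_w0) addnC; apply: weight_geM => //; apply: weight_ge_t.
Qed.

(* The special fiber s = 0. *)
Let IV := [set map_mpoly (@fps_coef0 {poly C}) g | g in I].

Lemma symbol_mem n f : S n f -> J f -> IV (symbol w0 w n f).
Proof.
move=> /(weight_ge_blow w w0_gt0)[g fE] Jf; exists g; first exact/(blow_mem fE).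
by apply: symbol_blow fE.
Qed.

(** The degree [n] component of a lift of [h] to [I] lies in [J]. Thus the graded pieces of the
    special fiber consist of symbols of elements of [J]. *)
Lemma IV_hpart n h : IV h ->
  exists f, [/\ S n f, J f & symbol w0 w n f = hpart w0 w n h].
Proof.
move=> [g Ig <-]; exists (component w0 w n 0 g); split.
- by rewrite -[X in S X](subn0 n); apply: component_weight_ge.
- exact: component_mem.
- exact: symbol_component.
Qed.

Lemma IV_homogeneous n h : IV h -> IV (hpart w0 w n h).
Proof. by move=> /(IV_hpart n)[f [Sf Jf <-]]; apply: symbol_mem. Qed.

(** Subtracting an element of [J] with the same symbol leaves a function of excess weight. *)
Lemma exceptionalE n f :
  exceptional_divisor w0 w J n f <-> S n f /\ IV (symbol w0 w n f).
Proof.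
split=> [[a [b [Sa /strict_transformE[Sb Jb] ->]]] | [Sf IVf]].
  have Sa' : S n a by apply: weight_geW Sa.
  split; first exact: weight_geD.
  rewrite symbolD //; have -> : symbol w0 w n a = 0 by apply/(symbol_eq0 w0_gt0 Sa').
  by rewrite add0r; apply: symbol_mem.
have [f' [Sf' Jf' f'E]] := IV_hpart n IVf.
exists (f - f'), f'; rewrite subrK; split=> //; last exact/strict_transformE.
have Sff' : S n (f - f') by apply: weight_geD => //; apply: (weight_geN w0_gt0).
by apply/(symbol_eq0 w0_gt0 Sff'); rewrite symbolD // symbolN // f'E hpart_symbol // subrr.
Qed.

Hypothesis IV_X : forall e h, IV ('X%:MP ^+ e * h) -> IV h.
Hypothesis idIV : ideal IV.

(** Saturation is tested on t alone: its symbol is X, which [IV_X] allows to cancel. *)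
Lemma cone_idealE n f :
  cone_ideal S (exceptional_divisor w0 w J) n f <-> S n f /\ IV (symbol w0 w n f).
Proof.
split=> -[Sf]; last first.
  move=> IVf; split=> // j a _ Sa; exists 0%N; rewrite mul0n addn0 expr0 mul1r.
  exact/exceptionalE.
move=> /(_ w0 tP w0_gt0 (weight_ge_t _ _))[e /exceptionalE[_]].
rewrite addnC symbolM //; last by apply: weight_geXn => //; apply: weight_ge_t.
suff -> : symbol w0 w (e * w0) (tP ^+ e) = 'X%:MP ^+ e by move=> /IV_X.
elim: e => [|e IHe]; first by rewrite !expr0 symbol1.
rewrite mulSn !exprS symbolM ?IHe ?symbol_t //; first exact: weight_ge_t.
by apply: weight_geXn => //; apply: weight_ge_t.
Qed.

Variables (OW : comNzRingType) (q : {rmorphism V -> OW}).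
Hypothesis qIV : is_quotient IV q.

Lemma cone_iso (G : comNzRingType) (sym : nat -> P -> G) :
    graded_quotient S (cone_ideal S (exceptional_divisor w0 w J)) sym ->
  exists psi : {rmorphism OW -> G},
    [/\ bijective psi,
        psi (q ('X)%:MP) = sym w0 tP,
        forall c : C, psi (q (c%:P)%:MP) = sym 0%N (c%:A)%:MP
      & forall i, psi (q 'X_i) = sym (w i) 'X_i].
Proof.
move=> gr; pose kap : {rmorphism C -> P} := @mpolyC l (fps C) \o in_alg (fps C).
have lift n h (hh : hpart w0 w n h = h) := symbol_vev w0_gt0 (kap := kap) (fun c => erefl _) hh.
have [] := graded_iso (w := w) (kap := kap) (t := tP) (z := fun i => 'X_i)
  w0_gt0 gr _ _ _ _ _ _ idIV qIV.
- exact: weight_ge_zero.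
- exact: weight_geD.
- by move=> *; apply: weight_geM.
- by move=> c; apply: weight_ge_all.
- exact: weight_ge_t.
- exact: weight_ge_z.
- exact: IV_homogeneous.
- move=> n a Sa; have ha := hpart_symbol w w0_gt0 n a; exists (symbol w0 w n a).
  have [Sl sl] := lift _ _ ha; split=> //.
  have Sal : S n (a - vev kap tP (fun i => 'X_i) (symbol w0 w n a)).
    by apply: weight_geD => //; apply: weight_geN.
  apply/cone_idealE; split=> //.
  by rewrite symbolD // symbolN // sl subrr; case: idIV.
- move=> n h hh; have [Sl sl] := lift _ _ hh.
  by split=> [/cone_idealE[_] | IVh]; [|apply/cone_idealE]; rewrite sl.
by move=> psi [bij psiX psiC psiz]; exists psi.
Qed.

End ExtendedRees.

(** * Cones and arcs in the toric base *)

Section Cones.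
Variables (R : realType) (r : nat).
Implicit Types (tau : set 'rV[R]_r) (a v : 'rV[int]_r) (x y : 'rV[R]_r).

Lemma dotp_realv a v : dotp (realv R a) (realv R v) = (dotp a v)%:~R.
Proof.
by rewrite /dotp rmorph_sum; apply: eq_bigr => i _; rewrite !mxE rmorphM.
Qed.

Lemma dotp_addZ y x (e : R) z : dotp y (x + e *: z) = dotp y x + e * dotp y z.
Proof.
rewrite /dotp mulr_sumr -big_split; apply: eq_bigr => i _.
by rewrite !mxE mulrDr mulrCA.
Qed.

Lemma dotpDl (a b v : 'rV[int]_r) : dotp (a + b) v = dotp a v + dotp b v.
Proof. by rewrite /dotp -big_split; apply: eq_bigr => i _; rewrite !mxE mulrDl. Qed.

Lemma dotp_self a : a != 0 -> 0 < dotp (realv R a) (realv R a).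
Proof.
move=> a0; have sq_ge0 i : 0 <= realv R a 0 i * realv R a 0 i by rewrite -expr2 sqr_ge0.
rewrite lt_neqAle sumr_ge0 ?andbT //; apply: contraNneq a0 => /esym/eqP.
rewrite psumr_eq0 // => /allP a0; apply/eqP/rowP => i; apply/eqP.
have := a0 i (mem_index_enum i); rewrite /= mulf_eq0 orbb !mxE.
by rewrite intr_eq0.
Qed.

Lemma interior_sub tau : cone_interior tau `<=` tau.
Proof. by move=> x /(_ 0)[e _]; rewrite scaler0 addr0. Qed.

Lemma dual_ge0 tau a v : dual_monoid tau a -> cone_interior tau (realv R v) ->
  0 <= dotp a v.
Proof.
by move=> ta /interior_sub/ta; rewrite dotp_realv ler0z.
Qed.

(** An interior point can be moved slightly in the direction [- a], which strictly lowers the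
    pairing with [a] and yet keeps it nonnegative. *)
Lemma dual_gt0 tau a v : dual_monoid tau a -> cone_interior tau (realv R v) ->
  a != 0 -> 0 < dotp a v.
Proof.
move=> ta iv a0; have [e e0 /ta] := iv (- realv R a).
rewrite scalerN -scaleNr dotp_addZ mulNr subr_ge0 => le.
by rewrite -(ltr0z R) -dotp_realv (lt_le_trans _ le) // mulr_gt0 // dotp_self.
Qed.

Lemma regular_cone_addZ tau x y (e : R) : regular_cone tau -> 0 <= e ->
  tau x -> tau y -> tau (x + e *: y).
Proof.
move=> [E _ ->] e0 [c [c0 ->]] [d [d0 ->]]; exists (fun i => c i + e * d i).
split=> [i|]; first by rewrite addr_ge0 // mulr_ge0.
by rewrite scaler_sumr -big_split; apply: eq_bigr => i _; rewrite scalerA scalerDl.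
Qed.

(** If the pairing were negative at some [x] in the cone, it would vanish at [x + e v] for a
    positive [e], and that point is interior because [v] is. *)
Lemma pos_interior_dual tau a v : regular_cone tau -> cone_interior tau (realv R v) ->
  (forall x, cone_interior tau x -> 0 < dotp (realv R a) x) -> dual_monoid tau a.
Proof.
move=> reg iv pos x tx; rewrite leNgt; apply/negP => neg.
pose e := - dotp (realv R a) x / dotp (realv R a) (realv R v).
have e0 : 0 < e by rewrite divr_gt0 ?oppr_gt0 // pos.
suff /pos : cone_interior tau (x + e *: realv R v).
  by rewrite dotp_addZ /e divfK ?subrr ?ltxx // gt_eqF ?pos.
clearbody e => y; have [e' e'0 te'] := iv y; exists (e * e'); first exact: mulr_gt0.
by rewrite -scalerA -addrA -scalerDr; apply: regular_cone_addZ => //; apply: ltW.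
Qed.

End Cones.

Section ToricArc.
Variables (R : realType) (l r : nat).
Local Notation C := (R[i]).
Local Notation P := {mpoly (fps C)[l]}.
Local Notation B := (fps {poly C}).
Local Notation s := (fpsX {poly C}).
Variables (tau : set 'rV[R]_r) (m : 'rV[int]_r) (u : 'I_l -> 'rV[int]_r).
Variables (ST : comAlgType C) (tt : {lrmorphism fps C -> ST}).
Variables (chi : 'rV[int]_r -> ST) (XX : ST) (H : param_scheme R u) (F : H ST) (JT : set P).
Hypothesis hST : toric_ring tau m tt chi XX.
Hypothesis torus_ideal : forall (A : comAlgType C) (y : {lrmorphism ST -> A}),
  (forall a, dual_monoid tau a -> exists b, y (chi a) * b = 1) ->
  par_ideal (par_pull y F) =
  ideal_gen [set rescale (fun i => y (chi (u i))) (map_mpoly (y \o tt) f) | f in JT].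

Hypothesis u_dual : forall i, dual_monoid tau (u i).

(** The family over C[[t]] is itself a pullback of [F], along the unit section of the torus: all
    characters go to 1 and X to t. *)
Lemma flat_family : ideal JT -> flat_quotient JT.
Proof.
move=> idJT; have [_ univ] := hST.
have [] := univ (fps C) idfun (fun=> 1) (fpsX C).
  by split=> [|a b _ _|]; rewrite ?mulr1.
move=> y [ytt ychi _] _.
have yE : par_ideal (par_pull y F) = JT.
  rewrite torus_ideal; last by move=> a ta; exists 1; rewrite ychi // mulr1.
  have rescE (f : P) : rescale (fun i => y (chi (u i))) (map_mpoly (y \o tt) f) = f.
    apply/mpolyP => a; rewrite mcoeff_rescale mcoeff_map /mmap1 big1 ?mulr1 => [|i _].
      exact: ytt.
    by rewrite ychi // expr1n.
  apply/seteqP; split=> [|f Jf].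
    by apply: ideal_gen_sub => // _ [f Jf <-]; rewrite rescE.
  by apply: mem_ideal_gen; exists f; rewrite ?rescE.
by rewrite -yE; apply: par_flat.
Qed.

Variables (v : 'rV[int]_r) (w0 : nat) (w : 'I_l -> nat).
Hypotheses (hv : cone_interior tau (realv R v)) (hw0 : (0 < w0)%N)
  (hw0E : w0%:Z = dotp m v) (hw : forall i, (w i)%:Z = dotp (u i) v).
Hypothesis m_dual : dual_monoid tau m.
Local Notation psi := (fps_dil (polyC : {rmorphism C -> {poly C}}) 'X w0).

(* Over C[X][[s]], with t = X s^w0, the base is the germ along V(tau') of the
   surface spanned by the arcs of direction v. *)
Lemma toric_arc : exists f : {rmorphism ST -> B},
  [/\ forall c, f (tt c) = psi c,
      forall a, dual_monoid tau a -> f (chi a) = s ^+ `|dotp a v|%N,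
      f XX = 'X%:A & flat_quotient (base_change_ideal f (par_ideal F))].
Proof.
(* [B] is an algebra over C[X]; its scalars are restricted to C before the universal property of
   [ST] is applied. *)
pose kap : {rmorphism C -> B} := in_alg B \o polyC.
have psik c : psi (c%:A : fps C) = kap c.
  by rewrite fps_dilZ (rmorph1 psi).
have [psi' psiE] := via_lrmorphism (S := fps C) (h := psi) psik.
have [_ univ] := hST.
have [] := univ (alg_via kap) psi' (fun a => s ^+ `|dotp a v|%N) ('X%:A : B).
  split.
  - by rewrite /dotp big1 ?expr0 // => i _; rewrite mxE mul0r.
  - move=> a b ta tb; rewrite -[RHS]exprD; congr (_ ^+ _).
    rewrite dotpDl.
    have := dual_ge0 ta hv; have := dual_ge0 tb hv.
    by case: (dotp a v) => // p; case: (dotp b v).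
  - rewrite psiE -hw0E; apply: etrans (fps_dilX _ _ hw0) _.
    exact: esym (mulr_algl _ _).
move=> f [ftt fchi fX] _; exists f; split=> //.
  by move=> c; apply: etrans (ftt c) (psiE c).
have : flat_quotient (par_ideal (par_pull f F)) by apply: par_flat.
by rewrite par_pullE.
Qed.

End ToricArc.

Lemma vev_morph (R : realType) (l : nat) (A A' : comNzRingType)
    (kap : {rmorphism R[i] -> A}) (kap' : {rmorphism R[i] -> A'}) (t : A) (z : 'I_l -> A)
    (g : {rmorphism A -> A'}) (h : {mpoly {poly R[i]}[l]}) :
  (forall c, g (kap c) = kap' c) ->
  g (vev kap t z h) = vev kap' (g t) (fun i => g (z i)) h.
Proof.
move=> gk; rewrite (congr1 (vev kap t z) (poly_mpolyE h)).
rewrite (congr1 (vev kap' (g t) (fun i => g (z i))) (poly_mpolyE h)).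
rewrite [vev kap t z _]rmorph_sum [LHS]rmorph_sum [RHS]rmorph_sum /=.
apply: eq_bigr => a _.
rewrite [vev kap t z _]rmorph_sum [LHS]rmorph_sum [RHS]rmorph_sum /=.
apply: eq_bigr => i _.
rewrite !vev_term !rmorphM rmorphXn gk; congr (_ * _).
by rewrite /mmap1 rmorph_prod; apply: eq_bigr => j _; rewrite rmorphXn.
Qed.

(** * The weight filtration on the local ring of the family *)

Section LocalRing.
Variables (R : realType) (l w0 : nat) (w : 'I_l -> nat).
Hypotheses (w0_gt0 : (0 < w0)%N) (w_gt0 : forall i, (0 < w i)%N).
Local Notation C := (R[i]).
Local Notation P := {mpoly (fps C)[l]}.
Local Notation V := {mpoly {poly C}[l]}.
Local Notation S := (@weight_ge R l w0 w).
Local Notation tP := ((fpsX C)%:MP : P).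
Variables (OD : comAlgType C) (pt0 : {lrmorphism OD -> C^o}) (t : OD)
  (taylor : {lrmorphism OD -> fps C}).
Hypotheses (taylor_t : taylor t = fpsX C)
  (taylor0 : forall a, fcoef (taylor a) 0%N = pt0 a).
Local Notation Q := {mpoly OD[l]}.
Local Notation T := (map_mpoly taylor).
Variables (J : set Q) (FJ : fieldType) (rho : {rmorphism Q -> FJ}).
Hypotheses (idJ : ideal J) (rhoP : forall a, rho a = 0 <-> J a)
  (J_origin : forall f, J f -> f@_0%MM = 0).
Let JT := base_change_ideal taylor J.

Let TD (f g : Q) : T (f + g) = T f + T g. Proof. exact: rmorphD. Qed.
Let TB (f g : Q) : T (f - g) = T f - T g. Proof. exact: rmorphB. Qed.
Let TM (f g : Q) : T (f * g) = T f * T g. Proof. exact: rmorphM. Qed.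

(** Coefficients truncated at order [n] are polynomials in the uniformizer, hence come from [OD];
    the discarded terms have weight at least [w0 * n >= n]. *)
Lemma truncation n (c : P) : exists c' : Q, S n (T c' - c).
Proof.
pose trunc (b : fps C) : OD := \sum_(i < n) fcoef b i *: t ^+ i.
have trunc0 : trunc 0 = 0 by rewrite /trunc big1 // => i _; rewrite scale0r.
exists (mfam (fun _ => trunc) c); apply/weight_geP => a i lt_n.
rewrite mcoeffB mcoeff_map mcoeff_mfam // fcoefD fcoefN.
have lt_in : (i < n)%N.
  by apply: leq_ltn_trans lt_n; rewrite (leq_trans (leq_pmull i w0_gt0)) ?leq_addr.
have tE c0 k : taylor (c0 *: t ^+ k) = c0 *: fpsX C ^+ k.
  by rewrite linearZ /= rmorphXn /= taylor_t.
rewrite /trunc rmorph_sum fcoef_sum (bigD1 (Ordinal lt_in)) //= tE.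
rewrite fcoefZ fcoefXn eqxx mulr1 big1 ?addr0 ?subrr // => k.
by rewrite -val_eqE /= tE fcoefZ fcoefXn eq_sym => /negPf ->; rewrite mulr0.
Qed.

(** An element of [JT] combines elements of [J] with power series multipliers, and truncating the
    multipliers gives an element of [J]. *)
Lemma approximation n f : JT f -> exists2 f', J f' & S n (T f' - f).
Proof.
have [J0 JD JM] := idJ.
apply: (ideal_gen_sub (I := [set f | exists2 f', J f' & S n (T f' - f)])).
  split.
  - by exists 0; rewrite // rmorph0 subr0; apply: weight_ge_zero.
  - move=> x y [x' Jx Sx] [y' Jy Sy]; exists (x' + y'); first exact: JD.
    by rewrite TD opprD addrACA; apply: weight_geD.
  - move=> c x [x' Jx Sx]; have [c' Sc] := truncation n c.
    exists (c' * x'); first exact: JM.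
    have -> : T (c' * x') - c * x = T c' * (T x' - x) + x * (T c' - c).
      rewrite TM mulrBr mulrBr addrA [x * T c']mulrC [x * c]mulrC.
      by rewrite subrK.
    by apply: weight_geD; apply: weight_geMl.
move=> _ [g Jg <-]; exists g => //; rewrite subrr; exact: weight_ge_zero.
Qed.

Let unit_germ g : pt0 g@_0%MM != 0 -> rho g != 0.
Proof.
by apply: contraNneq => /rhoP/J_origin ->; rewrite rmorph0.
Qed.

Let pt0_origin (f g : Q) : pt0 (f * g)@_0%MM = pt0 f@_0%MM * pt0 g@_0%MM.
Proof. by rewrite rmorphM rmorphM. Qed.

(** All weights are positive, so only the value at x has weight 0. *)
Lemma symbol_germ g : symbol w0 w 0 (T g) = (pt0 g@_0%MM)%:P%:MP.
Proof.
apply: vpolyP => a i; rewrite coef_symbol // mcoeff_map mcoeffC.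
have [->|a0] := eqVneq a 0%MM.
  rewrite wdeg0 addn0 muln_eq0 gtn_eqF // orFb mulr1 coefC.
  by case: eqP => // ->; rewrite taylor0.
rewrite mulr0 coef0; case: eqP => // /eqP; rewrite addn_eq0 => /andP[_].
rewrite /wdeg sum_nat_eq0 => /forallP wa0; case/eqP: a0; apply/mnmP => j.
by have := wa0 j; rewrite muln_eq0 gtn_eqF //= mnm0E => /eqP.
Qed.

Let filt := local_filtration w0 w pt0 taylor rho.
Let kapQ : {rmorphism C -> Q} := @mpolyC l OD \o in_alg OD.
Let kapP : {rmorphism C -> P} := @mpolyC l (fps C) \o in_alg (fps C).
Let kapF : {rmorphism C -> FJ} := rho \o kapQ.

Let pt0_1 : pt0 (1 : Q)@_0%MM != 0.
Proof. by rewrite mcoeff1 eqxx rmorph1 oner_eq0. Qed.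

Lemma filt_poly n f : S n (T f) -> filt n (rho f).
Proof. by move=> Sf; exists f, 1; split=> //; rewrite rmorph1 divr1. Qed.

Lemma filt_add n x y : filt n x -> filt n y -> filt n (x + y).
Proof.
move=> [f [g [Sf g0 ->]]] [f' [g' [Sf' g'0 ->]]].
exists (f * g' + f' * g), (g * g'); split.
- rewrite TD !TM; exact: (weight_geD (weight_geMr w0_gt0 Sf) (weight_geMr w0_gt0 Sf')).
- by rewrite pt0_origin mulf_neq0.
- by rewrite addf_div ?unit_germ // rmorphD !rmorphM.
Qed.

Lemma filt_mul i j x y : filt i x -> filt j y -> filt (i + j) (x * y).
Proof.
move=> [f [g [Sf g0 ->]]] [f' [g' [Sf' g'0 ->]]].
exists (f * f'), (g * g'); split.
- by rewrite TM; exact: (weight_geM w0_gt0 Sf Sf').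
- by rewrite pt0_origin mulf_neq0.
- by rewrite mulf_div !rmorphM.
Qed.

Variable IV : set V.
Hypotheses (idIV : ideal IV)
  (symbol_IV : forall n f, S n f -> JT f -> IV (symbol w0 w n f))
  (IV_symbol : forall n h, IV h ->
     exists f, [/\ S n f, JT f & symbol w0 w n f = hpart w0 w n h]).

Let evQ := vev kapQ t%:MP (fun i => 'X_i).

Let evQE n h : hpart w0 w n h = h -> S n (T (evQ h)) /\ symbol w0 w n (T (evQ h)) = h.
Proof.
have kE c : T (kapQ c) = kapP c.
  rewrite [LHS]map_mpolyC; congr (_%:MP); exact: rmorph_alg.
have Tt : T t%:MP = tP by rewrite map_mpolyC; congr (_%:MP); exact: taylor_t.
have Tz : (fun i : 'I_l => T 'X_i) = (fun i => 'X_i).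
  by apply/funext => i; rewrite map_mpolyX.
have TE : T (evQ h) = vev kapP (T t%:MP) (fun i => T 'X_i) h.
  exact: (vev_morph (g := T) _ _ _ kE).
rewrite Tt Tz in TE; rewrite TE.
exact: (symbol_vev w0_gt0 (kap := kapP)).
Qed.

Let evFE h : vev kapF (rho t%:MP) (fun i => rho 'X_i) h = rho (evQ h).
Proof. exact: esym (vev_morph (kap' := kapF) (g := rho) _ _ _ (fun c => erefl _)). Qed.

(** If [rho (evQ h) = f / g] with [f] of excess weight, then [g * evQ h - f] lies in [J] and has
    symbol [h] times the nonzero value of [g] at x. Conversely, an element of [JT] with symbol [h]
    is approximated from [J] and subtracted. *)
Lemma filt_IV n h : hpart w0 w n h = h -> (filt n.+1 (rho (evQ h)) <-> IV h).
Proof.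
have [IV0 IVD IVM] := idIV; move=> hh; have [Sh sh] := evQE hh; split.
  move=> [f [g [Sf g0 E]]].
  have /rhoP Jgf : rho (g * evQ h - f) = 0.
    by rewrite rmorphB rmorphM E mulrCA mulfV ?unit_germ // mulr1 subrr.
  have Sf' : S n (T f) by apply: weight_geW Sf.
  have Sgf : S n (T (g * evQ h - f)).
    rewrite TB TM; apply: weight_geD; first exact: weight_geMl.
    exact: weight_geN.
  have := symbol_IV Sgf (mem_base_change taylor Jgf).
  have -> : symbol w0 w n (T (g * evQ h - f)) = (pt0 g@_0%MM)%:P%:MP * h.
    have Sg : S 0 (T g) by exact: weight_ge_all.
    have sM := etrans (symbolM w0_gt0 Sg Sh) (congr2 *%R (symbol_germ g) sh).
    rewrite add0n in sM; rewrite TB TM (symbolD _ w0_gt0) (symbolN _ w0_gt0) sM.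
    by have /(symbol_eq0 w0_gt0 Sf') -> := Sf; rewrite subr0.
  move=> /(IVM ((pt0 g@_0%MM)^-1)%:P%:MP).
  by rewrite mulrA -!rmorphM mulVf // !rmorph1 mul1r.
move=> /(IV_symbol n)[f [Sf /(approximation n.+1)[f' Jf' Sff'] fE]].
have -> : rho (evQ h) = rho (evQ h - f').
  by rewrite rmorphB (rhoP f').2 ?subr0.
apply: filt_poly.
have Sd : S n (T (evQ h) - f) by apply: weight_geD => //; apply: weight_geN.
have -> : T (evQ h - f') = (T (evQ h) - f) - (T f' - f).
  by rewrite TB opprB addrA subrK.
apply: weight_geD (weight_geN w0_gt0 Sff').
apply/(symbol_eq0 w0_gt0 Sd).
by rewrite (symbolD _ w0_gt0) (symbolN _ w0_gt0) sh fE hh subrr.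
Qed.

Lemma filt_lift n x : filt n x ->
  exists h, hpart w0 w n h = h /\ filt n.+1 (x - rho (evQ h)).
Proof.
move=> [f [g [Sf g0 ->]]]; pose c := (pt0 g@_0%MM)^-1.
(* The denominator contributes to the symbol only through its value at x, of which [c] is the
   inverse. *)
pose h := c%:P%:MP * symbol w0 w n (T f).
have hh : hpart w0 w n h = h.
  apply: vpolyP => a i; rewrite coef_hpart // mcoeffCM coefCM coef_symbol //.
  by case: eqP => //; rewrite mulr0.
have [Sh sh] := evQE hh; exists h; split; first exact: hh.
exists (f - g * evQ h), g; split; [|exact: g0|]; last first.
  by rewrite rmorphB rmorphM mulrBl [rho g * _]mulrC mulfK ?unit_germ.
have Sgh : S n (T g * T (evQ h)) := weight_geMl w0_gt0 Sh.
have Sd : S n (T f - T g * T (evQ h)) by exact: (weight_geD Sf (weight_geN w0_gt0 Sgh)).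
rewrite TB TM; apply/(symbol_eq0 w0_gt0 Sd).
have Sg : S 0 (T g) by exact: weight_ge_all.
have sM := etrans (symbolM w0_gt0 Sg Sh) (congr2 *%R (symbol_germ g) sh).
rewrite add0n in sM; rewrite (symbolD _ w0_gt0) (symbolN _ w0_gt0) sM.
by rewrite /h mulrA -!rmorphM mulfV // !rmorph1 mul1r subrr.
Qed.

Variables (OW : comNzRingType) (q : {rmorphism V -> OW}).
Hypothesis qIV : is_quotient IV q.

Lemma local_iso (G : comNzRingType) (sym : nat -> FJ -> G) :
    graded_quotient filt (fun n => filt n.+1) sym ->
  exists psi : {rmorphism OW -> G},
    [/\ bijective psi,
        psi (q ('X)%:MP) = sym w0 (rho t%:MP),
        forall c : C, psi (q (c%:P)%:MP) = sym 0%N (rho (c%:A)%:MP)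
      & forall i, psi (q 'X_i) = sym (w i) (rho 'X_i)].
Proof.
move=> gr.
have [] := graded_iso (w := w) (kap := kapF) (t := rho t%:MP) (z := fun i => rho 'X_i)
  w0_gt0 gr _ _ _ _ _ _ idIV qIV.
- by move=> n; rewrite -(rmorph0 rho); apply: filt_poly; rewrite rmorph0; apply: weight_ge_zero.
- exact: filt_add.
- exact: filt_mul.
- by move=> c; apply: filt_poly; apply: weight_ge_all.
- apply: filt_poly; have -> : T t%:MP = tP by rewrite map_mpolyC; congr (_%:MP); exact: taylor_t.
  exact: weight_ge_t.
- by move=> i; apply: filt_poly; rewrite map_mpolyX; apply: weight_ge_z.
- move=> n h /(IV_symbol n)[f [Sf Jf <-]]; exact: symbol_IV.
- by move=> n a /filt_lift[h [hh Fh]]; exists h; split=> //; rewrite evFE.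
- by move=> n h hh; rewrite evFE; apply: filt_IV.
by move=> psi [bij psiX psiC psiz]; exists psi.
Qed.

End LocalRing.

(** * The family over the arc *)

Section ArcChart.
Variables (R : realType) (l w0 : nat) (w : 'I_l -> nat).
Hypothesis w0_gt0 : (0 < w0)%N.
Local Notation C := (R[i]).
Local Notation P := {mpoly (fps C)[l]}.
Local Notation s := (fpsX C).
Local Notation S := (@weight_ge R l w0 w).
Local Notation tP := ((fpsX C)%:MP : P).
Variable pw : {rmorphism fps C -> fps C}.
Hypothesis pwE : forall f j,
  fcoef (pw f) j = if (w0 %| j)%N then fcoef f (j %/ w0) else 0.
Local Notation beta := (blow w pw).

Definition arc_slice e (b : fps C) : fps C := FPS (fun i => fcoef b (w0 * i + e)%N).

Lemma fcoef_arc_slice e b i : fcoef (arc_slice e b) i = fcoef b (w0 * i + e)%N.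
Proof. by []. Qed.

(** Each slice collects the exponents in one residue class modulo [w0]. Together with
    [arc_slice_uniq], C[[s]] is free over C[[t]] with basis 1, s, ..., s^(w0 - 1). *)
Lemma arc_sliceP b : b = \sum_(r < w0) s ^+ r * pw (arc_slice r b).
Proof.
apply: fpsP => j; rewrite fcoef_sum.
under eq_bigr => r _ do rewrite fcoefXnM pwE.
have lt_r := ltn_pmod j w0_gt0; rewrite (bigD1 (Ordinal lt_r)) //=.
rewrite ltnNge leq_mod /= {2}(divn_eq j w0) addnK dvdn_mull //.
rewrite {2}(divn_eq j w0) addnK mulnK // mulnC -divn_eq big1 ?addr0 // => r.
rewrite -val_eqE /= => rN; case: ltnP => // le_rj; case: ifP => // dv.
case/eqP: rN; rewrite -[LHS](modn_small (ltn_ord r)).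
by apply/eqP; rewrite eq_sym eqn_mod_dvd.
Qed.

Lemma arc_slice_uniq (x : 'I_w0 -> fps C) (r : 'I_w0) :
  arc_slice r (\sum_(k < w0) s ^+ k * pw (x k)) = x r.
Proof.
apply: fpsP => i; rewrite fcoef_arc_slice fcoef_sum (bigD1 r) //.
rewrite big1 => [|k kN].
  apply: etrans (addr0 _) _.
  by rewrite fcoefXnM pwE ltnNge leq_addl addnK /= dvdn_mulr // mulKn.
rewrite fcoefXnM pwE; case: ltnP => // le_k; case: ifP => // dv.
case/eqP: kN; apply/val_inj; rewrite /= -[LHS](modn_small (ltn_ord k)).
rewrite -[RHS](modn_small (ltn_ord r)) -[in RHS](modnMDl i) [(i * _)%N]mulnC.
by apply/eqP; rewrite eq_sym eqn_mod_dvd.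
Qed.

(** A monomial z^a is reached by [beta] only after multiplication by s^(wdeg a), whence the power of
    [s]. Allowing every larger [N] lets several decompositions share one exponent. *)
Lemma arc_decomp (c : P) : exists N0, forall N, (N0 <= N)%N ->
  exists y : 'I_w0 -> P, s ^+ N *: c = \sum_(r < w0) s ^+ r *: beta (y r).
Proof.
exists (\max_(a <- msupp c) wdeg w a) => N le_N.
exists (fun r => mfam (fun a b => arc_slice r (fps_shift (wdeg w a) (s ^+ N * b))) c).
apply/mpolyP => a; rewrite mcoeffZ raddf_sum /=.
under eq_bigr => r _.
  rewrite mcoeffZ mcoeff_blow mcoeff_mfam; last first.
    by move=> b; rewrite mulr0 raddf0; apply: fpsP.
  rewrite mulrCA; over.
rewrite -mulr_sumr -arc_sliceP fps_shiftE // => i lt_i.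
have [ca|/memN_msupp_eq0 ->] := boolP (a \in msupp c); last by rewrite mulr0.
rewrite fcoefXnM (leq_trans lt_i) // (leq_trans _ le_N) //.
by rewrite (bigD1_seq a) ?msupp_uniq //= leq_maxl.
Qed.

Lemma arc_decomp_inj (x y : 'I_w0 -> P) :
  \sum_(r < w0) s ^+ r *: beta (x r) = \sum_(r < w0) s ^+ r *: beta (y r) -> x =1 y.
Proof.
move=> xy r; apply/mpolyP => a; have E := congr1 (mcoeff a) xy.
have coefE (z : 'I_w0 -> P) : (\sum_(r < w0) s ^+ r *: beta (z r))@_a =
    s ^+ wdeg w a * \sum_(r < w0) s ^+ r * pw (z r)@_a.
  rewrite raddf_sum /= mulr_sumr; apply: eq_bigr => k _.
  by rewrite mcoeffZ mcoeff_blow mulrCA.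
move: (etrans (esym (coefE x)) (etrans E (coefE y))).
move/(congr1 (fps_shift (wdeg w a))); rewrite !fps_shiftK.
by move/(congr1 (arc_slice r)); rewrite !arc_slice_uniq.
Qed.

Lemma pw_t M : pw (s ^+ M) = s ^+ (w0 * M).
Proof.
apply: fpsP => j; rewrite pwE !fcoefXn; case: ifP => [/dvdnP[k ->]|dN].
  by rewrite mulnK // mulnC eqn_pmul2l.
by case: eqP dN => [->|//]; rewrite dvdn_mulr.
Qed.

Lemma blow_tXn M f : beta (tP ^+ M * f) = s ^+ (w0 * M) *: beta f.
Proof.
apply/mpolyP => a; rewrite -rmorphXn /= mul_mpolyC mcoeffZ !mcoeff_blow mcoeffZ.
by rewrite rmorphM pw_t mulrCA.
Qed.

Lemma weight_ge_arc n f :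
  S n f <-> s ^+ n *: map_mpoly (fps_shift n) (beta f) = beta f.
Proof.
split=> [/weight_geP Sf | fE].
  apply/mpolyP => a; rewrite mcoeffZ mcoeff_map_mpoly fps_shiftE // => j lt_j.
  rewrite mcoeff_blow fcoefXnM; case: ltnP => // le_aj; rewrite pwE.
  case: ifP => // /dvdnP[k kE]; rewrite kE mulnK // Sf //.
  by rewrite mulnC -kE subnK.
apply/weight_geP => a i lt_n; move/mpolyP/(_ a): fE; rewrite mcoeff_blow mcoeffZ.
move/(congr1 (fun b => fcoef b (w0 * i + wdeg w a))).
by rewrite !fcoefXnM lt_n ltnNge leq_addl addnK /= pwE dvdn_mulr // mulKn.
Qed.

Variables (I J : set P).
Hypotheses (idI : ideal I) (idJ : ideal J) (flI : flat_quotient I) (flJ : flat_quotient J).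
Hypothesis I_gen : forall g, I g -> exists e, ideal_gen [set beta f | f in J] (s ^+ e *: g).
Hypothesis blow_I : forall f, J f -> I (beta f).

Lemma arc_decomp_mem (x : 'I_w0 -> P) :
  I (\sum_(r < w0) s ^+ r *: beta (x r)) -> forall r, J (x r).
Proof.
have [J0 JD JM] := idJ.
(* The quantifier over multipliers [c] makes [K] stable under multiplication, the one over large [N]
   makes it stable under sums. *)
pose K := [set g : P | forall c, exists N0, forall N, (N0 <= N)%N ->
  exists2 y : 'I_w0 -> P, (forall r, J (y r)) &
    s ^+ N *: (c * g) = \sum_(r < w0) s ^+ r *: beta (y r)].
have idK : ideal K.
  split=> [c|g g' Kg Kg' c|a g Kg c].
  - exists 0%N => N _; exists (fun=> 0) => //; rewrite mulr0 scaler0 big1 // => r _.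
    by rewrite [beta 0]rmorph0 scaler0.
  - have [N1 H1] := Kg c; have [N2 H2] := Kg' c; exists (maxn N1 N2) => N.
    rewrite geq_max => /andP[/H1[y1 Jy1 E1] /H2[y2 Jy2 E2]].
    exists (fun r => y1 r + y2 r) => [r|]; first exact: JD.
    rewrite mulrDr scalerDr; apply: etrans (congr2 +%R E1 E2) _.
    rewrite -big_split; apply: eq_bigr => r _ /=.
    by rewrite -scalerDr; congr (_ *: _); apply: esym; apply: rmorphD.
  - by have := Kg (c * a); rewrite -mulrA.
have genK : ideal_gen [set beta f | f in J] `<=` K.
  apply: ideal_gen_sub => // _ [f Jf <-] c; have [N0 dec] := arc_decomp c.
  exists N0 => N /dec[y cE]; exists (fun r => y r * f) => [r|]; first exact: JM.
  rewrite scalerAl cE mulr_suml; apply: eq_bigr => r _.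
  by rewrite blowM scalerAl.
move=> /I_gen[e /genK /(_ 1)[N0 dec]] r.
have le1 : (N0 + e <= w0 * (N0 + e))%N by rewrite leq_pmull.
have le2 : (e <= w0 * (N0 + e))%N by apply: leq_trans le1; apply: leq_addl.
(* With the factor s^e already present the total power is s^(w0 (N0 + e)), the image of t^(N0 + e),
   so uniqueness of slices applies. *)
have [|y Jy] := dec (w0 * (N0 + e) - e)%N; first by rewrite leq_subRL // addnC.
rewrite mul1r scalerA -exprD subnK //.
move=> E; have /(_ r) yE : (fun r => tP ^+ (N0 + e) * x r) =1 y.
  apply: arc_decomp_inj; apply: etrans _ E; rewrite scaler_sumr; apply: eq_bigr => k _.
  by rewrite blow_tXn scalerA mulrC -scalerA.
have : J (tP ^+ (N0 + e) * x r) by rewrite yE.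
rewrite -rmorphXn /= mul_mpolyC; apply: flat_torsion_free => //.
exact: fpsXn_nonzerodiv.
Qed.

Lemma blow_arc_mem f : I (beta f) <-> J f.
Proof.
split=> [If|]; last exact: blow_I.
pose x (r : 'I_w0) := if r == Ordinal w0_gt0 then f else 0.
have /arc_decomp_mem/(_ (Ordinal w0_gt0)) : I (\sum_(r < w0) s ^+ r *: beta (x r)).
  rewrite (bigD1 (Ordinal w0_gt0)) //= /x eqxx expr0 scale1r big1 ?addr0 // => r.
  by move/negPf => ->; rewrite [beta 0]rmorph0 scaler0.
by rewrite /x eqxx.
Qed.

Variables (OXv : comNzRingType) (q : {rmorphism P -> OXv}).
Hypothesis qI : is_quotient I q.

(* The value of f / t^n on the arc. *)
Definition arc_frac n (f : P) : OXv := q (map_mpoly (fps_shift (n * w0)) (beta f)).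

Lemma q_scale c f : q (c *: f) = q c%:MP * q f.
Proof. by rewrite -mul_mpolyC rmorphM. Qed.

Lemma q_eq0 f : q f = 0 <-> I f. Proof. by case: qI => _; apply. Qed.

Lemma qs_nonzerodiv n : nonzerodiv (q (s ^+ n)%:MP).
Proof.
move=> y; have [f <-] : exists f, q f = y by case: qI => + _; apply.
rewrite -q_scale => /q_eq0 If; apply/q_eq0.
by apply: flat_torsion_free If => //; apply: fpsXn_nonzerodiv.
Qed.

(** Identities between values of [arc_frac] are proved after multiplying by a power of [s], where
    the division disappears. *)
Lemma qs_cancel n y y' : q (s ^+ n)%:MP * y = q (s ^+ n)%:MP * y' -> y = y'.
Proof.
move=> E; apply/eqP; rewrite -subr_eq0; apply/eqP/(@qs_nonzerodiv n).
by rewrite mulrBr E subrr.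
Qed.

Lemma arc_fracE n f : S (n * w0) f ->
  q (s ^+ (n * w0))%:MP * arc_frac n f = q (beta f).
Proof. by move=> /weight_ge_arc fE; rewrite -q_scale fE. Qed.

Lemma arc_frac0E f : arc_frac 0 f = q (beta f).
Proof.
have Sf : S (0 * w0) f by rewrite mul0n; apply: weight_ge_all.
by have := arc_fracE Sf; rewrite mul0n expr0 !rmorph1 mul1r.
Qed.

Lemma arc_fracD n f g : arc_frac n (f + g) = arc_frac n f + arc_frac n g.
Proof.
rewrite /arc_frac [beta _]rmorphD; apply: etrans (rmorphD q _ _); congr (q _).
exact: (raddfD (map_mpoly (fps_shift (n * w0)))).
Qed.

Lemma arc_fracM n k f g : S (n * w0) f -> S (k * w0) g ->
  arc_frac (n + k) (f * g) = arc_frac n f * arc_frac k g.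
Proof.
move=> Sf Sg; apply: (@qs_cancel ((n + k) * w0)); rewrite arc_fracE; last first.
  by rewrite mulnDl; apply: weight_geM.
rewrite blowM rmorphM -(arc_fracE Sf) -(arc_fracE Sg) mulrACA -!rmorphM.
by rewrite -exprD -mulnDl.
Qed.

Lemma arc_frac_t : arc_frac 1 tP = 1.
Proof.
apply: (@qs_cancel (1 * w0)); rewrite arc_fracE; last by rewrite mul1n; apply: weight_ge_t.
by rewrite blowC -[X in pw X]expr1 pw_t muln1 mul1n mulr1.
Qed.

Lemma arc_frac_eq0 n f : S (n * w0) f -> (arc_frac n f = 0 <-> J f).
Proof.
move=> Sf; rewrite -blow_arc_mem -q_eq0 -(arc_fracE Sf).
by split=> [->|/qs_nonzerodiv //]; rewrite mulr0.
Qed.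

Lemma arc_frac_surj g : exists N (y : 'I_w0 -> P),
  q (s ^+ N)%:MP * q g = \sum_(r < w0) q (s ^+ r)%:MP * q (beta (y r)).
Proof.
have [N /(_ N (leqnn _))[y E]] := arc_decomp g; exists N, y.
by rewrite -q_scale E rmorph_sum; apply: eq_bigr => r _; rewrite q_scale.
Qed.

End ArcChart.

(** * Fractions of degree zero on an affine chart *)

Section ChartMaps.
Variables (P : comNzRingType) (S : nat -> set P) (J : set P) (g : P) (d : nat).
Hypotheses (S_one : S 0%N 1) (SD : forall n x y, S n x -> S n y -> S n (x + y))
  (SN : forall n x, S n x -> S n (- x))
  (SM : forall n k x y, S n x -> S k y -> S (n + k)%N (x * y)) (Sg : S d g).

(* [frac j f] behaves as the fraction f / g^j modulo the ideal [J]. *)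
Definition chart_map (B : comNzRingType) (frac : nat -> P -> B) :=
  [/\ forall j x y, S (j * d)%N x -> S (j * d)%N y -> frac j (x + y) = frac j x + frac j y,
      forall i j x y, S (i * d)%N x -> S (j * d)%N y ->
        frac (i + j)%N (x * y) = frac i x * frac j y,
      frac 0%N 1 = 1 /\ frac 1%N g = 1
    & forall j x, S (j * d)%N x -> (frac j x = 0 <-> J x)].

Lemma pow_degree k : S (k * d)%N (g ^+ k).
Proof. by elim: k => [|k IHk]; rewrite ?expr0 // exprS mulSn; apply: SM. Qed.

Section OneMap.
Variables (B : comNzRingType) (frac : nat -> P -> B).
Hypothesis frac_map : chart_map frac.

Lemma chart_map_pow k : frac k (g ^+ k) = 1.
Proof.
case: frac_map => _ fM [f1 fg] _; elim: k => [|k IHk]; first by rewrite expr0.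
rewrite exprS -[k.+1]add1n fM ?fg ?IHk ?mulr1 // ?mul1n //.
exact: pow_degree.
Qed.

Lemma chart_map_shift k j x : S (j * d)%N x -> frac (k + j)%N (g ^+ k * x) = frac j x.
Proof.
move=> Sx; have [_ fM _ _] := frac_map.
by rewrite fM ?chart_map_pow ?mul1r //; apply: pow_degree.
Qed.

Lemma chart_map_sub n x y : S (n * d)%N x -> S (n * d)%N y ->
  frac n (x - y) = frac n x - frac n y.
Proof.
move=> Sx Sy; apply: (addIr (frac n y)); rewrite subrK.
have [fD _ _ _] := frac_map.
by rewrite -fD ?subrK //; apply: SD => //; apply: SN.
Qed.

Lemma pow_mul_degree k j x : S (j * d)%N x -> S ((k + j) * d)%N (g ^+ k * x).
Proof. by move=> Sx; rewrite mulnDl; apply: SM => //; apply: pow_degree. Qed.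

Lemma chart_map_eq j x j' x' : S (j * d)%N x -> S (j' * d)%N x' ->
  frac j x = frac j' x' <-> J (g ^+ j' * x - g ^+ j * x').
Proof.
move=> Sx Sx'; have [_ _ _ ker] := frac_map.
have Sa : S ((j' + j) * d)%N (g ^+ j' * x) by apply: pow_mul_degree.
have Sb : S ((j' + j) * d)%N (g ^+ j * x').
  by rewrite addnC; apply: pow_mul_degree.
rewrite -(chart_map_shift j' Sx) -(chart_map_shift j Sx') [(j + j')%N]addnC -(ker (j' + j)%N).
  rewrite chart_map_sub //; split=> [->|/eqP]; first by rewrite subrr.
  by rewrite subr_eq0 => /eqP.
by apply: SD => //; apply: SN.
Qed.

End OneMap.

Variables (B B' : comNzRingType) (frac : nat -> P -> B) (frac' : nat -> P -> B').
Hypotheses (fB : chart_map frac) (fB' : chart_map frac')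
  (frac_surj : forall b, exists j x, S (j * d)%N x /\ b = frac j x).

Lemma chart_denominator b : exists j, forall n, (j <= n)%N ->
  exists x, S (n * d)%N x /\ b = frac n x.
Proof.
have [j [x [Sx ->]]] := frac_surj b; exists j => n le_jn.
exists (g ^+ (n - j) * x); rewrite -{1 3}(subnK le_jn) chart_map_shift //; split=> //.
exact: pow_mul_degree.
Qed.

(** By [chart_map_eq], equality of two fractions means the same cross-multiplied condition modulo
    [J] in both rings, so transport of representatives is well defined and injective. *)
Lemma chart_hom : exists h : {rmorphism B -> B'},
  injective h /\ forall j x, S (j * d)%N x -> h (frac j x) = frac' j x.
Proof.
have ex b : exists p : nat * P, S (p.1 * d)%N p.2 /\ b = frac p.1 p.2.
  by have [j [x H]] := frac_surj b; exists (j, x).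
have [c cP] := choice ex; pose h b := frac' (c b).1 (c b).2.
have hE j x : S (j * d)%N x -> h (frac j x) = frac' j x.
  move=> Sx; have [Sc cE] := cP (frac j x).
  by apply/(chart_map_eq fB') => //; apply/(chart_map_eq fB).
have com b b' : exists n x x', [/\ S (n * d)%N x, S (n * d)%N x', b = frac n x & b' = frac n x'].
  have [j hj] := chart_denominator b; have [j' hj'] := chart_denominator b'.
  have [x [Sx ->]] := hj _ (leq_maxl j j'); have [x' [Sx' ->]] := hj' _ (leq_maxr j j').
  by exists (maxn j j'), x, x'.
have hD : {morph h : b b' / b - b'}.
  move=> b b'; have [n [x [x' [Sx Sx' -> ->]]]] := com b b'.
  rewrite -(chart_map_sub fB) // !hE //; first exact: chart_map_sub.
  by apply: SD => //; apply: SN.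
have hM : monoid_morphism h.
  split=> [|b b'].
    have [_ _ [f1 _] _] := fB; have [_ _ [f1' _] _] := fB'.
    by rewrite -f1 hE // mul0n.
  have [n [x [x' [Sx Sx' -> ->]]]] := com b b'.
  have [_ fM _ _] := fB; have [_ fM' _ _] := fB'.
  by rewrite -fM // !hE // ?fM' // mulnDl; apply: SM.
pose m1 := GRing.isZmodMorphism.Build B B' h hD.
pose m2 := GRing.isMonoidMorphism.Build B B' h hM.
pose hr : {rmorphism B -> B'} := HB.pack h m1 m2.
have hrE b : hr b = h b by [].
exists hr; split=> [b b'|j x Sx]; last by rewrite hrE hE.
have [n [x [x' [Sx Sx' -> ->]]]] := com b b'; rewrite !hrE !hE //.
by move/(chart_map_eq fB' Sx Sx')/(chart_map_eq fB Sx Sx').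
Qed.

End ChartMaps.

Section BaseChangeGeneration.
Variables (A A' B B' : comNzRingType) (f : A -> B) (g : A -> A')
  (j : {rmorphism B -> B'}) (j' : {rmorphism A' -> B'}).

Definition tensor_pred : {pred B'} :=
  fun x => `[< exists s : seq (B * A'), x = \sum_(p <- s) j p.1 * j' p.2 >].

Fact tensor_subring : subring_closed tensor_pred.
Proof.
split.
- by apply/asboolP; exists [:: (1, 1)]; rewrite big_seq1 !rmorph1 mulr1.
- move=> x y /asboolP[s ->] /asboolP[s' ->]; apply/asboolP.
  exists (s ++ [seq (- p.1, p.2) | p <- s']); rewrite big_cat big_map; congr (_ + _).
  by rewrite -sumrN; apply: eq_bigr => p _; rewrite rmorphN mulNr.
- move=> x y /asboolP[s ->] /asboolP[s' ->]; apply/asboolP.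
  exists [seq (p.1 * p'.1, p.2 * p'.2) | p <- s, p' <- s'].
  rewrite big_allpairs_dep mulr_suml; apply: eq_bigr => p _.
  rewrite mulr_sumr; apply: eq_bigr => p' _.
  by rewrite !rmorphM mulrACA.
Qed.
HB.instance Definition _ := GRing.isSubringClosed.Build B' tensor_pred tensor_subring.

Fact tensor_left b : j b \in tensor_pred.
Proof. by apply/asboolP; exists [:: (b, 1)]; rewrite big_seq1 rmorph1 mulr1. Qed.

Fact tensor_right a : j' a \in tensor_pred.
Proof. by apply/asboolP; exists [:: (1, a)]; rewrite big_seq1 rmorph1 mul1r. Qed.

(* The subring generated by the two factors has a retraction from [B'], which
   is the identity by uniqueness. *)
Lemma base_change_generated : is_base_change f g j j' -> forall x,
  exists s : seq (B * A'), x = \sum_(p <- s) j p.1 * j' p.2.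
Proof.
move=> [jf univ] x.
have [|k [kj kj' _]] := univ _ (to_subring tensor_left) (to_subring tensor_right).
  by move=> a; apply: val_inj; rewrite /= jf.
have [k0 [_ _ uniq]] := univ B' j j' jf.
have vk : (\val \o k) x = k0 x.
  by apply: (uniq (\val \o k)) => y /=; rewrite ?kj ?kj'.
have -> : x = \val (k x) by rewrite -[RHS]/((\val \o k) x) vk -(uniq idfun).
by case: (k x) => y yP; apply: asboolW yP.
Qed.

End BaseChangeGeneration.

Lemma fraction_repr (A : idomainType) (x : {fraction A}) :
  exists n d, d != 0 /\ x * tofrac d = tofrac n.
Proof.
exists (repr x).1, (repr x).2; split; first exact: denom_ratioP.
rewrite -{1}[x]reprK; unlock tofrac; rewrite -[LHS]FracField.pi_mul.
apply/eqmodP; rewrite /= FracField.equivfE /FracField.mulf.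
by rewrite !numden_Ratio ?mulr1 ?mul1r ?oner_neq0 ?denom_ratioP // mulrC.
Qed.

(** A nonzero series is a power of the variable times a unit, so only such powers occur as
    denominators. *)
Lemma fps_fraction (k : fieldType) (x : {fraction fps k}) :
  exists e b, tofrac (fpsX k ^+ e) * x = tofrac b.
Proof.
have [n [d [d0 xE]]] := fraction_repr x.
have [e [de dlt]] := fps_neq0 d0.
have dE : fpsX k ^+ e * fps_shift e d = d by apply: fps_shiftE.
have [|g gE] := @fps_inv_ex _ (fps_shift e d); first by rewrite /= add0n.
exists e, (n * g); rewrite tofracM -xE -dE tofracM -!mulrA -tofracM.
by rewrite [fps_shift e d * g]mulrC gE tofrac1 mulr1 mulrC.
Qed.

(** * Normality of the family over the arc *)

Section ArcNormality.
Variables (R : realType) (l : nat) (w : 'I_l -> nat).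
Local Notation C := (R[i]).
Local Notation P := {mpoly (fps C)[l]}.
Local Notation s := (fpsX C).
Variable pw : {rmorphism fps C -> fps C}.
Local Notation beta := (blow w pw).
Local Notation K := {fraction (fps C)}.
Local Notation iota := (@tofrac (fps C) : {rmorphism fps C -> K}).
Variables (OD : comNzRingType) (taylor : {rmorphism OD -> fps C}) (JO : set {mpoly OD[l]}).
Let J := base_change_ideal taylor JO.

Variables (I : set P).
Hypotheses (idI : ideal I) (flI : flat_quotient I).
Hypothesis I_gen : forall g, I g -> exists e, ideal_gen [set beta f | f in J] (s ^+ e *: g).
Hypothesis blow_I : forall f, J f -> I (beta f).
Variables (OXv : comNzRingType) (q : {rmorphism P -> OXv}).
Hypothesis qI : is_quotient I q.

Variables (F : fieldType) (rho : {rmorphism {mpoly K[l]} -> F}).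
Hypotheses
  (rhoP : forall f, rho f = 0 <-> base_change_ideal (iota \o (pw \o taylor)) JO f)
  (rho_normal : normal (range rho)).
Variables (F0 : fieldType) (rho0 : {rmorphism {mpoly C[l]} -> F0}).
Hypothesis rho0P : forall f, rho0 f = 0 <-> base_change_ideal (@fps_coef0 C) I f.

Let sg : K := iota s.
Let sg_neq0 : sg != 0. Proof. by rewrite tofrac_eq0 fpsX_neq0. Qed.

(** Over C((s)) the substitution z_i = s^(w_i) z'_i is invertible; it identifies the generic fiber
    over the arc with the fiber of the original family at a C((s))-valued point. *)
Let down (p : {mpoly K[l]}) := rescale (fun i => sg^-1 ^+ w i) p.
Let up (p : {mpoly K[l]}) := rescale (fun i => sg ^+ w i) p.

Let mmap1_pow (x : K) a : mmap1 (fun i => x ^+ w i) a = x ^+ wdeg w a.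
Proof.
rewrite /mmap1 /wdeg expr_sum; apply: eq_bigr => i _.
by rewrite exprM.
Qed.

Let mcoeff_down p a : (down p)@_a = p@_a * sg^-1 ^+ wdeg w a.
Proof. by rewrite mcoeff_rescale mmap1_pow. Qed.

Let mcoeff_up p a : (up p)@_a = p@_a * sg ^+ wdeg w a.
Proof. by rewrite mcoeff_rescale mmap1_pow. Qed.

Let upK p : up (down p) = p.
Proof.
apply/mpolyP => a; apply: etrans (mcoeff_up _ _) _.
rewrite (mcoeff_down p a) -mulrA -exprMn mulVf //.
by rewrite expr1n mulr1.
Qed.

Definition generic_eval (f : P) : F := rho (down (map_mpoly iota f)).

Fact generic_eval_additive : {morph generic_eval : f g / f - g}.
Proof. by move=> f g; rewrite /generic_eval /down /rescale !rmorphB. Qed.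
Fact generic_eval_monoid : monoid_morphism generic_eval.
Proof.
by split=> [|f g]; rewrite /generic_eval /down /rescale ?rmorph1 ?rmorphM.
Qed.
HB.instance Definition _ := GRing.isZmodMorphism.Build P F generic_eval
  generic_eval_additive.
HB.instance Definition _ := GRing.isMonoidMorphism.Build P F generic_eval
  generic_eval_monoid.

Let generic_evalC c : generic_eval c%:MP = rho (iota c)%:MP.
Proof. by rewrite /generic_eval map_mpolyC /down /rescale comp_mpolyC. Qed.

Let generic_eval_s e : generic_eval (s ^+ e)%:MP != 0.
Proof.
rewrite generic_evalC; apply/eqP => E; pose x : K := iota (s ^+ e).
have x0 : x != 0 by rewrite tofrac_eq0 expf_neq0 ?fpsX_neq0.
have : rho (x^-1 * x)%:MP = 0 by rewrite mpolyCM rmorphM E mulr0.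
by rewrite mulVf // mpolyC1 rmorph1 => /eqP; rewrite oner_eq0.
Qed.

Let mcoeff_iota_blow f a :
  (map_mpoly iota (beta f))@_a = sg ^+ wdeg w a * iota (pw f@_a).
Proof.
apply: etrans (mcoeff_map iota _ a) _.
by rewrite (mcoeff_blow w pw f a) (rmorphM iota) (rmorphXn iota).
Qed.

Let generic_eval_blow f : generic_eval (beta f) = rho (map_mpoly (iota \o pw) f).
Proof.
apply: (congr1 rho); apply/mpolyP => a; apply: etrans (mcoeff_down _ _) _.
apply: etrans (congr1 ( *%R^~ _) (mcoeff_iota_blow f a)) _.
apply: etrans (esym (mcoeff_map (iota \o pw) f a)).
by rewrite mulrAC -exprMn mulfV // expr1n mul1r.
Qed.

(** Vanishing on the generic fiber is membership in the extended ideal over C((s)). Contracting it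
    costs a power of [s], which flatness removes. *)
Lemma generic_eval_eq0 f : generic_eval f = 0 <-> I f.
Proof.
split=> [/rhoP f0 | /I_gen[e]].
  pose G := [set beta (map_mpoly taylor j) | j in JO].
  have up_mem p : base_change_ideal (iota \o (pw \o taylor)) JO p ->
      ideal_gen [set map_mpoly iota g | g in G] (up p).
    have idU : ideal [set p | ideal_gen [set map_mpoly iota g | g in G] (up p)].
      exact: (ideal_preim (comp_mpoly _) (ideal_genP _)).
    apply: (ideal_gen_sub idU) => _ [j Jj <-].
    apply: mem_ideal_gen; exists (beta (map_mpoly taylor j)); first by exists j.
    apply/mpolyP => a; apply: etrans (esym (mcoeff_up _ _)).
    apply: etrans (mcoeff_iota_blow _ a) _; rewrite mulrC.
    apply: (congr1 ( *%R^~ _)); rewrite (mcoeff_map taylor).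
    exact: esym (mcoeff_map (iota \o (pw \o taylor)) j a).
  have iota_inj : injective iota by move=> x y /eqP; rewrite tofrac_eq => /eqP.
  have := up_mem _ f0; rewrite upK => /(contract_away iota_inj (@fps_fraction C))[e ge].
  apply: (flat_torsion_free flI (@fpsXn_nonzerodiv _ e)).
  apply: ideal_gen_sub ge => // _ [j Jj <-]; apply: blow_I.
  exact: mem_base_change.
pose ev : {rmorphism P -> F} := generic_eval.
pose Z := [set g | ev g = 0].
have idZ : ideal Z.
  split=> [|x y x0 y0|c x x0]; first exact: (rmorph0 ev).
    exact: etrans (rmorphD ev x y) (etrans (congr2 +%R x0 y0) (addr0 _)).
  exact: etrans (rmorphM ev c x) (etrans (congr1 _ x0) (mulr0 _)).
have JZ : [set beta f | f in J] `<=` Z.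
  move=> _ [j Jj <-]; apply: etrans (generic_eval_blow j) _; apply/rhoP.
  have jE : map_mpoly (iota \o pw) j = map_mpoly iota (map_mpoly pw j).
    exact: map_mpoly_comp2.
  rewrite jE -base_change_comp -base_change_comp.
  by do 2 apply: mem_base_change.
move=> /(ideal_gen_sub idZ JZ) Zf.
apply: (mulfI (generic_eval_s e)); rewrite mulr0.
apply: etrans (esym (rmorphM ev _ _)) _.
by rewrite mul_mpolyC; exact: Zf.
Qed.

(** The special fiber embeds into the field [F0], where a nilpotent class is zero; an element
    vanishing at s = 0 modulo [I] is a multiple of [s] modulo [I]. *)
Lemma special_reduced n g h : (0 < n)%N -> I (g ^+ n - s *: h) -> exists h', I (g - s *: h').
Proof.
move=> n_gt0 Igh.
have surj : forall b : C, exists a : fps C, fps_coef0 a = b.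
  by move=> b; exists b%:A; rewrite /fps_coef0 fcoef_alg.
pose c0 : {rmorphism P -> {mpoly C[l]}} := map_mpoly (@fps_coef0 C).
have c0s : c0 (s *: h) = 0.
  by rewrite /c0 /= map_mpolyZ -[X in X *: _]/(0 : C) scale0r.
have c0E : c0 (g ^+ n - s *: h) = c0 g ^+ n.
  by rewrite (rmorphB c0) c0s subr0 (rmorphXn c0).
have : rho0 (c0 g) = 0.
  have /rho0P := mem_base_change (@fps_coef0 C) Igh.
  rewrite -[map_mpoly _ _]/(c0 _) c0E rmorphXn.
  by move/eqP; rewrite expf_eq0 n_gt0 => /eqP.
move/rho0P; rewrite base_change_surj // => -[g' Ig' E].
exists (map_mpoly (fps_shift 1) (g - g')).
suff -> : s *: map_mpoly (fps_shift 1) (g - g') = g - g' by rewrite opprB addrC subrK.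
apply/mpolyP => a; rewrite mcoeffZ mcoeff_map_mpoly.
apply/esym/fps_coef0_eq0; apply: etrans (esym (mcoeff_map (@fps_coef0 C) _ a)) _.
have -> : map_mpoly (@fps_coef0 C) (g - g') = 0.
  by apply: etrans (rmorphB c0 g g') _; rewrite -[c0 g]E subrr.
exact: mcoeff0.
Qed.

(** The fraction x = a / b is integral, so normality of the generic fiber places it in [OXv] after
    multiplication by some s^e. If s^(e+1) x is a function, its integral equation makes its [d]-th
    power divisible by [s]; the special fiber being reduced, the function itself is divisible by
    [s], and [e] decreases to 0. *)
Lemma arc_normal : integrally_closed OXv.
Proof.
move=> a b nzb [d [c E]].
have [eta [eta_inj etaE']] := quotient_lift (f := generic_eval) qI generic_eval_eq0.
have etaE f : eta (q f) = generic_eval f := etaE' f.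
have q_surj y : exists f, q f = y by case: qI => + _; apply.
have b0 : eta b != 0.
  apply/eqP => eb; have : b = 0 by apply: eta_inj; rewrite eb rmorph0.
  move=> b0; have := nzb 1; rewrite b0 mul0r => /(_ erefl)/eqP.
  by rewrite oner_eq0.
pose x := eta a / eta b.
have xE : x ^+ d + \sum_(i < d) eta (c i) * x ^+ i = 0.
  have := congr1 (fun y => eta y / eta b ^+ d) E.
  rewrite rmorph0 mul0r rmorphD rmorphXn mulrDl -expr_div_n rmorph_sum mulr_suml => E'.
  rewrite -[RHS]E'; congr (_ + _); apply: eq_bigr => i _.
  have bE : eta b ^+ d = eta b ^+ (d - i) * eta b ^+ i by rewrite -exprD subnK // ltnW.
  rewrite !rmorphM !rmorphXn /x expr_div_n -!mulrA; congr (_ * (_ * _)).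
  by rewrite bE invfM mulrA mulfV ?mul1r // expf_neq0.
have eta_range y : range rho (eta y).
  by have [f <-] := q_surj y; rewrite etaE; exists (down (map_mpoly iota f)).
have [p _ pE] : range rho x.
  by apply: rho_normal; exists d, (fun i => eta (c i)); split=> // i.
have [e [f0 f0E]] := clear_denominators (up p) (@fps_fraction C).
pose rs := rho sg%:MP.
have rsE n : rho (sg ^+ n)%:MP = rs ^+ n by rewrite !rmorphXn.
have sE n : eta (q (s ^+ n)%:MP) = rs ^+ n.
  by rewrite etaE generic_evalC (rmorphXn iota) rsE.
have : exists y, eta y = rs ^+ e * x.
  exists (q f0); rewrite etaE /generic_eval -f0E -pE -rsE -rmorphM; apply: (congr1 rho).
  apply/mpolyP => a0; apply: etrans (mcoeff_down _ _) _.
  rewrite mul_mpolyC !mcoeffZ mcoeff_up (rmorphXn iota) -!mulrA -exprMn mulfV //.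
  by rewrite expr1n mulr1.
have d_gt0 : (0 < d)%N.
  by case: (d) (c) E => // c'; rewrite big_ord0 addr0 expr0 => /eqP; rewrite oner_eq0.
elim: e {f0 f0E} => [|e IHe] [y yE].
  exists y; apply: eta_inj; rewrite rmorphM yE expr0 mul1r.
  by rewrite /x mulrCA mulfV ?mulr1.
apply: IHe; have [f fE] := q_surj y.
(* Scaling the equation by s^((e+1) d) gives term [i] the factor s^((e+1)(d - i)). As [i < d], this
   exponent is positive, and one factor [s] is set aside. *)
pose h (i : 'I_d) := q (s ^+ (e.+1 * (d - i)).-1)%:MP * c i * y ^+ i.
have [h' h'E] := q_surj (- \sum_(i < d) h i).
have [|f1 If1] := special_reduced (g := f) (h := h') d_gt0.
  case: (qI) => _ /(_ (f ^+ d - s *: h')) [+ _]; apply.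
  rewrite rmorphB rmorphXn fE q_scale h'E mulrN opprK; apply: eta_inj.
  rewrite rmorph0 rmorphD rmorphXn yE rmorphM rmorph_sum.
  have E2 : (rs ^+ e.+1 * x) ^+ d +
      \sum_(i < d) (rs ^+ e.+1) ^+ d * (eta (c i) * x ^+ i) = 0.
    by rewrite exprMn -mulr_sumr -mulrDr xE mulr0.
  rewrite -[RHS]E2; congr (_ + _); rewrite mulr_sumr; apply: eq_bigr => i _.
  rewrite /h !rmorphM rmorphXn yE.
  rewrite -[q s%:MP]/(q (s ^+ 1)%:MP) !sE exprMn.
  have E1 : (rs ^+ e.+1) ^+ d = rs ^+ 1 *
      rs ^+ (e.+1 * (d - i)).-1 * (rs ^+ e.+1) ^+ i.
    rewrite -!exprM -!exprD; congr (_ ^+ _).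
    rewrite add1n prednK ?muln_gt0 ?subn_gt0 //= -mulnDr subnK // ltnW //.
  by rewrite E1 -!mulrA; congr (_ * (_ * _)); rewrite mulrCA.
exists (q f1); apply: (mulfI (x := eta (q s%:MP))).
  by rewrite etaE -[s]expr1.
rewrite -rmorphM -q_scale mulrA [eta (q s%:MP)](sE 1%N).
have -> : q (s *: f1) = y.
  apply/eqP; rewrite eq_sym -subr_eq0 -fE -rmorphB; apply/eqP.
  by case: (qI) => _ ->.
by rewrite yE -exprD.
Qed.

End ArcNormality.

(** * The base changed chart and its normalization *)

Section ArcNormalization.
Variables (R : realType) (l w0 : nat) (w : 'I_l -> nat).
Hypothesis w0_gt0 : (0 < w0)%N.
Local Notation C := (R[i]).
Local Notation P := {mpoly (fps C)[l]}.
Local Notation s := (fpsX C).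
Local Notation S := (@weight_ge R l w0 w).
Local Notation tP := ((fpsX C)%:MP : P).
Variable pw : {rmorphism fps C -> fps C}.
Hypothesis pwE : forall f j,
  fcoef (pw f) j = if (w0 %| j)%N then fcoef f (j %/ w0) else 0.
Local Notation beta := (blow w pw).
Variables (I J : set P).
Hypotheses (idI : ideal I) (idJ : ideal J) (flI : flat_quotient I) (flJ : flat_quotient J).
Hypothesis I_gen : forall g, I g -> exists e, ideal_gen [set beta f | f in J] (s ^+ e *: g).
Hypothesis blow_I : forall f, J f -> I (beta f).
Variables (OXv : comNzRingType) (q : {rmorphism P -> OXv}).
Hypothesis qI : is_quotient I q.
Local Notation af := (arc_frac w0 w pw q).
Local Notation bl := (strict_transform w0 w J).

Lemma arc_chart_map : chart_map S J tP w0 af.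
Proof.
split=> [j x y _ _|i j x y Sx Sy||j x Sx].
- exact: arc_fracD.
- exact: (arc_fracM w0_gt0 pwE flI qI Sx Sy).
- split; last exact: (arc_frac_t w w0_gt0 pwE flI qI).
  by rewrite (arc_frac0E w w0_gt0 pwE q) [blow _ _ _]rmorph1 rmorph1.
- exact: (arc_frac_eq0 w0_gt0 pwE idJ flI flJ I_gen blow_I qI Sx).
Qed.

(** Powers of t cancel modulo [J], so the vanishing of a fraction in the chart amounts to its
    numerator lying in [J]. *)
Lemma strict_transform_shift i n x : S (n * w0)%N x ->
  bl ((i + n) * w0)%N (tP ^+ i * x) <-> J x.
Proof.
move=> Sx; split=> [/(strict_transformE w w0_gt0 flJ)[_]|Jx].
  exact: torsion_free_tP.
apply/(strict_transformE w w0_gt0 flJ); split; last by case: idJ => _ _; apply.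
rewrite mulnDl; apply: (weight_geM w0_gt0) Sx.
by apply: (weight_geXn w0_gt0); apply: weight_ge_t.
Qed.

Lemma strict_chart_map (B : comNzRingType) (frac : nat -> P -> B) :
  chart_ring S bl tP w0 frac -> chart_map S J tP w0 frac.
Proof.
move=> [fD fM f1 _ fker]; split=> // j x Sx; rewrite fker //; split=> [[k]|Jx].
  by move/(strict_transform_shift k Sx).
by exists 0%N; apply/strict_transform_shift.
Qed.

(** The only slice is [r = 0], so s^N g is itself some [beta x]. Divisibility by s^N then says that
    [x] has weight at least [N], and [g] is the value of x / t^N. *)
Lemma arc_chart_ring : w0 = 1%N -> chart_ring S bl tP w0 af.
Proof.
move=> w01; have [fD fM f1 fker] := arc_chart_map; split=> //; [move=> b | move=> j x Sx].
  have [g <-] : exists g, q g = b by case: qI => + _; apply.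
  have [N /(_ N (leqnn _))[y]] := arc_decomp w w0_gt0 pwE g.
  rewrite (big_pred1 (Ordinal w0_gt0)) => [|r]; last first.
    by rewrite [RHS]/= -val_eqE /=; have := ltn_ord r; rewrite {2}w01 ltnS leqn0.
  rewrite expr0 scale1r; set x := y _ => E.
  have Sx : S (N * w0)%N x.
    apply/(weight_ge_arc w w0_gt0 pwE); rewrite w01 muln1 -E.
    congr (_ *: _); apply/mpolyP => a.
    rewrite mcoeff_map_mpoly mcoeffZ. exact: fps_shiftK.
  exists N, x; split=> //; apply: (qs_cancel flI qI (n := (N * w0)%N)).
  apply: etrans (esym (arc_fracE w0_gt0 pwE q Sx)).
  apply: etrans (esym (q_scale q _ _)) _; apply: (congr1 q).
  by apply: etrans _ E; rewrite w01 muln1.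
rewrite fker //; split=> [Jx|[k]]; last by move/(strict_transform_shift k Sx).
by exists 0%N; apply/strict_transform_shift.
Qed.

Hypothesis OXv_normal : integrally_closed OXv.
Variables (Och OchS : comNzRingType) (frac : nat -> P -> Och)
  (j : {rmorphism Och -> OchS}) (js : {rmorphism fps C -> OchS}).
Hypotheses (chF : chart_ring S bl tP w0 frac)
  (bcF : is_base_change (fun c => frac 0%N c%:MP) pw j js).

Let frac_surj : forall b, exists k x, S (k * w0)%N x /\ b = frac k x.
Proof. by case: chF. Qed.

Let frac_map := strict_chart_map chF.
Let S1 : S 0%N 1. Proof. exact: weight_ge_all. Qed.
Let SD n x y : S n x -> S n y -> S n (x + y). Proof. exact: weight_geD. Qed.
Let SN n x : S n x -> S n (- x). Proof. exact: weight_geN. Qed.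
Let SM n k x y : S n x -> S k y -> S (n + k)%N (x * y). Proof. exact: weight_geM. Qed.
Let St : S w0 tP. Proof. exact: weight_ge_t. Qed.

(** A scalar in the image of [pw] can be moved to the factor [Och]; only the basis elements s^r with
    [r < w0] remain on the other side. *)
Lemma base_change_slices x : exists b : 'I_w0 -> Och,
  x = \sum_(r < w0) js (s ^+ r) * j (b r).
Proof.
have [e ->] := base_change_generated bcF x.
exists (fun r => \sum_(p <- e) p.1 * frac 0 (arc_slice w0 r p.2)%:MP).
under [RHS]eq_bigr => r _ do rewrite rmorph_sum mulr_sumr.
rewrite exchange_big /=; apply: eq_bigr => p _.
rewrite [in LHS](arc_sliceP w0_gt0 pwE p.2) rmorph_sum mulr_sumr.
apply: eq_bigr => r _; case: bcF => jE _.
by rewrite !rmorphM jE mulrCA.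
Qed.

Lemma common_denominator (b : 'I_w0 -> Och) : exists N (x : 'I_w0 -> P),
  forall r, S (N * w0)%N (x r) /\ b r = frac N (x r).
Proof.
have [k kP] := choice (fun r => chart_denominator S1 SM St frac_map frac_surj (b r)).
have [x xP] := choice (fun r => kP r _ (@leq_bigmax 'I_w0 k r)).
by exists (\max_r k r)%N, x.
Qed.

Lemma blow_z i : beta 'X_i = s ^+ w i *: 'X_i.
Proof.
apply/mpolyP => a; rewrite mcoeff_blow mcoeffZ !mcoeffX rmorph_nat.
by case: eqP => [<-|_]; rewrite ?wdegU // !mulr0.
Qed.

Lemma arc_normalization : exists nu : {rmorphism OchS -> OXv},
  [/\ forall c, nu (js c) = q c%:MP, forall f, nu (j (frac 0 f)) = q (beta f)
    & is_normalization nu].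
Proof.
have [h [_ hE]] := chart_hom S1 SD SN SM St frac_map arc_chart_map frac_surj.
pose qC : {rmorphism fps C -> OXv} := q \o @mpolyC l (fps C).
have h0 f : h (frac 0 f) = q (beta f).
  rewrite hE ?mul0n; last exact: weight_ge_all.
  exact: (arc_frac0E w w0_gt0 pwE q f).
have hC c : h (frac 0 c%:MP) = qC (pw c) by rewrite h0 blowC.
have [nu [nuj nujs _]] := (proj2 bcF) OXv h qC hC.
have nu_js c : nu (js c) = q c%:MP := nujs c.
have nu_j f : nu (j (frac 0 f)) = q (beta f) by rewrite nuj h0.
have nzd N : nonzerodiv (nu (js (s ^+ N))).
  by rewrite nu_js; apply: (qs_nonzerodiv flI qI).
(* Over a common denominator the relation puts a sum of slices into [I], and then each numerator
   separately lies in [J]. *)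
have nu0 x : nu x = 0 -> x = 0.
  have [b ->] := base_change_slices x; have [N [y yP]] := common_denominator b.
  rewrite rmorph_sum => E.
  have Iy : I (\sum_(r < w0) s ^+ r *: beta (y r)).
    apply/(q_eq0 qI); rewrite rmorph_sum.
    apply: etrans (etrans (congr1 ( *%R (q (s ^+ (N * w0))%:MP)) E) (mulr0 _)).
    rewrite mulr_sumr.
    apply: eq_bigr => r _; have [Sy bE] := yP r.
    apply: etrans (q_scale q _ _) _; rewrite rmorphM nuj nu_js bE hE // mulrCA.
    by congr (_ * _); apply: esym; apply: (arc_fracE w0_gt0 pwE q Sy).
  have Jy := arc_decomp_mem w0_gt0 pwE idJ flJ I_gen Iy.
  apply: big1 => r _; have [Sy ->] := yP r; case: frac_map => _ _ _ ker.
  by have /ker -> := Jy r; rewrite // rmorph0 mulr0.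
have nu_inj : injective nu.
  move=> x y xy; apply/eqP; rewrite -subr_eq0; apply/eqP/nu0.
  by rewrite rmorphB xy subrr.
exists nu; split=> //; split=> // y.
  have [g <-] : exists g, q g = y by case: qI => + _; apply.
  have intX i : integralOver nu (q 'X_i).
    pose c := j (frac (w i) ('X_i ^+ w0)).
    exists ('X^w0 - c%:P); first exact: monicXnsubC.
    rewrite rmorphB /= map_polyXn map_polyC rootE !hornerE subr_eq0 /=.
    have Sx : S (w i * w0)%N ('X_i ^+ w0).
      by rewrite mulnC; apply: (weight_geXn w0_gt0); apply: weight_ge_z.
    rewrite nuj hE //; apply/eqP; apply: (qs_cancel flI qI (n := (w i * w0)%N)).
    apply: etrans (esym (arc_fracE w0_gt0 pwE q Sx)).
    have bE : beta ('X_i ^+ w0) = s ^+ (w i * w0) *: 'X_i ^+ w0.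
      apply: etrans (rmorphXn _ _ _) _; apply: etrans (congr1 (fun x => x ^+ w0) (blow_z i)) _.
      by rewrite exprZn -exprM.
    apply: esym; apply: etrans (congr1 q bE) _.
    apply: etrans (q_scale q _ _) _.
    by rewrite [X in _ * X]rmorphXn.
  have [p p_monic /rootP p0] : integralOver nu (q g).
    elim/mpolyind: g => [|c a p _ _ intp]; first by rewrite rmorph0; apply: integral0.
    rewrite rmorphD; apply: integral_add => //.
    rewrite q_scale -nu_js; apply: integral_mul; first exact: integral_id.
    rewrite mpolyXE_id rmorph_prod; elim/big_ind: _ => [|x x' intx intx'|i _].
    - exact: integral1.
    - exact: integral_mul.
    elim: (a i) => [|k IHk]; first by rewrite expr0 rmorph1; apply: integral1.
    by rewrite exprS rmorphM; apply: integral_mul.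
  (* The monic [p] is split into its leading power, of exponent [(size p).-1], and the lower
     terms. *)
  have sz : (size p).-1.+1 = size p by rewrite prednK // size_poly_gt0 monic_neq0.
  exists (size p).-1, (fun i => p`_i); rewrite -[RHS]p0.
  have szp : (size (map_poly nu p) <= size p)%N by apply: size_poly.
  rewrite (horner_coef_wide _ szp) -sz big_ord_recr /= addrC.
  have lp : nu p`_(size p).-1 = 1 by rewrite -[p`__]/(lead_coef p) (eqP p_monic) rmorph1.
  rewrite coef_map; congr (_ + _); first by apply: etrans (esym (mul1r _)) (congr1 ( *%R^~ _) (esym lp)).
  by apply: eq_bigr => i _; rewrite coef_map.
have [g <-] : exists g, q g = y by case: qI => + _; apply.
have [N [x E]] := arc_frac_surj w w0_gt0 pwE q g.
(* Birationality: the slice decomposition of [g] needs only a power of [s] as denominator. *)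
exists (js (s ^+ N)), (\sum_(r < w0) js (s ^+ r) * j (frac 0 (x r))); split=> //.
  move=> z z0; apply: nu_inj; rewrite rmorph0; apply: (nzd N).
  by rewrite -rmorphM z0 rmorph0.
rewrite nu_js E rmorph_sum; apply: eq_bigr => r _.
by rewrite rmorphM nu_js nu_j.
Qed.

End ArcNormalization.

(** * Equations of the family along an arc *)

Section ArcIdeal.
Variables (R : realType) (l r : nat).
Local Notation C := (R[i]).
Variables (tau : set 'rV[R]_r) (u : 'I_l -> 'rV[int]_r).
Variables (ST : comAlgType C) (tt : {lrmorphism fps C -> ST}).
Variables (chi : 'rV[int]_r -> ST).
Variables (H : param_scheme R u) (F : H ST) (JT : set {mpoly (fps C)[l]}).
Hypothesis torus_ideal : forall (A : comAlgType C) (y : {lrmorphism ST -> A}),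
  (forall a, dual_monoid tau a -> exists b, y (chi a) * b = 1) ->
  par_ideal (par_pull y F) =
  ideal_gen [set rescale (fun i => y (chi (u i))) (map_mpoly (y \o tt) f) | f in JT].
Variables (v : 'rV[int]_r) (w : 'I_l -> nat).
Hypotheses (hw : forall i, (w i)%:Z = dotp (u i) v) (u_dual : forall i, dual_monoid tau (u i)).
Variables (D : idomainType) (f : {rmorphism ST -> fps D}) (psi : {rmorphism fps C -> fps D}).
Hypotheses (f_tt : forall c, f (tt c) = psi c)
  (f_chi : forall a, dual_monoid tau a -> f (chi a) = fpsX D ^+ `|dotp a v|%N)
  (flI : flat_quotient (base_change_ideal f (par_ideal F))).

Let torus_gens : [set rescale (fun i => f (chi (u i))) (map_mpoly (f \o tt) j) | j in JT] =
  [set blow w psi j | j in JT].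
Proof.
have jE j : rescale (fun i => f (chi (u i))) (map_mpoly (f \o tt) j) = blow w psi j.
  have chi_s : (fun i => f (chi (u i))) = fun i => fpsX D ^+ w i.
    by apply/funext => i; rewrite f_chi // -hw.
  rewrite blow.unlock.
  apply: etrans (congr1 (fun g => rescale g (map_mpoly (f \o tt) j)) chi_s) _.
  apply: (congr1 (rescale _)).
  exact: (@eq_map_mpoly _ _ (f \o tt) psi).
by apply/seteqP; split=> _ [j Jj <-]; exists j; rewrite ?jE.
Qed.

Let s_neq0 : fpsX D != 0. Proof. exact: fpsX_neq0. Qed.

Let chiE a : dual_monoid tau a -> exists e, f (chi a) = fpsX D ^+ e.
Proof. by move=> ta; exists `|dotp a v|%N; apply: f_chi. Qed.

(** For chi^a |-> s^<a, v> the torus equations are those obtained by z_i = s^(w_i) z'_i. The ring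
    [D] is C for the given arc and C[X] for its universal version. *)
Lemma arc_ideal_gen g : base_change_ideal f (par_ideal F) g ->
  exists e, ideal_gen [set blow w psi j | j in JT] (fpsX D ^+ e *: g).
Proof.
move=> Ig; have [e ge] := pull_sub_torus torus_ideal s_neq0 chiE Ig.
by exists e; rewrite -torus_gens.
Qed.

Lemma arc_ideal_blow j : JT j -> base_change_ideal f (par_ideal F) (blow w psi j).
Proof.
move=> Jj; have [|e ge] := torus_sub_pull torus_ideal s_neq0 chiE (g := blow w psi j).
  by rewrite torus_gens; apply: mem_ideal_gen; exists j.
apply: flat_torsion_free ge => //; exact: fpsXn_nonzerodiv.
Qed.

End ArcIdeal.

Lemma power_mapE (A : comNzRingType) (d : nat) (pw : {rmorphism fps A -> fps A}) :
    (0 < d)%N -> (forall a, pw a%:A = a%:A) -> pw (fpsX A) = fpsX A ^+ d ->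
  forall f j, fcoef (pw f) j = if (d %| j)%N then fcoef f (j %/ d) else 0.
Proof.
move=> d_gt0 pwA pwX f j.
rewrite (@fps_dil_uniq _ _ idfun 1 d d_gt0 pw pwA) ?scale1r //=.
by case: ifP; rewrite ?expr1n ?mulr1.
Qed.

Lemma alg_lrmorphism (k : comNzRingType) (A B : comAlgType k) (g : {rmorphism A -> B}) :
  (forall c, g c%:A = c%:A) -> exists y : {lrmorphism A -> B}, y =1 g.
Proof.
move=> gA; have gZ : scalable g by move=> c x; rewrite -mulr_algl rmorphM gA mulr_algl.
pose m := GRing.isScalable.Build k A B *:%R g gZ.
by exists (HB.pack (g : A -> B) g m : {lrmorphism A -> B}).
Qed.

(** * Maps into the stratum V(tau') *)

Section Stratum.
Variables (R : realType) (r : nat).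
Local Notation C := (R[i]).
Variables (tau : set 'rV[R]_r) (m : 'rV[int]_r) (ST : comAlgType C).
Variables (tt : {lrmorphism fps C -> ST}) (chi : 'rV[int]_r -> ST) (XX : ST).
Hypotheses (hST : toric_ring tau m tt chi XX) (m_dual : dual_monoid tau m) (m_neq0 : m != 0).

(** As [m] is nonzero, t = X chi^m vanishes on the stratum, so a series in t acts through its
    constant term. With this, the universal property of [ST] shows that a stratum map is determined
    by the image of X. *)
Lemma stratum_map_tt (A : comAlgType C) (y : {lrmorphism ST -> A}) x f :
  stratum_map tau chi XX y x -> y (tt f) = (fcoef f 0)%:A.
Proof.
move=> [y_chi _]; have [[_ _ ttX] _] := hST.
have fE : f = (fcoef f 0)%:A + fpsX C ^+ 1 * fps_shift 1 (f - (fcoef f 0)%:A).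
  rewrite fps_shiftE; first by rewrite addrC subrK.
  by case=> // _; rewrite fcoefD fcoefN fcoef_alg subrr.
have yX : y (tt (fpsX C)) = 0.
  rewrite ttX; apply: etrans (rmorphM y _ _) _.
  exact: etrans (congr1 ( *%R _) (y_chi _ m_dual m_neq0)) (mulr0 _).
apply: etrans (congr1 (y \o tt) fE) _; rewrite rmorphD rmorphM /= yX mul0r addr0.
by rewrite !linearZ /= !rmorph1.
Qed.

Lemma stratum_map_uniq (A : comAlgType C) (y y' : {lrmorphism ST -> A}) x :
  stratum_map tau chi XX y x -> stratum_map tau chi XX y' x -> y =1 y'.
Proof.
move=> hy hy'; have [[chi1 chiM ttX] univ] := hST.
have [|h [_ _ _] h_uniq] := univ A (y \o tt) (y \o chi) (y XX).
  split=> [|a b ta tb|] /=; first by rewrite chi1 rmorph1.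
    by rewrite chiM // rmorphM.
  by rewrite ttX rmorphM.
have yh : y =1 h by apply: h_uniq.
suff y'h : y' =1 h by move=> z; rewrite yh y'h.
apply: h_uniq; split=> [f|a ta|].
- by rewrite (stratum_map_tt f hy') /= (stratum_map_tt f hy).
- have [-> | a0] := eqVneq a 0; first by rewrite /= chi1 !rmorph1.
  by rewrite /= (proj1 hy) // (proj1 hy').
- by rewrite (proj2 hy) (proj2 hy').
Qed.

End Stratum.

Theorem theorem3p2 (R : realType) (l n r : nat)
  (* the base curve *)
  (OD : comAlgType R[i]) (pt0 : {lrmorphism OD -> (R[i])^o}) (t : OD)
  (taylor : {lrmorphism OD -> fps R[i]})
  (hcurve : smooth_affine_curve OD)
  (hunif : uniformized pt0 t taylor)
  (* the family *)
  (J : set {mpoly OD[l]})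
  (FJ : fieldType) (rhoJ : {rmorphism {mpoly OD[l]} -> FJ})
  (hfam : gorenstein_lt_family n J rhoJ)
  (hdeg : strictly_degenerating pt0 n J)
  (* the minimizing valuation of the central fiber *)
  (FX : fieldType) (rhoX : {rmorphism {mpoly R[i][l]} -> FX}) (vX : FX -> R)
  (xi : 'rV[R]_r) (u : 'I_l -> 'rV[int]_r)
  (GW : comNzRingType) (symW : R -> FX -> GW)
  (hmin : minimizer_data n (base_change_ideal pt0 J) rhoX vX xi u symW)
  (* the toric base, the parameter scheme and the equivariant morphism F *)
  (tau : set 'rV[R]_r) (m : 'rV[int]_r)
  (ST : comAlgType R[i]) (tt : {lrmorphism fps R[i] -> ST})
  (chi : 'rV[int]_r -> ST) (XX : ST)
  (H : param_scheme R u) (F : H ST)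
  (hbub : bubble_data tau m tt chi XX n xi
            (base_change_ideal pt0 J) (base_change_ideal taylor J) F)
  (* the primitive vector (v, w0), the weights and phi *)
  (v : 'rV[int]_r) (w0 : nat) (w : 'I_l -> nat)
  (hv : cone_interior tau (realv R v))
  (hprim : forall d : nat, (forall i, (d%:Z %| v 0%R i)%Z) -> (d %| w0)%N -> d = 1%N)
  (hw0 : (0 < w0)%N) (hw0E : w0%:Z = dotp m v)
  (hw : forall i, (w i)%:Z = dotp (u i) v)
  (phi : {lrmorphism ST -> fps R[i]})
  (hphi : arc_map tau tt chi XX v w0 phi) :
  let JT := base_change_ideal taylor J in
  let rees := @weight_ge R l w0 w in
  let bl := strict_transform w0 w JT in
  let t_bl : {mpoly (fps R[i])[l]} := (fpsX R[i])%:MP in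
  (* (1) *)
  (forall p, proj_point rees p -> in_Vplus bl p ->
     (~ in_Vplus (strict_transform w0 w (central_fiber JT)) p <-> ~ p w0 t_bl)) /\
  (forall (OXv : comNzRingType) (q : {rmorphism {mpoly (fps R[i])[l]} -> OXv}),
     is_quotient (par_ideal (par_pull phi F)) q ->
     (w0 = 1%N ->
        exists frac : nat -> {mpoly (fps R[i])[l]} -> OXv,
          chart_ring rees bl t_bl w0 frac /\
          forall f, frac 0%N f = q (blow_down w (phi \o tt) f)) /\
     (forall (Och OchS : comNzRingType) (frac : nat -> {mpoly (fps R[i])[l]} -> Och)
             (j : {rmorphism Och -> OchS}) (js : {rmorphism fps R[i] -> OchS}),
        chart_ring rees bl t_bl w0 frac ->
        is_base_change (fun c => frac 0%N c%:MP) (phi \o tt) j js ->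
        exists nu : {rmorphism OchS -> OXv},
          [/\ forall c, nu (js c) = q c%:MP,
              forall f, nu (j (frac 0%N f)) = q (blow_down w (phi \o tt) f)
            & is_normalization nu])) /\
  (* (2) *)
  (forall (rV : {lrmorphism ST -> {poly R[i]}}),
     stratum_map tau chi XX rV 'X ->
   forall (OW : comNzRingType) (q : {rmorphism {mpoly {poly R[i]}[l]} -> OW}),
     is_quotient (par_ideal (par_pull rV F)) q ->
     (forall (G : comNzRingType) (sym : nat -> FJ -> G),
        let filt := local_filtration w0 w pt0 taylor rhoJ in
        graded_quotient filt (fun lam => filt lam.+1) sym ->
        exists psi : {rmorphism OW -> G},
          [/\ bijective psi,
              psi (q ('X)%:MP) = sym w0 (rhoJ t%:MP),
              forall c : R[i], psi (q (c%:P)%:MP) = sym 0%N (rhoJ (c%:A)%:MP)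
            & forall i, psi (q 'X_i) = sym (w i) (rhoJ 'X_i)]) /\
     (forall (G : comNzRingType) (sym : nat -> {mpoly (fps R[i])[l]} -> G),
        graded_quotient rees (cone_ideal rees (exceptional_divisor w0 w JT)) sym ->
        exists psi : {rmorphism OW -> G},
          [/\ bijective psi,
              psi (q ('X)%:MP) = sym w0 t_bl,
              forall c : R[i], psi (q (c%:P)%:MP) = sym 0%N (c%:A)%:MP
            & forall i, psi (q 'X_i) = sym (w i) 'X_i])).
Proof.
move=> JT rees bl t_bl.
have [[reg u_pos _ m_int hST] _ torus_ideal [_ special] _] := hbub.
have [[idJ [rhoJP _]] _ _ fibers J_origin] := hfam.
have [_ _ taylor_t taylor0] := hunif.
have idJT : ideal JT by apply: (base_changeP taylor).
have u_dual i : dual_monoid tau (u i).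
  by apply: (pos_interior_dual reg hv) => x /u_pos.
have m_dual : dual_monoid tau m by apply: interior_sub m_int.
(* Otherwise [w0 = <m, v>] would be 0. *)
have m_neq0 : m != 0.
  apply: contraTneq hw0 => m0; rewrite -eqn0Ngt -eqz_nat hw0E m0 /dotp big1 // => i _.
  by rewrite mxE mul0r.
have w_gt0 i : (0 < w i)%N.
  by have := u_pos _ i hv; rewrite dotp_realv -hw ltr0z.
have flJ : flat_quotient JT := flat_family hST torus_ideal u_dual idJT.
have [f [f_tt f_chi f_X flI]] := toric_arc F hST hv hw0 hw0E.
have idI : ideal (base_change_ideal f (par_ideal F)) by apply: base_changeP.
have /(_ hw0) I_gen := arc_ideal_gen torus_ideal hw u_dual f_tt f_chi.
have /(_ hw0) blow_I := arc_ideal_blow torus_ideal hw u_dual f_tt f_chi flI.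
split.
  move=> p pp pV; exact: (strict_transform_central hw0 idJT flI flJ I_gen blow_I pp pV).
split.
  move=> OXv q qI.
  pose pw : {rmorphism fps R[i] -> fps R[i]} := phi \o tt.
  have [phiX phi_chi phi_t] := hphi.
  have pwA a : pw a%:A = a%:A by rewrite /pw /= linearZ rmorph1 linearZ rmorph1.
  have pwE := power_mapE hw0 pwA phi_t.
  have bdE g : blow_down w (phi \o tt) g = blow w pw g by rewrite blow.unlock.
  move: qI; rewrite par_pullE => qI.
  have flA : flat_quotient (base_change_ideal phi (par_ideal F)).
    by rewrite -par_pullE; apply: par_flat.
  have idA : ideal (base_change_ideal phi (par_ideal F)) by apply: (base_changeP phi).
  have A_gen := arc_ideal_gen (f := phi) (psi := pw) torus_ideal hw u_dual
    (fun _ => erefl) phi_chi.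
  have blow_A := arc_ideal_blow (f := phi) (psi := pw) torus_ideal hw u_dual
    (fun _ => erefl) phi_chi flA.
  (* At s = 0 the arc passes through the point X = 1 of the stratum, since [<a, v>] is positive for
     every nonzero [a] in the dual monoid; the fiber there is the log terminal one of the bubble. *)
  have [y0 y0E] : exists y0 : {lrmorphism ST -> R[i]^o}, y0 =1 @fps_coef0 R[i] \o phi.
    apply: (@alg_lrmorphism R[i] ST R[i]^o (@fps_coef0 R[i] \o phi)) => c.
    by rewrite /= linearZ rmorph1 /fps_coef0 fcoef_alg [RHS]mulr1.
  have y0s : stratum_map tau chi XX y0 1.
    split=> [a ta a0|]; rewrite y0E /=; last by rewrite phiX rmorph1.
    have := dual_gt0 ta hv a0; rewrite phi_chi // /fps_coef0 fcoefXn.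
    by case: (dotp a v) => // -[].
  have [[F0 [rho0 [[rho0P _] _ _ _]]] _] := special y0 y0s.
  have rho0P' g : rho0 g = 0 <->
      base_change_ideal (@fps_coef0 R[i]) (base_change_ideal phi (par_ideal F)) g.
    rewrite rho0P par_pullE (base_change_comp phi (@fps_coef0 R[i])).
    by have -> : y0 = @fps_coef0 R[i] \o phi :> (ST -> R[i]) by apply/funext.
  (* The C((s))-valued point of the curve given by Taylor expansion followed by t = s^w0. *)
  have [K [rho [[rhoP _] _ [nrm _ _] _]]] :=
    fibers _ (@tofrac (fps R[i]) \o (pw \o taylor)).
  have nOXv := arc_normal idA flA A_gen blow_A qI rhoP nrm rho0P'.
  split=> [w01|Och OchS frac j js chF bcF].
    exists (arc_frac w0 w pw q); split.
      exact: (arc_chart_ring hw0 pwE idJT flA flJ A_gen blow_A qI w01).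
    by move=> g; rewrite bdE; apply: (arc_frac0E w hw0 pwE q g).
  have [nu [nujs nuj nuN]] :=
    arc_normalization hw0 pwE idJT flA flJ A_gen blow_A qI nOXv chF bcF.
  by exists nu; split=> // g; rewrite bdE; apply: nuj.
move=> rV rV_str OW q; pose B := {poly R[i]}.
(* The universal arc at s = 0 is a stratum map with X |-> X, hence agrees with [rV]; the restriction
   to the stratum is therefore the special fiber [IV]. *)
have [g0 g0E] : exists g0 : {lrmorphism ST -> B}, g0 =1 @fps_coef0 B \o f.
  apply: (@alg_lrmorphism R[i] ST B (@fps_coef0 B \o f)) => c.
  have -> : c%:A = tt c%:A by rewrite linearZ rmorph1.
  rewrite /= f_tt fps_dilZ ?rmorph1 //; apply: etrans (fcoef_alg _ _) _.
  by rewrite -mul_polyC mulr1.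
have g0_str : stratum_map tau chi XX g0 'X.
  split=> [a ta a0|]; rewrite g0E /=; last by rewrite f_X /fps_coef0 fcoef_alg.
  have := dual_gt0 ta hv a0; rewrite f_chi // /fps_coef0 fcoefXn.
  by case: (dotp a v) => // -[].
pose IV := [set map_mpoly (@fps_coef0 B) g | g in base_change_ideal f (par_ideal F)].
have IVE : par_ideal (par_pull rV F) = IV.
  rewrite par_pullE; have -> : rV = @fps_coef0 B \o f :> (ST -> B).
    apply/funext => b; rewrite -g0E.
    exact: (stratum_map_uniq hST m_dual m_neq0 rV_str g0_str).
  rewrite -(base_change_comp f (@fps_coef0 B)) base_change_surj // => b.
  by exists b%:A; apply: fcoef_alg.
have flV : flat_quotient IV by rewrite -IVE; apply: par_flat.
have idV : ideal IV by rewrite -IVE; apply: par_idealP.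
(* The restricted family is flat over C[X], so X is a nonzerodivisor on it. *)
have IV_X e h : IV ('X%:MP ^+ e * h) -> IV h.
  rewrite -rmorphXn /= mul_mpolyC; apply: flat_torsion_free => // b /eqP.
  by rewrite mulf_eq0 expf_eq0 polyX_eq0 andbF => /eqP.
rewrite IVE => qI; split=> G sym; last first.
  exact: (cone_iso hw0 idJT flI flJ I_gen blow_I IV_X idV qI).
apply: (local_iso hw0 w_gt0 taylor_t taylor0 idJ rhoJP J_origin idV _ _ qI).
  exact: (symbol_mem hw0 idJT flI I_gen blow_I).
exact: (IV_hpart hw0 idJT I_gen).
Qed.
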